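(* Let $\lambda_n>0$ and let $\hat{\mathbf R}=\mathbf I+\hat{\mathbf R}_0$ be the estimated correlation operator matrix on $\mathcal H=\mathcal H_1\times\cdots\times\mathcal H_p$. For Hilbert-Schmidt operators $\mathbf A$ on $\mathcal H$ with $\mathbf I+\mathbf A>\mathbf 0$ let $$\mathcal F[\mathbf A]=\mathrm{tr}(\mathbf A\hat{\mathbf R}_0)-\log\det\nolimits_2(\mathbf I+\mathbf A)+\lambda_n\|\mathbf A_0\|_{2,1}.$$ Then $$\min_{\mathbf A}\{\mathcal F[\mathbf A]:\mathbf I+\mathbf A>\mathbf 0\}=-2\min_{\mathbf B}\{\mathcal D[\mathbf B_0]:\mathrm{dg}\,\mathbf B=\mathbf 0\text{ and }\|\mathbf B_0-\hat{\mathbf R}_0\|_{2,\infty}\le\lambda_n\}.$$ Furthermore, if $\hat{\mathbf H}=\arg\min_{\mathbf A}\mathcal F[\mathbf A]$ and $\tilde{\mathbf R}=\mathbf I+\tilde{\mathbf R}_0$, where $\tilde{\mathbf R}_0$ is the minimizer $\arg\min_{\mathbf B}\mathcal D[\mathbf B_0]$ of the constrained problem on the right-hand side, then $\tilde{\mathbf R}^{-1}=\mathbf I+\hat{\mathbf H}$.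
   Context: $\mathcal H_1,\dots,\mathcal H_p$ are real separable Hilbert spaces and $\mathcal H$ has inner product $\langle\mathbf f,\mathbf g\rangle=\sum_j\langle f_j,g_j\rangle$. Operator matrices $\mathbf A=[\mathbf A_{ij}]$ have entries $\mathbf A_{ij}:\mathcal H_j\to\mathcal H_i$; $\mathrm{dg}\,\mathbf A$ is the block-diagonal part and $\mathbf A_0=\mathbf A-\mathrm{dg}\,\mathbf A$. $\|\cdot\|_2$ is the Hilbert-Schmidt norm, $\|\mathbf A\|_{2,1}=\sum_{i,j}\|\mathbf A_{ij}\|_2$, $\|\mathbf A\|_{2,\infty}=\max_{i,j}\|\mathbf A_{ij}\|_2$. $\det_2(\mathbf I+\mathbf A)=\prod_j(1+\lambda_j)e^{-\lambda_j}$ is the Carleman-Fredholm determinant, $\lambda_j$ the eigenvalues of $\mathbf A$. $\mathbf I+\mathbf A>\mathbf 0$ means that $\mathbf A$ is self-adjoint with all eigenvalues $>-1$. The estimated correlation operator matrix is $\hat{\mathbf R}=\mathbf I+\hat{\mathbf R}_0$ with $\hat{\mathbf R}_0=[\epsilon_n\mathbf I+\mathrm{dg}\,\hat{\mathbf C}]^{-1/2}\hat{\mathbf C}_0[\epsilon_n\mathbf I+\mathrm{dg}\,\hat{\mathbf C}]^{-1/2}$, where $\epsilon_n$ is a tuning parameter and $\hat{\mathbf C}$ is a given estimate of the covariance operator of a second-order random element in $\mathcal H$; $\hat{\mathbf R}_0$ is Hilbert-Schmidt. $\mathcal D[\mathbf B_0]$ is the Kullback-Leibler divergence, with respect to the product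 of its marginals, of a zero-mean Gaussian measure on $\mathcal H$ with correlation operator $\mathbf I+\mathbf B_0$ (where $\mathbf B_0$ is Hilbert-Schmidt with zero diagonal entries and $\mathbf I+\mathbf B_0>\mathbf 0$); it equals $\mathcal D[\mathbf B_0]=-\frac12\log\det_2(\mathbf I+\mathbf B_0)$. The minimum on the right-hand side is over such $\mathbf B_0$. *)

(* Defs.v *)
From HB Require Import structures.
From mathcomp Require Import all_boot all_order all_algebra.
From mathcomp Require Import all_classical all_reals all_analysis.
From mathcomp Require Import ring lra.

Set Implicit Arguments.
Unset Strict Implicit.
Unset Printing Implicit Defensive.

Import Order.TTheory GRing.Theory Num.Theory.
Import numFieldNormedType.Exports.

Local Open Scope classical_set_scope.
Local Open Scope ring_scope.

HB.mixin Record NormedModule_isPreHilbert (R : realType) H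
    & NormedModule R H := {
  inner : H -> H -> R ;
  innerC : forall x y, inner x y = inner y x ;
  innerDl : forall x y z, inner (x + y) z = inner x z + inner y z ;
  innerZl : forall (a : R) x y, inner (a *: x) y = a * inner x y ;
  inner_norm : forall x, inner x x = `|x| ^+ 2
}.

#[short(type="preHilbertType")]
HB.structure Definition PreHilbert (R : realType) :=
  {H of NormedModule R H & NormedModule_isPreHilbert R H}.

#[short(type="hilbertType")]
HB.structure Definition Hilbert (R : realType) :=
  {H of CompleteNormedModule R H & NormedModule_isPreHilbert R H}.

HB.factory Record Lmodule_isPreHilbert (R : realType) H & GRing.Lmodule R H := {
  inner : H -> H -> R ;
  innerC : forall x y, inner x y = inner y x ;
  innerDl : forall x y z, inner (x + y) z = inner x z + inner y z ;
  innerZl : forall (a : R) x y, inner (a *: x) y = a * inner x y ;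
  inner_ge0 : forall x, 0 <= inner x x ;
  inner_eq0 : forall x, inner x x = 0 -> x = 0
}.

HB.builders Context R H & Lmodule_isPreHilbert R H.

Let n (x : H) : R := Num.sqrt (inner x x).

Let innerDr x y z : inner x (y + z) = inner x y + inner x z.
Proof. by rewrite innerC innerDl !(innerC x). Qed.

Let innerZr a x y : inner x (a *: y) = a * inner x y.
Proof. by rewrite innerC innerZl innerC. Qed.

Let n_sqr x : n x ^+ 2 = inner x x.
Proof. by rewrite sqr_sqrtr// inner_ge0. Qed.

Let cauchy_schwarz x y : inner x y <= n x * n y.
Proof.
have nx0 : 0 <= n x by exact: sqrtr_ge0.
have ny0 : 0 <= n y by exact: sqrtr_ge0.
have [y0|y0] := eqVneq (n y) 0.
  have -> : y = 0 by apply: inner_eq0; rewrite -n_sqr y0 expr0n.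
  rewrite -(scale0r (0 : H)) innerZr mul0r.
  by rewrite mulr_ge0// sqrtr_ge0.
have [x0|x0] := eqVneq (n x) 0.
  have -> : x = 0 by apply: inner_eq0; rewrite -n_sqr x0 expr0n.
  rewrite -(scale0r (0 : H)) innerZl mul0r.
  by rewrite mulr_ge0// sqrtr_ge0.
have := inner_ge0 (n y *: x - n x *: y).
rewrite -scaleNr !(innerDl, innerDr, innerZl, innerZr) -!n_sqr (innerC y x).
have xp : 0 < n x by rewrite lt_def x0.
have yp : 0 < n y by rewrite lt_def y0.
move=> h.
have : 0 <= (n x * n y) * (n x * n y - inner x y) by nra.
by rewrite pmulr_rge0 ?subr_ge0// mulr_gt0.
Qed.

Let ler_nD x y : n (x + y) <= n x + n y.
Proof.
have nx0 : 0 <= n x by exact: sqrtr_ge0.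
have ny0 : 0 <= n y by exact: sqrtr_ge0.
rewrite -(@ler_pXn2r _ 2)// ?nnegrE ?addr_ge0 ?sqrtr_ge0//.
rewrite n_sqr !(innerDl, innerDr) (innerC y x) sqrrD !n_sqr.
have := cauchy_schwarz x y; lra.
Qed.

Let nZ (l : R) x : n (l *: x) = `|l| * n x.
Proof.
by rewrite /n innerZl innerZr mulrA -expr2 sqrtrM ?sqr_ge0// sqrtr_sqr.
Qed.

Let n0_eq0 x : n x = 0 -> x = 0.
Proof. by move=> x0; apply: inner_eq0; rewrite -n_sqr x0 expr0n. Qed.

HB.instance Definition _ := Lmodule_isNormed.Build R H ler_nD nZ n0_eq0.

Let inner_norm x : inner x x = `|x| ^+ 2.
Proof. by rewrite -n_sqr. Qed.

HB.instance Definition _ := NormedModule_isPreHilbert.Build R H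
  innerC innerDl innerZl inner_norm.

HB.end.

Section product.
Variables (R : realType) (p : nat) (H : 'I_p -> hilbertType R).

(* A type of its own, so that the norm and topology are those of the inner
   product \sum_j <f_j, g_j> and not the product ones. *)
Definition hprod : Type := forall j : 'I_p, H j.

HB.instance Definition _ := gen_eqMixin hprod.
HB.instance Definition _ := gen_choiceMixin hprod.

Let add (f g : hprod) : hprod := fun j => f j + g j.
Let opp (f : hprod) : hprod := fun j => - f j.
Let zero : hprod := fun j => 0.
Let scale (a : R) (f : hprod) : hprod := fun j => a *: f j.

Let addA : associative add.
Proof. by move=> f g h; apply: functional_extensionality_dep => j; exact: addrA. Qed.
Let addC : commutative add.
Proof. by move=> f g; apply: functional_extensionality_dep => j; exact: addrC. Qed.
Let add0 : left_id zero add.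
Proof. by move=> f; apply: functional_extensionality_dep => j; exact: add0r. Qed.
Let addN : left_inverse zero opp add.
Proof. by move=> f; apply: functional_extensionality_dep => j; exact: addNr. Qed.

HB.instance Definition _ := GRing.isZmodule.Build hprod addA addC add0 addN.

Let scaleA a b f : scale a (scale b f) = scale (a * b) f.
Proof. by apply: functional_extensionality_dep => j; exact: scalerA. Qed.
Let scale1 : left_id 1 scale.
Proof. by move=> f; apply: functional_extensionality_dep => j; exact: scale1r. Qed.
Let scaleDr : right_distributive scale +%R.
Proof. by move=> a f g; apply: functional_extensionality_dep => j; exact: scalerDr. Qed.
Let scaleDl f : {morph scale^~ f : a b / a + b}.
Proof. by move=> a b; apply: functional_extensionality_dep => j; exact: scalerDl. Qed.

HB.instance Definition _ :=
  GRing.Zmodule_isLmodule.Build R hprod scaleA scale1 scaleDr scaleDl.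

Definition hprod_inner (f g : hprod) : R := \sum_j inner (f j) (g j).

Let hinnerC f g : hprod_inner f g = hprod_inner g f.
Proof. by apply: eq_bigr => j _; exact: innerC. Qed.
Let hinnerDl f g h : hprod_inner (f + g) h = hprod_inner f h + hprod_inner g h.
Proof. by rewrite -big_split; apply: eq_bigr => j _; exact: innerDl. Qed.
Let hinnerZl (a : R) f g : hprod_inner (a *: f) g = a * hprod_inner f g.
Proof. by rewrite /hprod_inner mulr_sumr; apply: eq_bigr => j _; exact: innerZl. Qed.
Let hinner_ge0 f : 0 <= hprod_inner f f.
Proof. by apply: sumr_ge0 => j _; rewrite inner_norm sqr_ge0. Qed.
Let hinner_eq0 f : hprod_inner f f = 0 -> f = 0.
Proof.
move=> /eqP; rewrite psumr_eq0; last by move=> j _; rewrite inner_norm sqr_ge0.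
move=> /allP f0; apply: functional_extensionality_dep => j.
have /eqP := f0 j (mem_index_enum j); rewrite inner_norm => /eqP.
by rewrite sqrf_eq0 normr_eq0 => /eqP.
Qed.

HB.instance Definition _ := Lmodule_isPreHilbert.Build R hprod
  hinnerC hinnerDl hinnerZl hinner_ge0 hinner_eq0.

Lemma hprod_normE (f : hprod) : `|f| ^+ 2 = \sum_j `|f j| ^+ 2.
Proof. by rewrite -inner_norm; apply: eq_bigr => j _; rewrite inner_norm. Qed.

Lemma ler_hprod_proj (f : hprod) j : `|f j| <= `|f|.
Proof.
rewrite -(@ler_pXn2r _ 2)// ?nnegrE// hprod_normE (bigD1 j)//=.
by rewrite lerDl sumr_ge0// => i _; rewrite sqr_ge0.
Qed.

Lemma ler_hprod_sum (f : hprod) : `|f| <= \sum_j `|f j|.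
Proof.
rewrite -(@ler_pXn2r _ 2)// ?nnegrE ?sumr_ge0// hprod_normE.
rewrite expr2 mulr_suml; apply: ler_sum => j _.
by rewrite expr2 ler_wpM2l// (bigD1 j)//= lerDl sumr_ge0.
Qed.

Let hprod_complete (F : set_system hprod) : ProperFilter F -> cauchy F -> cvg F.
Proof.
move=> FF cF.
have pF j : cauchy ((fun f : hprod => f j) @ F).
  apply/cauchy_ballP => e e0.
  have /cauchy_ballP /(_ e e0) := cF.
  rewrite !near_simpl => h; near_simpl; move: h; apply: filterS => -[f g] /=.
  rewrite -!ball_normE /=.
  exact: le_lt_trans (ler_hprod_proj (f - g) j).
pose l : hprod := fun j => lim ((fun f : hprod => f j) @ F).
have cl j : (fun f : hprod => f j) @ F --> l j.
  by apply: cauchy_cvg; exact: pF.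
apply/cvg_ex; exists l; apply/cvgrPdist_lt => e e0.
have d0 : 0 < e / p.+1%:R by rewrite divr_gt0// ltr0n.
have : \forall f \near F, forall j, `|l j - f j| < e / p.+1%:R.
  apply: filter_forall => j.
  by move/cvgrPdist_lt : (cl j) => /(_ _ d0).
apply: filterS => f lf.
apply: le_lt_trans (ler_hprod_sum _) _.
apply: (@le_lt_trans _ _ (\sum_(j < p) e / p.+1%:R)).
  by apply: ler_sum => j _; exact/ltW/lf.
rewrite sumr_const card_ord -(mulr_natr _ p) mulrAC ltr_pdivrMr ?ltr0n//.
by rewrite ltr_pM2l// ltr_nat.
Qed.

HB.instance Definition _ := Uniform_isComplete.Build hprod hprod_complete.

End product.

Definition separable (T : topologicalType) : Prop :=
  exists D : set T, countable D /\ dense D.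

(* Operators are bare functions; linearity and boundedness (that is,
   continuity) are always stated separately. *)
Section operators.
Variable R : realType.
Implicit Types U V : hilbertType R.

Definition orthonormal_set U (E : set U) : Prop :=
  (forall e, E e -> inner e e = 1) /\
  (forall e f, E e -> E f -> e <> f -> inner e f = 0).

(* [E] is a complete orthonormal system of the closed subspace [W]. *)
Definition orthobasis U (W E : set U) : Prop :=
  [/\ E `<=` W, orthonormal_set E &
      forall x, W x -> (forall e, E e -> inner x e = 0) -> x = 0].

(* An orthonormal basis of [U]; the norm and trace defined from it below do not
   depend on which one is chosen. *)
Definition onb U : set U := xget set0 (orthobasis [set: U]).
Arguments onb : clear implicits.

(* \|T\|_2^2 = \sum_k \|T e_k\|^2 *)
Definition hs_norm_sqr U V (T : U -> V) : \bar R :=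
  \esum_(e in onb U) (`|T e| ^+ 2)%:E.

Definition hilbert_schmidt U V (T : U -> V) : Prop :=
  [/\ linear T, continuous T & (hs_norm_sqr T < +oo)%E].

Definition hs_norm U V (T : U -> V) : R := Num.sqrt (fine (hs_norm_sqr T)).

(* tr T = \sum_k <T e_k, e_k>; [esum] is meant for nonnegative families, hence
   the positive and negative parts. For trace-class [T], in particular for a
   product of two Hilbert-Schmidt operators, both sums are finite. *)
Definition trace U (T : U -> U) : R :=
  let d := fun e : U => (inner (T e) e)%:E in
  fine (\esum_(e in onb U) d^\+%E e) - fine (\esum_(e in onb U) d^\-%E e).

Definition selfadjoint U (T : U -> U) : Prop :=
  forall x y, inner (T x) y = inner x (T y).

Definition nonneg_op U (T : U -> U) : Prop :=
  selfadjoint T /\ forall x, 0 <= inner (T x) x.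

Definition op_eigenvalue U (T : U -> U) (c : R) : Prop :=
  exists2 x, x != 0 & T x = c *: x.

(* I + A > 0, as a predicate on A *)
Definition id_plus_pos U (A : U -> U) : Prop :=
  selfadjoint A /\ forall c, op_eigenvalue A c -> -1 < c.

(* [lam] enumerates the nonzero eigenvalues of the compact self-adjoint operator
   [A] (which are real), each repeated according to its multiplicity, the
   dimension of its eigenspace. The zeros that may be interspersed contribute
   factors 1 to the determinant below. *)
Definition eigenvalue_seq U (A : U -> U) (lam : nat -> R) : Prop :=
  forall c, c != 0 -> exists2 E : set U,
    orthobasis [set x | A x = c *: x] E &
    (E #= [set j | lam j = c])%card.

(* det_2 (I + A) = \prod_j (1 + lam_j) e^(- lam_j), for [A] self-adjoint and
   Hilbert-Schmidt; the product converges absolutely, so the order of the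
   enumeration is immaterial. *)
Definition det2 U (A : U -> U) : R :=
  let lam := xget (fun=> 0) (eigenvalue_seq A) in
  limn (fun n => \prod_(0 <= j < n) ((1 + lam j) * expR (- lam j))).

(* T^(-1/2): the nonnegative [S] with S^2 = T^-1. *)
Definition inv_sqrt U (T : U -> U) : U -> U :=
  xget (fun=> 0) [set S | [/\ linear S, continuous S, nonneg_op S,
    cancel T (S \o S) & cancel (S \o S) T]].

End operators.

Definition minimizer (R : realType) (X : Type) (S : set X) (f : X -> R) (x : X) :
  Prop := S x /\ forall y, S y -> f x <= f y.

Section operator_matrices.
Variables (R : realType) (p : nat) (H : 'I_p -> hilbertType R).
Implicit Types A B C : hprod H -> hprod H.

(* A_ij : H_j -> H_i *)
Definition entry A (i j : 'I_p) : H j -> H i :=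
  fun x => A (@dfwith _ H (fun=> 0) j x) i.
Arguments entry : clear implicits.

Definition dg A : hprod H -> hprod H := fun f i => entry A i i (f i).

(* A_0 = A - dg A *)
Definition offdg A : hprod H -> hprod H := A \- dg A.

Definition norm21 A : R := \sum_i \sum_j hs_norm (entry A i j).

Definition norm2oo A : R :=
  \big[Num.max/0]_i \big[Num.max/0]_j hs_norm (entry A i j).

(* [eps I + dg C]^(-1/2) C_0 [eps I + dg C]^(-1/2) *)
Definition corr0 (eps : R) C : hprod H -> hprod H :=
  let S := inv_sqrt (fun f => eps *: f + dg C f) in S \o offdg C \o S.

(* The objective F[A], with [R0] in the role of the estimated R_0. *)
Definition glasso (lam : R) (R0 A : hprod H -> hprod H) : R :=
  trace (A \o R0) - ln (det2 A) + lam * norm21 (offdg A).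

Definition glasso_dom : set (hprod H -> hprod H) :=
  [set A | hilbert_schmidt A /\ id_plus_pos A].

(* D[B_0]: the Kullback-Leibler divergence of a centred Gaussian measure with
   correlation operator I + B_0 from the product of its marginals is
   - 1/2 log det_2 (I + B_0). *)
Definition KLdiv (B0 : hprod H -> hprod H) : R := - 2^-1 * ln (det2 B0).

Definition KLdiv_dom (lam : R) (R0 : hprod H -> hprod H) :
    set (hprod H -> hprod H) :=
  [set B | [/\ hilbert_schmidt B, id_plus_pos B, dg B = (fun=> 0) &
    norm2oo (offdg B \- R0) <= lam]].

End operator_matrices.

(* Main.v *)
Require Import Defs.
From HB Require Import structures.
From mathcomp Require Import all_boot all_order all_algebra finmap.
From mathcomp Require Import all_classical all_reals all_analysis.
From mathcomp Require Import ring lra.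

(* Write [G A = - log det_2 (I + A)]. Let [u_j], [v_k] be eigenbases of [A] and
   [B], with eigenvalues [a_j], [b_k]. Since the weights [<u_j, v_k>^2] are
   doubly stochastic,
     G A + G B + tr (A B) = \sum_(j, k) <u_j, v_k>^2 psi ((1 + a_j) (1 + b_k)),
   where [psi s = s - 1 - log s]. So the left-hand side (the Fenchel gap) is
   nonnegative and vanishes exactly when [(I + A) (I + B) = I]. As
   [tr (A B) <= tr (A R_0) + lambda |A_0|_{2,1}] for feasible [B], this gives
   weak duality [F A >= - G B] and the form of the pairs attaining equality.
   A lower bound on [psi] makes [G] strongly convex on balls, hence minimising
   sequences on the closed convex bounded feasible set are Cauchy in
   Hilbert-Schmidt norm and a minimiser [B] of [G] exists, with [I + B] bounded
   below. For [A = (I + B)^-1 - I], comparing [B] with [B + t (C - B)] through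
   the Fenchel gap gives [tr (A C) <= tr (A B)] for every feasible [C], and the
   choice of [C] extremal for the norm duality yields [F A = - G B]. *)

Set Implicit Arguments.
Unset Strict Implicit.
Unset Printing Implicit Defensive.

Import Order.TTheory GRing.Theory Num.Theory.
Import numFieldNormedType.Exports.

Local Open Scope classical_set_scope.
Local Open Scope ring_scope.

(** * Inner products *)

(** Neither differentiability nor continuity of [det_2] is established. A pair of inverse partners
    [A], [B], for which the gap vanishes, stands for the point [B] with gradient [- A], and the
    nonnegativity of the gap between [A] and any other operator is the supporting hyperplane
    inequality at [B]. Lower semicontinuity of [G] along a minimising sequence and first-order
    optimality are both read off from it. The condition [I + B > 0] is not closed, so the
    minimisation runs over the closed set given by the other constraints. A bound on [G B] bounds
    each [b_k - log (1 + b_k)], which keeps [1 + b_k] uniformly away from 0, and this passes to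
    limits. The extremal [C] may violate [I + C > 0], but [B + t (C - B)] satisfies it for small
    [t]. Traces are signed unordered sums, whereas sums of nonnegative terms can be exchanged
    freely; polarisation therefore turns every trace into squared norms. That [R_0] is itself
    feasible is not formal: [dg R_0 = 0] rests on the uniqueness of nonnegative square roots, and
    [I + R_0 > 0] on the nonnegativity of the covariance estimate. *)

Section inner_product.
Variables (R : realType) (U : hilbertType R).
Implicit Types (x y z : U) (a : R).

Lemma innerDr x y z : inner x (y + z) = inner x y + inner x z.
Proof. by rewrite innerC innerDl !(innerC x). Qed.

Lemma innerZr a x y : inner x (a *: y) = a * inner x y.
Proof. by rewrite innerC innerZl innerC. Qed.

Lemma innerNl x y : inner (- x) y = - inner x y.
Proof. by rewrite -scaleN1r innerZl mulN1r. Qed.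

Lemma innerNr x y : inner x (- y) = - inner x y.
Proof. by rewrite innerC innerNl innerC. Qed.

Lemma inner0l y : inner 0 y = 0.
Proof. by rewrite -(scale0r 0) innerZl mul0r. Qed.

Lemma inner0r y : inner y 0 = 0.
Proof. by rewrite innerC inner0l. Qed.

Lemma innerBl x y z : inner (x - y) z = inner x z - inner y z.
Proof. by rewrite innerDl innerNl. Qed.

Lemma innerBr x y z : inner x (y - z) = inner x y - inner x z.
Proof. by rewrite innerDr innerNr. Qed.

Lemma inner_suml I (r : seq I) (P : pred I) (f : I -> U) y :
  inner (\sum_(i <- r | P i) f i) y = \sum_(i <- r | P i) inner (f i) y.
Proof.
by apply: (big_morph (fun x => inner x y)) => [x z|];
  rewrite ?innerDl ?inner0l.
Qed.

Lemma inner_sumr I (r : seq I) (P : pred I) (f : I -> U) y :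
  inner y (\sum_(i <- r | P i) f i) = \sum_(i <- r | P i) inner y (f i).
Proof. by rewrite innerC inner_suml; apply: eq_bigr => i _; rewrite innerC. Qed.

Lemma normD_sqr x y : `|x + y| ^+ 2 = `|x| ^+ 2 + 2 * inner x y + `|y| ^+ 2.
Proof. by rewrite -!inner_norm !(innerDl, innerDr) (innerC y x); ring. Qed.

Lemma normB_sqr x y : `|x - y| ^+ 2 = `|x| ^+ 2 - 2 * inner x y + `|y| ^+ 2.
Proof. by rewrite normD_sqr normrN innerNr; ring. Qed.

Lemma cauchy_schwarz x y : `|inner x y| <= `|x| * `|y|.
Proof.
have [->|y0] := eqVneq y 0; first by rewrite inner0r !normr0 mulr0.
have yp : 0 < `|y| by rewrite normr_gt0.
rewrite -(@ler_pXn2r _ 2)// ?nnegrE ?mulr_ge0// exprMn real_normK ?num_real//.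
have := sqr_ge0 `|(`|y| ^+ 2) *: x - inner x y *: y|.
rewrite normB_sqr !normrZ innerZl innerZr normr_id exprMn.
rewrite [(`|inner x y| * _) ^+ 2]exprMn real_normK ?num_real// -subr_ge0 => h.
have : 0 <= `|y| ^+ 2 * (`|x| ^+ 2 * `|y| ^+ 2 - inner x y ^+ 2) by nra.
by rewrite pmulr_rge0 ?exprn_gt0// subr_ge0.
Qed.

Lemma inner_eq0_all x : (forall y, inner x y = 0) -> x = 0.
Proof.
move=> /(_ x); rewrite inner_norm => /eqP.
by rewrite sqrf_eq0 normr_eq0 => /eqP.
Qed.

Lemma cvg_inner_l (T : Type) (F : set_system T) {FF : Filter F}
    (f : T -> U) x y : f @ F --> x -> (fun t => inner (f t) y) @ F --> inner x y.
Proof.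
move=> fx; apply/cvgrPdist_lt => e e0.
have d0 : 0 < e / (1 + `|y|) by rewrite divr_gt0// ltr_pwDl.
move/cvgrPdist_lt : fx => /(_ _ d0); apply: filterS => t ft.
rewrite -innerBl (le_lt_trans (cauchy_schwarz _ _))//.
have : `|x - f t| * (1 + `|y|) < e by rewrite -ltr_pdivlMr// ltr_pwDl.
apply: le_lt_trans; rewrite ler_wpM2l// lerDr//.
Qed.

Lemma cvg_norm_sqr (T : Type) (F : set_system T) {FF : Filter F}
    (f : T -> U) x : f @ F --> x -> (fun t => `|f t| ^+ 2) @ F --> `|x| ^+ 2.
Proof. by move=> fx; apply: cvgM; apply: cvg_norm. Qed.

End inner_product.

(** * Orthonormal bases *)

Section orthonormal_systems.
Variables (R : realType) (U : hilbertType R).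
Implicit Types (x y z : U) (E : set U) (F G : {fset U}).

(** Stated for arbitrary proper filters because the compactness argument of the spectral theorem
    runs along an ultrafilter. *)
Lemma hilbert_cauchy_cvg (T : Type) (F : set_system T) {FF : ProperFilter F}
    (u : T -> U) :
  (forall e, 0 < e -> exists x, \forall t \near F, `|x - u t| < e) ->
  cvg (u @ F).
Proof.
move=> h; apply: cauchy_cvg; apply: cauchy_exP => e e0.
have [x xe] := h _ e0; exists x; near_simpl.
by apply: filterS xe => t; rewrite -ball_normE.
Qed.

Lemma hilbert_cauchy_seq_cvg (u : nat -> U) (b : nat -> R) :
  b @ \oo --> 0 ->
  (forall n m, (n <= m)%N -> `|u n - u m| ^+ 2 <= b n) -> cvgn u.
Proof.
move=> b0 ub; apply: (@hilbert_cauchy_cvg _ \oo _ u) => e e0.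
have e20 : 0 < e ^+ 2 by rewrite exprn_gt0.
move/cvgrPdist_lt : b0 => /(_ _ e20) [N _ hN].
exists (u N); exists N => // n /= Nn.
rewrite -(@ltr_pXn2r _ 2)// ?nnegrE ?(ltW e0)//.
apply: le_lt_trans (ub _ _ Nn) _.
have := hN N (leqnn N); rewrite /= sub0r normrN.
by apply: le_lt_trans; rewrite ler_norm.
Qed.

(** Zorn's lemma on the orthonormal subsets of [W]: a nonzero vector of [W] orthogonal to a maximal
    one could be normalised inside [W] and adjoined. *)
Lemma exists_orthobasis (W : set U) :
  (forall a x, W x -> W (a *: x)) -> exists E, orthobasis W E.
Proof.
move=> WZ.
pose P E := E `<=` W /\ orthonormal_set E.
have [|E [[EW [E1 E0]] maxE]] := @Zorn_bigcup U P.
  move=> C CP totC; split; first by apply: bigcup_sub => X /CP[].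
  split=> [e [X CX Xe]|e f [X CX Xe] [Y CY Yf] ef].
    by have [_ [+ _]] := CP _ CX; apply.
  have [XY|YX] := totC _ _ CX CY.
    by have [_ [_ +]] := CP _ CY; apply => //; exact: XY.
  by have [_ [_ +]] := CP _ CX; apply => //; exact: YX.
exists E; split => // x Wx xE.
apply/eqP; apply: contrapT => /negP x0.
have nx0 : `|x| != 0 by rewrite normr_eq0.
pose y := `|x|^-1 *: x.
have yE e : E e -> inner y e = 0 by move=> /xE xe0; rewrite innerZl xe0 mulr0.
have y1 : inner y y = 1.
  rewrite inner_norm normrZ normfV normr_id mulVf// expr1n//.
apply: (maxE (E `|` [set y])).
  split; first by move=> e; left.
  move=> /(_ y (or_intror erefl)) /yE; rewrite y1 => /eqP.
  by rewrite oner_eq0.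
split; first by move=> e [/EW//|->]; exact: WZ.
split=> [e [/E1//|->//]|e f [Ee|->] [Ef|->]] ef //.
- exact: E0.
- by rewrite innerC yE.
- exact: yE.
Qed.

Section orthonormal.
Variable E : set U.
Hypothesis oE : orthonormal_set E.

Definition proj F x : U := \sum_(e <- F) inner x e *: e.

Lemma inner_proj F x e : [set` F] `<=` E -> E e ->
  inner (proj F x) e = if e \in F then inner x e else 0.
Proof.
move=> FE Ee; rewrite /proj inner_suml.
have h f : f \in F -> inner (inner x f *: f) e = if f == e then inner x e else 0.
  move=> fF; have [<-|/eqP fe] := eqVneq f e.
    by rewrite innerZl (oE.1 _ (FE _ fF)) mulr1.
  by rewrite innerZl (oE.2 f e) ?mulr0//; exact: FE.
rewrite big_seq (eq_bigr (fun f => if f == e then inner x e else 0)) => [|f /h//].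
rewrite -big_seq -big_mkcond/=; case: ifPn => [eF|eF].
  by rewrite -big_filter filter_pred1_uniq ?fset_uniq// big_seq1.
by rewrite big_seq_cond big_pred0// => f; apply/negbTE/negP => /andP[fF /eqP fe];
  move: eF; rewrite -fe fF.
Qed.

Lemma inner_projl F x y : inner (proj F x) y = \sum_(e <- F) inner x e * inner y e.
Proof.
by rewrite inner_suml; apply: eq_bigr => e _; rewrite innerZl (innerC e).
Qed.

Lemma inner_proj_proj F G x : [set` G] `<=` E -> {subset F <= G} ->
  inner (proj F x) (proj G x) = \sum_(e <- F) inner x e ^+ 2.
Proof.
move=> GE FG; rewrite inner_projl big_seq [RHS]big_seq.
apply: eq_bigr => e eF; rewrite inner_proj//; last exact/GE/FG.
by rewrite FG// expr2.
Qed.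

Lemma norm_projB F G x : [set` G] `<=` E -> {subset F <= G} ->
  `|proj G x - proj F x| ^+ 2 =
  \sum_(e <- G) inner x e ^+ 2 - \sum_(e <- F) inner x e ^+ 2.
Proof.
move=> GE FG; rewrite normB_sqr -!inner_norm (innerC _ (proj F x)).
by rewrite !inner_proj_proj//; [ring|move=> e /FG; exact: GE].
Qed.

Lemma norm_sub_proj F x : [set` F] `<=` E ->
  `|x - proj F x| ^+ 2 = `|x| ^+ 2 - \sum_(e <- F) inner x e ^+ 2.
Proof.
move=> FE; rewrite normB_sqr -(inner_norm (proj F x)) inner_proj_proj//.
rewrite innerC inner_projl (eq_bigr (fun e => inner x e ^+ 2)) => [|e _].
  by ring.
by rewrite expr2.
Qed.

Lemma bessel F x : [set` F] `<=` E ->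
  \sum_(e <- F) inner x e ^+ 2 <= `|x| ^+ 2.
Proof. by move=> FE; rewrite -subr_ge0 -norm_sub_proj// sqr_ge0. Qed.

End orthonormal.

Lemma esum_fsetP (T : choiceType) (E : set T) (f : T -> R) (b : \bar R) :
  (forall F : {fset T}, [set` F] `<=` E -> ((\sum_(e <- F) f e)%:E <= b)%E) ->
  (\esum_(e in E) (f e)%:E <= b)%E.
Proof.
move=> h; apply: ge_ereal_sup => _ [A [finA AE] <-].
rewrite fsbig_finite// sumEFin; apply: h => e /=.
by rewrite in_fset_set// inE => /AE.
Qed.

Lemma esum_fset_ge (T : choiceType) (E : set T) (f : T -> R) (F : {fset T}) :
  [set` F] `<=` E -> ((\sum_(e <- F) f e)%:E <= \esum_(e in E) (f e)%:E)%E.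
Proof.
move=> FE; apply: esum_ge; exists [set` F]; first by split.
by rewrite fsbig_finite// set_fsetK sumEFin.
Qed.

Lemma esum_fset_gt (T : choiceType) (E : set T) (f : T -> R) (b : \bar R) :
  (b < \esum_(e in E) (f e)%:E)%E ->
  exists2 F : {fset T}, [set` F] `<=` E & (b < (\sum_(e <- F) f e)%:E)%E.
Proof.
move=> /ereal_sup_gt[_ [A [finA AE] <-]] ltb.
exists (fset_set A); first by move=> e /=; rewrite in_fset_set// inE => /AE.
by rewrite -sumEFin -fsbig_finite.
Qed.

Definition closed_subspace (W : set U) :=
  [/\ W 0, forall (a : R) x y, W x -> W y -> W (a *: x + y) &
      forall u : nat -> U, (forall n, W (u n)) -> cvgn u -> W (limn u)].

Lemma closed_subspace_proj (W : set U) E F x : closed_subspace W -> E `<=` W ->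
  [set` F] `<=` E -> W (proj F x).
Proof.
move=> [W0 Wlin _] EW FE; have {FE} : {subset enum_fset F <= E}.
  by move=> e eF; rewrite inE; exact: FE.
rewrite /proj; elim: (enum_fset F) => [_|e r ih h]; first by rewrite big_nil.
rewrite big_cons; apply: Wlin.
  by apply: EW; apply: set_mem; apply: h; rewrite mem_head.
by apply: ih => f fr; apply: h; rewrite in_cons fr orbT.
Qed.

(** The sets [F n] nearly attain the supremum of the Bessel sums, so enlarging [F n] moves the
    projection by at most [1 / (n + 1)] in squared norm. The projections are thus Cauchy; their
    limit has the same coefficients along [E] as [x], and completeness of [E] in [W] identifies the
    two. No enumeration of [E] is chosen. *)
Lemma orthobasis_expansion (W : set U) E x : closed_subspace W -> orthobasis W E ->
  W x -> exists F : nat -> {fset U},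
    (forall n, [set` F n] `<=` E) /\ (fun n => proj (F n) x) @ \oo --> x.
Proof.
move=> cW [EW oE complE] Wx; have [W0 Wlin Wlim] := cW.
pose S := \esum_(e in E) (inner x e ^+ 2)%:E.
have S_ge0 : (0 <= S)%E by apply: esum_ge0 => e _; rewrite lee_fin sqr_ge0.
have S_le : (S <= (`|x| ^+ 2)%:E)%E.
  by apply: esum_fsetP => F FE; rewrite lee_fin (bessel oE).
have Sfin : S \is a fin_num by rewrite ge0_fin_numE// (le_lt_trans S_le) ?ltry.
have [s Ss] : exists s, S = s%:E by exists (fine S); rewrite fineK.
have /choice[F hF] n : exists F : {fset U}, [set` F] `<=` E /\
    s - n.+1%:R^-1 < \sum_(e <- F) inner x e ^+ 2.
  have : ((s - n.+1%:R^-1)%:E < S)%E.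
    by rewrite Ss lte_fin ltrBlDr ltrDl invr_gt0 ltr0n.
  by move=> /esum_fset_gt[F FE]; rewrite lte_fin => ltF; exists F.
have Fs G : [set` G] `<=` E -> \sum_(e <- G) inner x e ^+ 2 <= s.
  by move=> GE; rewrite -lee_fin -Ss; exact: esum_fset_ge.
have close n G : [set` G] `<=` E -> {subset F n <= G} ->
    `|proj G x - proj (F n) x| ^+ 2 <= n.+1%:R^-1.
  move=> GE FG; rewrite (norm_projB oE)//.
  have := Fs _ GE; have := (hF n).2; move: (_^-1 : R) => i; lra.
have cu : cvgn (fun n => proj (F n) x).
  (* Both projections are compared with the one on the union [G]; [|b - a|^2 <= 2 |b|^2 + 2 |a|^2]
     with both squares at most [1 / (n + 1)] gives the 4. *)
  apply: (@hilbert_cauchy_seq_cvg _ (fun n => 4 * n.+1%:R^-1)).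
    by rewrite -(mulr0 4); apply: cvgM; [exact: cvg_cst|exact: cvg_harmonic].
  move=> n m nm; pose G := (F n `|` F m)%fset.
  have GE : [set` G] `<=` E.
    by move=> e /=; rewrite inE => /orP[/(hF n).1|/(hF m).1].
  have h1 := close n G GE (fun e => ltac:(by rewrite inE => ->)).
  have h2 := close m G GE (fun e => ltac:(by rewrite inE orbC => ->)).
  have mn : m.+1%:R^-1 <= n.+1%:R^-1 :> R by rewrite lef_pV2 ?posrE ?ltr0n// ler_nat.
  have -> : proj (F n) x - proj (F m) x =
      (proj G x - proj (F m) x) - (proj G x - proj (F n) x).
    by rewrite opprB [RHS]addrC addrA subrK.
  set a := proj G x - proj (F n) x in h1 *.
  set b := proj G x - proj (F m) x in h2 *.
  have : `|b - a| ^+ 2 <= 2 * `|b| ^+ 2 + 2 * `|a| ^+ 2.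
    have := sqr_ge0 `|b + a|; rewrite normB_sqr (normD_sqr b a); lra.
  have := h1; have := h2; move: mn.
  by move: (_^-1 : R) (_^-1 : R) => i j; lra.
pose y := limn (fun n => proj (F n) x).
have yE e : E e -> inner y e = inner x e.
  move=> Ee.
  have cye : (fun n => inner (proj (F n) x) e) @ \oo --> inner y e.
    exact: cvg_inner_l cu.
  have cxe : (fun n => inner (proj (F n) x) e) @ \oo --> inner x e.
    apply/cvgrPdist_lt => d d0.
    have d20 : 0 < d ^+ 2 by rewrite exprn_gt0.
    have := @cvg_harmonic R => /cvgrPdist_lt/(_ _ d20)[N _ hN].
    exists N => // n /hN /=; rewrite sub0r normrN => hn.
    rewrite (inner_proj oE)//; last exact: (hF n).1.
    case: ifPn => eF; first by rewrite subrr normr0.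
    rewrite subr0 -(@ltr_pXn2r _ 2)// ?nnegrE ?(ltW d0)//.
    rewrite real_normK ?num_real//.
    (* Adjoining a missing [e] to [F n] cannot push the Bessel sum above [s], so
       [<x, e>^2 < 1 / (n + 1)]. *)
    have GE : [set` (e |` F n)%fset] `<=` E.
      by move=> f /=; rewrite !inE => /orP[/eqP->//|/(hF n).1].
    have := Fs _ GE; rewrite big_fsetU1//= => h.
    move: hn; rewrite ger0_norm ?invr_ge0// /harmonic => hn.
    by have := (hF n).2; move: hn; move: (_^-1 : R) => i; lra.
  by rewrite -(cvg_lim _ cye)// (cvg_lim _ cxe).
have Wproj n : W (proj (F n) x) by have := closed_subspace_proj x cW EW (hF n).1.
have Wy : W y by exact: Wlim.
have xy : y = x.
  apply/eqP; rewrite -subr_eq0; apply/eqP; apply: complE => [|e Ee].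
    by rewrite addrC -scaleN1r; exact: Wlin.
  by rewrite innerBl yE// subrr.
exists F; split=> [n|]; first exact: (hF n).1.
by have := cu; rewrite -/y xy.
Qed.

Lemma orthobasis_inner0 (W : set U) E x y : closed_subspace W -> orthobasis W E ->
  W y -> (forall e, E e -> inner x e = 0) -> inner x y = 0.
Proof.
move=> cW bE Wy xE; have [F [FE cF]] := orthobasis_expansion cW bE Wy.
rewrite innerC.
have c1 : (fun n => inner (proj (F n) y) x) @ \oo --> inner y x.
  exact: cvg_inner_l cF.
rewrite -(cvg_lim _ c1)//.
rewrite (_ : (fun n => _) = cst 0) ?lim_cst//.
apply/funext => n; rewrite inner_projl big_seq big1// => e eF.
by rewrite xE ?mulr0//; exact: (FE n).
Qed.

Lemma closed_subspaceT : closed_subspace [set: U].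
Proof. by []. Qed.

Lemma parseval E x : orthobasis [set: U] E ->
  \esum_(e in E) (inner x e ^+ 2)%:E = (`|x| ^+ 2)%:E.
Proof.
move=> bE; have [_ oE _] := bE.
have [F [FE cF]] := orthobasis_expansion closed_subspaceT bE (x := x) Logic.I.
have S_le : (\esum_(e in E) (inner x e ^+ 2)%:E <= (`|x| ^+ 2)%:E)%E.
  by apply: esum_fsetP => X XE; rewrite lee_fin (bessel oE).
apply/eqP; rewrite eq_le S_le /=.
set S := esum _ _ in S_le *.
have Sfin : S \is a fin_num.
  by rewrite ge0_fin_numE ?(le_lt_trans S_le) ?ltry// esum_ge0// => e _; rewrite lee_fin sqr_ge0.
rewrite -(fineK Sfin) lee_fin.
have c1 : (fun n => `|proj (F n) x| ^+ 2) @ \oo --> `|x| ^+ 2.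
  exact: cvg_norm_sqr cF.
apply: (cvgr_to_le c1); apply: nearW => n.
rewrite -inner_norm (inner_proj_proj oE)//.
by rewrite -lee_fin (fineK Sfin); exact: esum_fset_ge.
Qed.

End orthonormal_systems.

(** * Real-valued unordered sums *)

Section real_sums.
Variables (R : realType) (T : choiceType) (E : set T).
Implicit Types (f g h : T -> R).

(** The shape is that of [trace], which is therefore an [rsum] by conversion. *)
Definition rsum f : R :=
  fine (\esum_(e in E) (EFin \o f)^\+%E e) -
  fine (\esum_(e in E) (EFin \o f)^\-%E e).

Definition nnsum f : R := fine (\esum_(e in E) (f e)%:E).

Definition finsum f : Prop := (\esum_(e in E) (f e)%:E < +oo)%E.

Lemma nnsumE f : (forall e, E e -> 0 <= f e) -> finsum f ->
  \esum_(e in E) (f e)%:E = (nnsum f)%:E.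
Proof.
move=> f0 fs; rewrite /nnsum fineK// ge0_fin_numE//.
by apply: esum_ge0 => e Ee; rewrite lee_fin f0.
Qed.

Lemma nnsum_ge0 f : (forall e, E e -> 0 <= f e) -> 0 <= nnsum f.
Proof. by move=> f0; rewrite fine_ge0// esum_ge0// => e Ee; rewrite lee_fin f0. Qed.

Lemma le_finsum f g : (forall e, E e -> f e <= g e) -> finsum g -> finsum f.
Proof.
by move=> fg; apply: le_lt_trans; apply: le_esum => e Ee; rewrite lee_fin fg.
Qed.

Lemma esum_le_nnsum f (c : R) : (forall e, E e -> 0 <= f e) ->
  (\esum_(e in E) (f e)%:E <= c%:E)%E -> finsum f /\ nnsum f <= c.
Proof.
move=> f0 fc; have fs : finsum f by apply: le_lt_trans fc _; rewrite ltry.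
by split => //; rewrite -lee_fin -nnsumE.
Qed.

Lemma finsumD f g : (forall e, E e -> 0 <= f e) -> (forall e, E e -> 0 <= g e) ->
  finsum f -> finsum g -> finsum (fun e => f e + g e).
Proof.
move=> f0 g0 fs gs; rewrite /finsum.
under eq_esum do rewrite EFinD.
by rewrite esumD// ?lte_add_pinfty// => e Ee; rewrite lee_fin ?f0 ?g0.
Qed.

Lemma nnsumD f g : (forall e, E e -> 0 <= f e) -> (forall e, E e -> 0 <= g e) ->
  finsum f -> finsum g ->
  nnsum (fun e => f e + g e) = nnsum f + nnsum g.
Proof.
move=> f0 g0 fs gs; rewrite {1}/nnsum.
under eq_esum do rewrite EFinD.
rewrite esumD//; try by move=> e Ee; rewrite lee_fin ?f0 ?g0.
by rewrite !nnsumE.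
Qed.

Lemma esumZl (c : R) f : 0 <= c -> (forall e, E e -> 0 <= f e) ->
  \esum_(e in E) (c * f e)%:E = (c%:E * \esum_(e in E) (f e)%:E)%E.
Proof.
have le (b : R) g : 0 <= b -> (forall e, E e -> 0 <= g e) ->
    (\esum_(e in E) (b * g e)%:E <= b%:E * \esum_(e in E) (g e)%:E)%E.
  move=> b0 g0; apply: esum_fsetP => F FE.
  rewrite -mulr_sumr EFinM lee_wpmul2l//; last exact: esum_fset_ge.
move=> c0 f0; apply/eqP; rewrite eq_le le//=.
have [->|cn0] := eqVneq c 0.
  by rewrite mul0e; apply: esum_ge0 => e Ee; rewrite mul0r.
have cp : 0 < c by rewrite lt_def cn0.
have ci : 0 <= c^-1 by rewrite invr_ge0 ltW.
have := le c^-1 (fun e => c * f e) ci.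
rewrite (eq_esum (b := fun e => (f e)%:E)); last first.
  by move=> e _; rewrite mulrA mulVf ?mul1r.
move=> /(_ (fun e Ee => mulr_ge0 c0 (f0 e Ee))).
by move=> h; rewrite -lee_pdivlMl.
Qed.
End real_sums.

Section real_sums_linear.
Variables (R : realType) (T : choiceType) (E : set T).
Implicit Types (f g h : T -> R).

Lemma eq_rsum f g : (forall e, E e -> f e = g e) -> rsum E f = rsum E g.
Proof.
move=> fg; rewrite /rsum; congr (fine _ - fine _); apply: eq_esum => e Ee /=.
  by rewrite !funeposE /= fg.
by rewrite !funenegE /= fg.
Qed.

(** Any decomposition into summable nonnegative families computes [rsum], not only the positive and
    negative parts. Linearity of signed sums thereby reduces to that of nonnegative ones. *)
Lemma rsumB_nn f g h : (forall e, E e -> 0 <= g e) -> (forall e, E e -> 0 <= h e) ->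
  finsum E g -> finsum E h -> (forall e, E e -> f e = g e - h e) ->
  rsum E f = nnsum E g - nnsum E h.
Proof.
move=> g0 h0 gs hs fE; rewrite (eq_rsum fE) /rsum.
have sm (k : T -> R) : (forall e, E e -> 0 <= k e) -> finsum E k -> summable E (EFin \o k).
  move=> k0; apply: le_lt_trans; apply: le_esum => e Ee /=.
  by rewrite lee_fin ger0_norm// k0.
have k0 (k : T -> R) : (forall e, E e -> 0 <= k e) -> forall e, E e -> (0 <= (EFin \o k) e)%E.
  by move=> k0 e Ee; rewrite lee_fin k0.
pose d : T -> \bar R := EFin \o (fun e => g e - h e).
have : (\esum_(e in E) d^\+ e - \esum_(e in E) d^\- e =
    \esum_(e in E) (g e)%:E - \esum_(e in E) (h e)%:E)%E :=
  esumB (sm _ g0 gs) (sm _ h0 hs) (k0 _ g0) (k0 _ h0).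
rewrite -/d.
set P := esum _ _; set Q := esum _ _.
rewrite !nnsumE// -EFinB.
have P0 : (0 <= P)%E by apply: esum_ge0.
have Q0 : (0 <= Q)%E by apply: esum_ge0.
by move: P Q P0 Q0 => [p||] [q||] //= _ _ [].
Qed.

Lemma rsum_nn f : (forall e, E e -> 0 <= f e) -> finsum E f ->
  rsum E f = nnsum E f.
Proof.
move=> f0 fs; rewrite (@rsumB_nn _ f (fun=> 0))//; last 2 first.
- by rewrite /finsum esum1// ltry.
- by move=> e _; rewrite subr0.
by rewrite [X in _ - X]/nnsum esum1// subr0.
Qed.

Lemma rsumD f g : finsum E (fun e => `|f e|) -> finsum E (fun e => `|g e|) ->
  rsum E (fun e => f e + g e) = rsum E f + rsum E g.
Proof.
move=> fs gs.
pose p (k : T -> R) e := (`|k e| + k e) / 2; pose m (k : T -> R) e := (`|k e| - k e) / 2.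
have p0 (k : T -> R) e : 0 <= p k e by rewrite /p; have := ler_norm (- k e); rewrite normrN; lra.
have m0 (k : T -> R) e : 0 <= m k e by rewrite /m; have := ler_norm (k e); lra.
have ps (k : T -> R) : finsum E (fun e => `|k e|) -> finsum E (p k).
  by apply: le_finsum => e _; rewrite /p; have := ler_norm (k e); lra.
have ms (k : T -> R) : finsum E (fun e => `|k e|) -> finsum E (m k).
  by apply: le_finsum => e _; rewrite /m; have := ler_norm (- k e); rewrite normrN; lra.
have psf := ps _ fs; have msf := ms _ fs; have psg := ps _ gs; have msg := ms _ gs.
rewrite (@rsumB_nn f (p f) (m f))//; last by move=> e _; rewrite /p /m; lra.
rewrite (@rsumB_nn g (p g) (m g))//; last by move=> e _; rewrite /p /m; lra.
rewrite (@rsumB_nn _ (fun e => p f e + p g e) (fun e => m f e + m g e)).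
- by rewrite !nnsumD//; lra.
- by move=> e _; rewrite addr_ge0.
- by move=> e _; rewrite addr_ge0.
- by exact: finsumD.
- by exact: finsumD.
- by move=> e _; rewrite /p /m; lra.
Qed.

Lemma finsumZ (c : R) f : 0 <= c -> (forall e, E e -> 0 <= f e) -> finsum E f ->
  finsum E (fun e => c * f e).
Proof. by move=> c0 f0 fs; rewrite /finsum esumZl// nnsumE// -EFinM ltry. Qed.

Lemma nnsumZ (c : R) f : 0 <= c -> (forall e, E e -> 0 <= f e) -> finsum E f ->
  nnsum E (fun e => c * f e) = c * nnsum E f.
Proof. by move=> c0 f0 fs; rewrite {1}/nnsum esumZl// nnsumE. Qed.

Lemma rsumN f : finsum E (fun e => `|f e|) ->
  rsum E (fun e => - f e) = - rsum E f.
Proof.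
move=> fs; apply/eqP; rewrite -addr_eq0 -rsumD//; last first.
  by apply: le_finsum fs => e _; rewrite normrN.
rewrite (eq_rsum (g := fun=> 0)); last by move=> e _; rewrite addNr.
rewrite rsum_nn//; first by rewrite /nnsum esum1.
by rewrite /finsum esum1// ltry.
Qed.

Lemma rsumZ (c : R) f : finsum E (fun e => `|f e|) ->
  rsum E (fun e => c * f e) = c * rsum E f.
Proof.
move=> fs.
have pos b : 0 <= b -> rsum E (fun e => b * f e) = b * rsum E f.
  move=> b0.
  pose p e := (`|f e| + f e) / 2; pose m e := (`|f e| - f e) / 2.
  have p0 e : 0 <= p e by rewrite /p; have := ler_norm (- f e); rewrite normrN; lra.
  have m0 e : 0 <= m e by rewrite /m; have := ler_norm (f e); lra.
  have ps : finsum E p.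
    by apply: le_finsum fs => e _; rewrite /p; have := ler_norm (f e); lra.
  have ms : finsum E m.
    by apply: le_finsum fs => e _; rewrite /m; have := ler_norm (- f e); rewrite normrN; lra.
  rewrite (@rsumB_nn f p m)//; last by move=> e _; rewrite /p /m; lra.
  rewrite (@rsumB_nn _ (fun e => b * p e) (fun e => b * m e)).
  - by rewrite !nnsumZ//; ring.
  - by move=> e _; rewrite mulr_ge0.
  - by move=> e _; rewrite mulr_ge0.
  - exact: finsumZ.
  - exact: finsumZ.
  - by move=> e _; rewrite /p /m; lra.
have [c0|c0] := leP 0 c; first exact: pos.
rewrite (eq_rsum (g := fun e => - (- c * f e))); last by move=> e _; ring.
rewrite rsumN ?pos; [ring|lra|].
rewrite (_ : (fun e => _) = (fun e => `|c| * `|f e|)); last first.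
  by apply/funext => e; rewrite normrM normrN.
exact: finsumZ.
Qed.

End real_sums_linear.

Lemma exchange_esum (R : realType) (S T : choiceType) (I : set S) (J : set T)
    (a : S -> T -> \bar R) : (forall i j, I i -> J j -> (0 <= a i j)%E) ->
  \esum_(i in I) \esum_(j in J) a i j = \esum_(j in J) \esum_(i in I) a i j.
Proof.
move=> a0; rewrite !esum_esum//; last by move=> j i Jj Ii; exact: a0.
rewrite (reindex_esum (J `*`` fun=> I) _ (fun x => (x.2, x.1)))//; split=> //=.
- by move=> [j i] [/=].
- by move=> [i1 j1] [i2 j2] _ _ [-> ->].
- by move=> [i j] [/= Ii Jj]; exists (j, i).
Qed.

(** For [c > 0] evaluate at the minimiser [t = - b / c]; for [c = 0] and [b] nonzero,
    [t = - (a + 1) / (2 b)] would give the value -1. *)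
Lemma quadratic_discr (R : realType) (a b c : R) : 0 <= c ->
  (forall t, 0 <= a + 2 * t * b + t ^+ 2 * c) -> b ^+ 2 <= a * c.
Proof.
move=> c0 h.
have [c_eq0|c_neq0] := eqVneq c 0.
  rewrite c_eq0 mulr0; have [->|b0] := eqVneq b 0; first by rewrite expr0n.
  have := h (- (a + 1) / (2 * b)); rewrite c_eq0.
  have -> : a + 2 * (- (a + 1) / (2 * b)) * b + (- (a + 1) / (2 * b)) ^+ 2 * 0 = -1.
    by field.
  by rewrite lerNr oppr0 ler10.
have cp : 0 < c by rewrite lt_def c_neq0.
have := h (- b / c).
have -> : a + 2 * (- b / c) * b + (- b / c) ^+ 2 * c = (a * c - b ^+ 2) / c by field.
by rewrite pmulr_lge0 ?invr_gt0// subr_ge0.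
Qed.

(** * Square-summable families *)

Section square_summable_families.
Variables (R : realType) (V : hilbertType R) (T : choiceType) (E : set T).
Implicit Types (u v w : T -> V).

Definition sqsum u : Prop := finsum E (fun e => `|u e| ^+ 2).

Definition sqnorm u : R := nnsum E (fun e => `|u e| ^+ 2).

Definition fip u v : R := rsum E (fun e => inner (u e) (v e)).

Lemma sqnorm_ge0 u : 0 <= sqnorm u.
Proof. by apply: nnsum_ge0 => e _; rewrite sqr_ge0. Qed.

Lemma esum_sqnorm u : sqsum u -> \esum_(e in E) (`|u e| ^+ 2)%:E = (sqnorm u)%:E.
Proof. by move=> us; rewrite nnsumE// => e _; rewrite sqr_ge0. Qed.

Lemma esum_sqnorm_le u (c : R) :
  (\esum_(e in E) (`|u e| ^+ 2)%:E <= c%:E)%E -> sqsum u /\ sqnorm u <= c.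
Proof. by apply: esum_le_nnsum => e _; rewrite sqr_ge0. Qed.

Lemma sqsumZ (a : R) u : sqsum u -> sqsum (fun e => a *: u e).
Proof.
move=> us; rewrite /sqsum (_ : (fun e => _) = (fun e => a ^+ 2 * `|u e| ^+ 2)).
  by apply: finsumZ => //; rewrite ?sqr_ge0// => e _; rewrite sqr_ge0.
by apply/funext => e; rewrite normrZ exprMn real_normK// num_real.
Qed.

Lemma sqsumD u v : sqsum u -> sqsum v -> sqsum (fun e => u e + v e).
Proof.
move=> us vs.
apply: (@le_finsum _ _ _ _ (fun e => 2 * `|u e| ^+ 2 + 2 * `|v e| ^+ 2)).
  move=> e _; rewrite normD_sqr.
  have := sqr_ge0 `|u e - v e|; rewrite normB_sqr; lra.
by apply: finsumD => [e _|e _||]; rewrite ?mulr_ge0 ?sqr_ge0//;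
  apply: finsumZ => // e _; rewrite sqr_ge0.
Qed.

Lemma sqsumB u v : sqsum u -> sqsum v -> sqsum (fun e => u e - v e).
Proof.
move=> us vs; rewrite (_ : (fun e => _) = (fun e => u e + (-1) *: v e)).
  by apply: sqsumD => //; exact: sqsumZ.
by apply/funext => e; rewrite scaleN1r.
Qed.

Lemma fip_summable u v : sqsum u -> sqsum v ->
  finsum E (fun e => `|inner (u e) (v e)|).
Proof.
move=> us vs.
apply: (@le_finsum _ _ _ _ (fun e => `|u e| ^+ 2 + `|v e| ^+ 2)).
  move=> e _; apply: le_trans (cauchy_schwarz _ _) _.
  have := sqr_ge0 (`|u e| - `|v e|); have := sqr_ge0 (`|u e| + `|v e|); nra.
by apply: finsumD => // e _; rewrite sqr_ge0.
Qed.

Lemma eq_fip u u' v v' : (forall e, E e -> u e = u' e) ->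
  (forall e, E e -> v e = v' e) -> fip u v = fip u' v'.
Proof. by move=> uE vE; apply: eq_rsum => e Ee; rewrite uE ?vE. Qed.

Lemma fipC u v : fip u v = fip v u.
Proof. by apply: eq_rsum => e _; rewrite innerC. Qed.

Lemma fipDl u v w : sqsum u -> sqsum v -> sqsum w ->
  fip (fun e => u e + v e) w = fip u w + fip v w.
Proof.
move=> us vs ws; rewrite /fip -rsumD; try exact: fip_summable.
by apply: eq_rsum => e _; rewrite innerDl.
Qed.

Lemma fipZl (a : R) u w : sqsum u -> sqsum w ->
  fip (fun e => a *: u e) w = a * fip u w.
Proof.
move=> us ws; rewrite /fip -rsumZ; last exact: fip_summable.
by apply: eq_rsum => e _; rewrite innerZl.
Qed.

Lemma fipBl u v w : sqsum u -> sqsum v -> sqsum w ->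
  fip (fun e => u e - v e) w = fip u w - fip v w.
Proof.
move=> us vs ws.
rewrite (@eq_fip _ (fun e => u e + (-1) *: v e) _ w)//; last first.
  by move=> e _; rewrite scaleN1r.
by rewrite fipDl ?fipZl//; [ring|exact: sqsumZ].
Qed.

Lemma fip_sqnorm u : sqsum u -> fip u u = sqnorm u.
Proof.
move=> us; rewrite /fip /sqnorm -rsum_nn//.
by apply: eq_rsum => e _; rewrite inner_norm.
Qed.

Lemma sqnormZ (a : R) u : sqsum u -> sqnorm (fun e => a *: u e) = a ^+ 2 * sqnorm u.
Proof.
move=> us; rewrite -!fip_sqnorm//; last exact: sqsumZ.
by rewrite fipZl ?[fip u _]fipC ?fipZl//; [ring|exact: sqsumZ].
Qed.

Lemma sqnormD u v : sqsum u -> sqsum v ->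
  sqnorm (fun e => u e + v e) = sqnorm u + 2 * fip u v + sqnorm v.
Proof.
move=> us vs; rewrite -!fip_sqnorm//; last exact: sqsumD.
have uvs := sqsumD us vs.
rewrite fipDl// !(fipC _ (fun e => u e + v e)) !fipDl// (fipC v u); ring.
Qed.

Lemma sqnormB u v : sqsum u -> sqsum v ->
  sqnorm (fun e => u e - v e) = sqnorm u - 2 * fip u v + sqnorm v.
Proof.
move=> us vs; rewrite -!fip_sqnorm//; last exact: sqsumB.
have uvs := sqsumB us vs.
rewrite fipBl// !(fipC _ (fun e => u e - v e)) !fipBl// (fipC v u); ring.
Qed.

Lemma fip_cauchy_schwarz u v : sqsum u -> sqsum v ->
  fip u v ^+ 2 <= sqnorm u * sqnorm v.
Proof.
move=> us vs; apply: quadratic_discr; first exact: sqnorm_ge0.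
move=> t; have := sqnorm_ge0 (fun e => u e + t *: v e).
have tvs := sqsumZ t vs.
by rewrite sqnormD// sqnormZ// (fipC u) fipZl// (fipC v) mulrA.
Qed.

Lemma fip_le u v : sqsum u -> sqsum v ->
  fip u v <= Num.sqrt (sqnorm u) * Num.sqrt (sqnorm v).
Proof.
move=> us vs; rewrite -sqrtrM ?sqnorm_ge0//.
have [h|h] := leP (fip u v) 0; first by rewrite (le_trans h)// sqrtr_ge0.
rewrite -(ger0_norm (ltW h)) -sqrtr_sqr ler_wsqrtr//.
exact: fip_cauchy_schwarz.
Qed.

(** Identities for inner products become identities for squared norms, whose nonnegative sums can be
    exchanged and split into blocks. *)
Lemma fip_polar u v : sqsum u -> sqsum v ->
  fip u v = (sqnorm (fun e => u e + v e) - sqnorm u - sqnorm v) / 2.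
Proof. by move=> us vs; rewrite sqnormD//; lra. Qed.

(** A form of Fatou's lemma: finite partial sums pass to the pointwise limit, and the sum is their
    supremum. *)
Lemma esum_sqnorm_lim (I : Type) (F : set_system I) {FF : ProperFilter F}
    (u_ : I -> T -> V) u (c : R) :
  (forall e, E e -> (fun i => u_ i e) @ F --> u e) ->
  (\forall i \near F, \esum_(e in E) (`|u_ i e| ^+ 2)%:E <= c%:E)%E ->
  (\esum_(e in E) (`|u e| ^+ 2)%:E <= c%:E)%E.
Proof.
move=> cu hc; apply: esum_fsetP => X XE; rewrite lee_fin.
have cX : (fun i => \sum_(e <- X) `|u_ i e| ^+ 2) @ F --> \sum_(e <- X) `|u e| ^+ 2.
  have : {in enum_fset X, forall e, (fun i => `|u_ i e| ^+ 2) @ F --> `|u e| ^+ 2}.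
    by move=> e eX; apply: cvg_norm_sqr; exact/cu/XE.
  elim: (enum_fset X) => [_|e s ih h].
    by rewrite big_nil; under eq_fun do rewrite big_nil; exact: cvg_cst.
  rewrite big_cons; under eq_fun do rewrite big_cons.
  apply: cvgD; first by apply: h; rewrite mem_head.
  by apply: ih => f fs; apply: h; rewrite in_cons fs orbT.
apply: (cvgr_to_le cX); apply: filterS hc => i hi.
by rewrite -lee_fin; apply: le_trans hi; exact: esum_fset_ge.
Qed.

End square_summable_families.

(** * Self-adjoint Hilbert-Schmidt operators *)

Lemma sqnorm_comp_bound (R : realType) (V W : hilbertType R) (I : choiceType)
    (E : set I) (u : I -> V) (S : V -> W) (c : R) : 0 <= c -> sqsum E u ->
  (forall x, `|S x| <= c * `|x|) ->
  sqsum E (S \o u) /\ sqnorm E (S \o u) <= c ^+ 2 * sqnorm E u.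
Proof.
move=> c0 us Sc; apply: esum_sqnorm_le.
have u0 e : E e -> 0 <= `|u e| ^+ 2 by rewrite sqr_ge0.
rewrite -nnsumZ ?sqr_ge0// -nnsumE; last 2 first.
- by move=> e Ee; rewrite mulr_ge0 ?sqr_ge0.
- by apply: finsumZ; rewrite ?sqr_ge0.
apply: le_esum => e _; rewrite lee_fin -exprMn.
by rewrite ler_pXn2r ?nnegrE ?mulr_ge0//; exact: Sc.
Qed.

Section adjoint_pairs.
Variables (R : realType) (U V : hilbertType R).

Lemma onbP : orthobasis [set: U] (@onb R U).
Proof. by apply: xgetPex; exact: exists_orthobasis. Qed.

(** Both sides equal the double sum of [<T e, f>^2], by Parseval in [F] and in [E]. Taking [T' = T]
    shows that the Hilbert-Schmidt norm of a self-adjoint operator does not depend on the basis. *)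
Lemma esum_sqnorm_adjoint (E : set U) (F : set V) (T : U -> V) (T' : V -> U) :
  orthobasis [set: U] E -> orthobasis [set: V] F ->
  (forall x y, inner (T x) y = inner x (T' y)) ->
  \esum_(e in E) (`|T e| ^+ 2)%:E = \esum_(f in F) (`|T' f| ^+ 2)%:E.
Proof.
move=> bE bF TT'.
under eq_esum do rewrite -(parseval _ bF).
rewrite exchange_esum; last by move=> e f _ _; rewrite lee_fin sqr_ge0.
apply: eq_esum => f _; rewrite -(parseval _ bE); apply: eq_esum => e _.
by rewrite TT' innerC.
Qed.

End adjoint_pairs.

Lemma continuous_lipschitz (R : realType) (U V : hilbertType R) (T : U -> V)
    (c : R) : (forall x y, `|T x - T y| <= c * `|x - y|) -> continuous T.
Proof.
move=> Tc x; apply/cvgrPdist_lt => e e0.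
have c0 : 0 < 1 + `|c| by rewrite ltr_pwDl.
have d0 : 0 < e / (1 + `|c|) by rewrite divr_gt0.
apply/nbhs_ballP; exists (e / (1 + `|c|)) => // y; rewrite -ball_normE /= => xy.
apply: le_lt_trans (Tc _ _) _.
move: xy; rewrite ltr_pdivlMr//; apply: le_lt_trans.
rewrite mulrC ler_wpM2l//; have := ler_norm c; lra.
Qed.

Lemma linear_continuous_bound (R : realType) (U V : hilbertType R) (T : U -> V) :
  linear T -> continuous T -> exists2 M, 0 < M & forall x, `|T x| <= M * `|x|.
Proof.
move=> lT cT.
have T0 : T 0 = 0 by have := lT (-1) 0 0; rewrite scaler0 scaleN1r addNr addr0.
have TZ a x : T (a *: x) = a *: T x by have := lT a x 0; rewrite T0 !addr0.
have /cvgrPdist_lt/(_ _ ltr01) := cT 0.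
move=> /nbhs_ballP[d /= d0 hd].
exists (2 / d); first by rewrite divr_gt0.
move=> x; have [->|x0] := eqVneq x 0; first by rewrite T0 !normr0 mulr0.
have nx : 0 < `|x| by rewrite normr_gt0.
have k0 : 0 < d / (2 * `|x|) by rewrite divr_gt0// mulr_gt0.
have /hd : ball 0 d ((d / (2 * `|x|)) *: x).
  rewrite -ball_normE /= sub0r normrN normrZ gtr0_norm//.
  rewrite (_ : d / (2 * `|x|) * `|x| = d / 2); last by field; rewrite gt_eqF.
  by lra.
rewrite /= T0 sub0r normrN TZ normrZ gtr0_norm// mulrC -ltr_pdivlMr// => /ltW hT.
apply: le_trans hT _; rewrite (_ : 1 / _ = 2 / d * `|x|)//.
by field; rewrite !gt_eqF.
Qed.

(* Locked, as comparing two of these up to conversion unfolds them to suprema of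
   finite sums. *)
HB.lock Definition hsn (R : realType) (U : hilbertType R) (A : U -> U) : R :=
  sqnorm (@onb R U) A.

HB.lock Definition hsip (R : realType) (U : hilbertType R) (A B : U -> U) : R :=
  fip (@onb R U) A B.

Section selfadjoint_operators.
Variables (R : realType) (U : hilbertType R).
Implicit Types (A B : U -> U) (E : set U).

Lemma selfadjoint_linear A : selfadjoint A -> linear A.
Proof.
move=> sA a x y; apply/eqP; rewrite -subr_eq0; apply/eqP/inner_eq0_all => z.
by rewrite innerBl innerDl innerZl !sA innerDl innerZl subrr.
Qed.

Lemma sa0 A : selfadjoint A -> A 0 = 0.
Proof. by move=> sA; apply: inner_eq0_all => z; rewrite sA inner0l. Qed.

Lemma saD A x y : selfadjoint A -> A (x + y) = A x + A y.
Proof. by move=> /selfadjoint_linear/(_ 1 x y); rewrite !scale1r. Qed.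

Lemma saZ A (a : R) x : selfadjoint A -> A (a *: x) = a *: A x.
Proof. by move=> sA; have := selfadjoint_linear sA a x 0; rewrite (sa0 sA) !addr0. Qed.

Lemma saB A x y : selfadjoint A -> A (x - y) = A x - A y.
Proof. by move=> sA; rewrite -scaleN1r saD// saZ// scaleN1r. Qed.

Lemma esum_sqnorm_sa E F A : orthobasis [set: U] E -> orthobasis [set: U] F ->
  selfadjoint A ->
  \esum_(e in E) (`|A e| ^+ 2)%:E = \esum_(e in F) (`|A e| ^+ 2)%:E.
Proof. by move=> bE bF sA; exact: esum_sqnorm_adjoint. Qed.

(* Self-adjoint Hilbert-Schmidt; linearity and continuity are then automatic. *)
Definition sahs A := selfadjoint A /\ sqsum (@onb R U) A.

Lemma hsn_ge0 A : 0 <= hsn A. Proof. by rewrite hsn.unlock sqnorm_ge0. Qed.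

Lemma hs_norm_sqrE A : sahs A -> hs_norm_sqr A = (hsn A)%:E.
Proof. by move=> [_ As]; rewrite /hs_norm_sqr esum_sqnorm// hsn.unlock. Qed.

Lemma esum_sahs E A : orthobasis [set: U] E -> sahs A ->
  \esum_(e in E) (`|A e| ^+ 2)%:E = (hsn A)%:E.
Proof.
by move=> bE [sA As]; rewrite (esum_sqnorm_sa bE (@onbP R U) sA) esum_sqnorm// hsn.unlock.
Qed.

Lemma sahs_sqsum E A : orthobasis [set: U] E -> sahs A -> sqsum E A.
Proof. by move=> bE sA; rewrite /sqsum /finsum esum_sahs// ltry. Qed.

Lemma saDop A B : selfadjoint A -> selfadjoint B -> selfadjoint (fun x => A x + B x).
Proof. by move=> sA sB x y; rewrite innerDl innerDr sA sB. Qed.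

Lemma saZop (a : R) A : selfadjoint A -> selfadjoint (fun x => a *: A x).
Proof. by move=> sA x y; rewrite innerZl innerZr sA. Qed.

Lemma saBop A B : selfadjoint A -> selfadjoint B -> selfadjoint (fun x => A x - B x).
Proof. by move=> sA sB x y; rewrite innerBl innerBr sA sB. Qed.

Lemma sahsD A B : sahs A -> sahs B -> sahs (fun x => A x + B x).
Proof. by move=> [sA As] [sB Bs]; split; [exact: saDop|exact: sqsumD]. Qed.

Lemma sahsZ (a : R) A : sahs A -> sahs (fun x => a *: A x).
Proof. by move=> [sA As]; split; [exact: saZop|exact: sqsumZ]. Qed.

Lemma sahsB A B : sahs A -> sahs B -> sahs (fun x => A x - B x).
Proof. by move=> [sA As] [sB Bs]; split; [exact: saBop|exact: sqsumB]. Qed.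

Lemma trace_comp A B : selfadjoint A -> trace (A \o B) = hsip A B.
Proof.
by move=> sA; rewrite hsip.unlock fipC; apply: eq_rsum => e _; rewrite /= sA.
Qed.

(** By Parseval and symmetry [|A x|^2] is the sum of [<x, A e>^2]; Cauchy-Schwarz is applied to each
    term. *)
Lemma sahs_bound A x : sahs A -> `|A x| ^+ 2 <= `|x| ^+ 2 * hsn A.
Proof.
move=> sA; rewrite -lee_fin -(parseval _ (@onbP R U)) EFinM -hs_norm_sqrE//.
rewrite /hs_norm_sqr (esum_sqnorm sA.2) -EFinM.
rewrite -[sqnorm _ _]/(nnsum _ _) -nnsumZ ?sqr_ge0//; last exact: sA.2.
rewrite -nnsumE; last first.
- by apply: finsumZ; rewrite ?sqr_ge0//; exact: sA.2.
- by move=> e _; rewrite mulr_ge0 ?sqr_ge0.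
apply: le_esum => e _; rewrite lee_fin sA.1 -exprMn -[leLHS]real_normK ?num_real//.
by rewrite ler_pXn2r ?nnegrE ?mulr_ge0//; exact: cauchy_schwarz.
Qed.

Lemma sahs_norm_bound A x : sahs A -> `|A x| <= Num.sqrt (hsn A) * `|x|.
Proof.
move=> sA; rewrite -(@ler_pXn2r _ 2)// ?nnegrE ?mulr_ge0 ?sqrtr_ge0//.
by rewrite exprMn sqr_sqrtr ?hsn_ge0// mulrC sahs_bound.
Qed.

Lemma sahs_continuous A : sahs A -> continuous A.
Proof.
move=> sA; apply: (@continuous_lipschitz _ _ _ _ (Num.sqrt (hsn A))) => x y.
by rewrite -saB ?sahs_norm_bound//; exact: sA.1.
Qed.

Lemma sahsP A : sahs A <-> hilbert_schmidt A /\ selfadjoint A.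
Proof.
split=> [sA|[[_ _ As] sA]]; last by split.
split; last exact: sA.1.
by split; [exact: selfadjoint_linear sA.1|exact: sahs_continuous|exact: sA.2].
Qed.

End selfadjoint_operators.

(** * The spectral theorem *)

Section spectral_theorem.
Variables (R : realType) (U : hilbertType R).
Implicit Types (A : U -> U) (x y : U).

Lemma ultra_bounded_cvg (T : Type) (G : set_system T) (GU : UltraFilter G)
    (f : T -> R) (M : R) : (forall t, `|f t| <= M) ->
  exists l : R, f @ G --> l.
Proof.
move=> fM; have FF : ProperFilter (f @ G) by exact: fmap_proper_filter.
have := @segment_compact R (- M) M.
move=> /(_ (f @ G) FF) [|l [_ cl]].
  rewrite /= /fmap /=; apply: (@filterE _ G) => t; rewrite /= in_itv /=.
  by rewrite -ler_norml.
exists l => V nV.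
have [//|hC] := in_ultra_setVsetC (f @^-1` V) GU.
have [t [/= tC tV]] := cl (~` V) V hC nV.
by [].
Qed.

(** For [|x| <= 2] the terms [4 |A e|^2 - <x, A e>^2] are nonnegative, so their sum over [X] is at
    most their total [4 hsn A - |A x|^2]. The radius 2 accommodates differences of vectors of the
    unit ball. *)
Lemma sahs_tail A (X : {fset U}) x : sahs A -> [set` X] `<=` onb (U := U) ->
  `|x| <= 2 ->
  `|A x| ^+ 2 <= \sum_(e <- X) inner x (A e) ^+ 2 +
    4 * (hsn A - \sum_(e <- X) `|A e| ^+ 2).
Proof.
move=> sA XE x2.
pose f e := 4 * `|A e| ^+ 2 - inner x (A e) ^+ 2.
have f0 e : 0 <= f e.
  rewrite subr_ge0 -[leLHS]real_normK ?num_real//.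
  have -> : 4 * `|A e| ^+ 2 = (2 * `|A e|) ^+ 2 by rewrite exprMn; ring.
  rewrite ler_pXn2r ?nnegrE ?mulr_ge0//.
  by apply: le_trans (cauchy_schwarz _ _) _; rewrite ler_wpM2r.
have As : finsum (onb (U := U)) (fun e => 4 * `|A e| ^+ 2).
  by apply: finsumZ => //; exact: sA.2.
have fs : finsum (onb (U := U)) f.
  by apply: le_finsum As => e _; rewrite /f gerBl sqr_ge0.
have Ps : \esum_(e in @onb R U) (inner x (A e) ^+ 2)%:E = (`|A x| ^+ 2)%:E.
  by rewrite -(parseval _ (@onbP R U)); apply: eq_esum => e _; rewrite sA.1.
have ps : finsum (onb (U := U)) (fun e => inner x (A e) ^+ 2).
  by rewrite /finsum Ps ltry.
have pE : nnsum (onb (U := U)) (fun e => inner x (A e) ^+ 2) = `|A x| ^+ 2.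
  by rewrite /nnsum Ps.
have hf : nnsum (onb (U := U)) f + `|A x| ^+ 2 = 4 * hsn A.
  rewrite -pE -nnsumD//; last by move=> e _; rewrite sqr_ge0.
  rewrite hsn.unlock -[sqnorm _ A]/(nnsum _ _) -nnsumZ//; last exact: sA.2.
  by rewrite /nnsum; congr fine; apply: eq_esum => e _; rewrite /f subrK.
have : \sum_(e <- X) f e <= nnsum (onb (U := U)) f.
  by rewrite -lee_fin -nnsumE//; exact: esum_fset_ge.
rewrite /f big_split/= sumrN -mulr_sumr; lra.
Qed.

(** Compactness of [A]. Along an ultrafilter all the bounded scalars [<x n, A u>] converge at once,
    which replaces a diagonal extraction of subsequences; finitely many of them control [A (x n)] up
    to a small tail. *)
Lemma sahs_ultra_cvg A (G : set_system nat) (GU : UltraFilter G) (x : nat -> U) :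
  sahs A -> (forall n, `|x n| <= 1) -> cvg ((fun n => A (x n)) @ G).
Proof.
move=> sA x1; apply: (@hilbert_cauchy_cvg _ _ _ G) => e e0.
have e20 : 0 < e ^+ 2 by rewrite exprn_gt0.
(* The tail contributes less than [4 e^2 / 16], and the finite part, split through the limits [l u],
   less than [2 e^2 / 8] twice: below [e^2] in total. *)
have [X XE hX] : exists2 X : {fset U}, [set` X] `<=` onb (U := U) &
    hsn A - e ^+ 2 / 16 < \sum_(e <- X) `|A e| ^+ 2.
  have : ((hsn A - e ^+ 2 / 16)%:E < \esum_(e in @onb R U) (`|A e| ^+ 2)%:E)%E.
    rewrite esum_sqnorm; last exact: sA.2.
    by rewrite lte_fin hsn.unlock ltrBlDr ltrDl divr_gt0.
  by move=> /esum_fset_gt[X XE hX]; exists X => //; rewrite lte_fin in hX.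
have /choice[l hl] u : exists l : R, (fun n => inner (x n) (A u)) @ G --> l.
  apply: (@ultra_bounded_cvg _ _ _ _ `|A u|) => n.
  by apply: le_trans (cauchy_schwarz _ _) _; rewrite ler_piMl.
have cX : (fun n => \sum_(u <- X) (l u - inner (x n) (A u)) ^+ 2) @ G --> (0 : R).
  elim: (enum_fset X) => [|u s ih].
    by under eq_fun do rewrite big_nil; exact: cvg_cst.
  under eq_fun do rewrite big_cons.
  have h : (fun n => l u - inner (x n) (A u)) @ G --> l u - l u.
    by apply: cvgB; [exact: cvg_cst|exact: hl].
  have h2 : (fun n => (l u - inner (x n) (A u)) ^+ 2) @ G --> (l u - l u) ^+ 2.
    by apply: cvgM; exact: h.
  rewrite subrr expr0n /= in h2.
  have : (fun n => (l u - inner (x n) (A u)) ^+ 2 +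
      \sum_(u <- s) (l u - inner (x n) (A u)) ^+ 2) @ G --> (0 + 0 : R).
    exact: cvgD.
  by rewrite addr0.
have d0 : 0 < e ^+ 2 / 8 by rewrite divr_gt0.
move/cvgrPdist_lt : cX => /(_ _ d0) hn.
have small n : `|0 - \sum_(u <- X) (l u - inner (x n) (A u)) ^+ 2| < e ^+ 2 / 8 ->
    \sum_(u <- X) (l u - inner (x n) (A u)) ^+ 2 < e ^+ 2 / 8.
  by apply: le_lt_trans; rewrite sub0r normrN ler_norm.
have [k /small hk] := filter_ex hn.
exists (A (x k)); apply: filterS hn => n /small hnn.
rewrite -(@ltr_pXn2r _ 2)// ?nnegrE ?(ltW e0)//.
rewrite -(saB _ _ sA.1).
have d2 : `|x k - x n| <= 2.
  apply: le_trans (ler_normB _ _) _; have := x1 k; have := x1 n; lra.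
apply: le_lt_trans (sahs_tail sA XE d2) _.
have : \sum_(u <- X) inner (x k - x n) (A u) ^+ 2 <=
    2 * \sum_(u <- X) (l u - inner (x k) (A u)) ^+ 2 +
    2 * \sum_(u <- X) (l u - inner (x n) (A u)) ^+ 2.
  rewrite !mulr_sumr -big_split/=; apply: ler_sum => u _.
  rewrite innerBl; have := sqr_ge0 (l u - inner (x k) (A u) + (l u - inner (x n) (A u))).
  nra.
lra.
Qed.

(* On the invariant subspace [W] orthogonal to all eigenvectors, maximise
   [`|A y| ^+ 2] over the unit ball; a limit point of a maximising sequence
   satisfies [A (A y) = m2 *: y], so [A y + m *: y] or [y] is an eigenvector. *)
Lemma eigenvectors_complete A x : sahs A ->
  (forall c v, A v = c *: v -> inner x v = 0) -> x = 0.
Proof.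
move=> sA; pose W y := forall c v, A v = c *: v -> inner y v = 0.
move=> Wx; have sa := sA.1.
have WA y : W y -> W (A y).
  by move=> Wy c v vE; rewrite sa vE innerZr (Wy _ _ vE) mulr0.
have WZ (a : R) y : W y -> W (a *: y).
  by move=> Wy c v vE; rewrite innerZl (Wy _ _ vE) mulr0.
have WD y z : W y -> W z -> W (y + z).
  by move=> Wy Wz c v vE; rewrite innerDl (Wy _ _ vE) (Wz _ _ vE) addr0.
have W0 c v : W v -> A v = c *: v -> v = 0.
  move=> Wv vE; have := Wv _ _ vE; rewrite inner_norm => /eqP.
  by rewrite sqrf_eq0 normr_eq0 => /eqP.
apply: contrapT => xn0.
have Ax0 : A x <> 0.
  by move=> Ax0; apply: xn0; apply: (W0 0) => //; rewrite scale0r.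
pose S := [set `|A y| ^+ 2 | y in [set y | W y /\ `|y| <= 1]].
have supS : has_sup S.
  split.
    exists (`|A 0| ^+ 2), 0 => //; split; last by rewrite normr0.
    by move=> c v _; rewrite inner0l.
  exists (hsn A) => _ [y [_ y1] <-].
  apply: le_trans (sahs_bound _ sA) _.
  by rewrite ler_piMl ?hsn_ge0// expr_le1.
pose m2 := sup S.
have Sub y : W y -> `|A y| ^+ 2 <= m2 * `|y| ^+ 2.
  move=> Wy; have [->|y0] := eqVneq y 0.
    by rewrite (sa0 sa) !normr0 expr0n mulr0.
  have ny : 0 < `|y| by rewrite normr_gt0.
  have : `|A (`|y|^-1 *: y)| ^+ 2 <= m2.
    apply: ub_le_sup; first exact: supS.2.
    exists (`|y|^-1 *: y) => //; split; first exact: WZ.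
    by rewrite normrZ normfV normr_id mulVf// gt_eqF.
  rewrite (saZ _ _ sa) normrZ normfV normr_id exprMn exprVn mulrC ler_pdivrMr//.
  by rewrite exprn_gt0.
have m2_gt0 : 0 < m2.
  have := Sub _ Wx; have : 0 < `|A x| ^+ 2.
    by rewrite exprn_gt0// normr_gt0; exact/eqP.
  have : 0 <= `|x| ^+ 2 by rewrite sqr_ge0.
  move=> h1 h2 h3; rewrite ltNge; apply/negP => m0.
  by have := lt_le_trans h2 h3; rewrite ltNge mulr_le0_ge0.
have /choice[u hu] n : exists u, [/\ W u, `|u| <= 1 & m2 - n.+1%:R^-1 < `|A u| ^+ 2].
  have n0 : 0 < n.+1%:R^-1 :> R by rewrite invr_gt0.
  by have [_ [y [Wy y1] <-] hy] := sup_adherent n0 supS; exists y.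
have [G [GU Goo]] := @ultraFilterLemma nat \oo _.
have c0 : (fun n => m2 * n.+1%:R^-1 : R) @ G --> (0 : R).
  rewrite -(mulr0 m2); apply: cvgM; first exact: cvg_cst.
  by move=> V nV; apply: Goo; exact: (@cvg_harmonic R).
have /cvg_ex[/= z cz] := @sahs_ultra_cvg A G GU u sA (fun n => let: And3 _ h _ := hu n in h).
have cA := sahs_continuous sA.
have cAz : (fun n => A (A (u n))) @ G --> A z.
  exact: continuous_cvg (cA z) cz.
(* Expanding the square and using [|A A u|^2 <= m2 |A u|^2] and [|u| <= 1] bounds it by
   [m2 (m2 - |A u|^2)], which the choice of [u n] makes small. *)
have cd : (fun n => A (A (u n)) - m2 *: u n) @ G --> (0 : U).
  apply/cvgrPdist_lt => e e0; have e20 : 0 < e ^+ 2 by rewrite exprn_gt0.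
  move/cvgrPdist_lt : c0 => /(_ _ e20); apply: filterS => n hn.
  rewrite sub0r normrN -(@ltr_pXn2r _ 2)// ?nnegrE ?(ltW e0)//.
  apply: le_lt_trans hn; rewrite sub0r normrN.
  apply: le_trans (ler_norm _).
  have [Wu u1 uS] := hu n.
  rewrite normB_sqr innerZr sa inner_norm normrZ exprMn (gtr0_norm m2_gt0).
  have h1 := Sub _ (WA _ Wu).
  have h2 : `|u n| ^+ 2 <= 1 by rewrite expr_le1.
  have h3 : m2 ^+ 2 * `|u n| ^+ 2 <= m2 ^+ 2 by rewrite ler_piMr ?sqr_ge0.
  have h4 : m2 * (m2 - `|A (u n)| ^+ 2) <= m2 * n.+1%:R^-1.
    by rewrite ler_pM2l// lerBlDl -lerBlDr ltW.
  by move: h4; move: (m2 * _^-1) => b; lra.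
pose y := m2^-1 *: A z.
have cy : u @ G --> y.
  have : (fun n => m2^-1 *: (A (A (u n)) - (A (A (u n)) - m2 *: u n))) @ G --> m2^-1 *: (A z - 0).
    by apply: cvgZr; apply: cvgB.
  rewrite subr0; apply: cvg_trans; apply: near_eq_cvg; apply: nearW => n.
  by rewrite opprB addrC subrK scalerA mulVf ?gt_eqF// scale1r.
have Wy : W y.
  move=> c v vE.
  have : (fun n => inner (u n) v) @ G --> inner y v by exact: cvg_inner_l cy.
  move=> /cvg_lim <-//; under eq_fun => n do have [/(_ _ _ vE) -> _ _] := hu n.
  exact: lim_cst.
have cAy : (fun n => A (u n)) @ G --> A y by exact: continuous_cvg (cA y) cy.
have zE : z = A y by rewrite -(cvg_lim _ cz)// (cvg_lim _ cAy).
have AAy : A (A y) = m2 *: y by rewrite -zE /y scalerA divff ?gt_eqF// scale1r.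
clearbody y.
have Ay0 : m2 <= `|A y| ^+ 2.
  have h : (fun n => m2 - n.+1%:R^-1 - `|A (u n)| ^+ 2) @ G --> m2 - 0 - `|A y| ^+ 2.
    apply: cvgB; last exact: cvg_norm_sqr.
    apply: cvgB; first exact: cvg_cst.
    by move=> V nV; apply: Goo; exact: (@cvg_harmonic R).
  have : m2 - 0 - `|A y| ^+ 2 <= 0.
    by apply: (cvgr_to_le h); apply: nearW => n; have [_ _ /ltW] := hu n; rewrite subr_le0.
  by rewrite subr0 subr_le0.
pose m := Num.sqrt m2.
have mm : m * m = m2 by rewrite -expr2 sqr_sqrtr// ltW.
have y0 : A y + m *: y = 0.
  apply: (W0 m); first by apply: WD; [exact: WA|exact: WZ].
  by rewrite (saD _ _ sa) (saZ _ _ sa) AAy scalerDr scalerA mm addrC.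
have y00 : y = 0.
  by apply: (W0 (- m)) => //; rewrite scaleNr; apply/eqP; rewrite -addr_eq0 y0.
by move: Ay0; rewrite y00 (sa0 sa) normr0 expr0n leNgt m2_gt0.
Qed.

Definition eigenspace A (c : R) : set U := [set x | A x = c *: x].

Lemma eigenspace_closed A c : sahs A -> closed_subspace (eigenspace A c).
Proof.
move=> sA; have sa := sA.1; split.
- by rewrite /eigenspace /= (sa0 sa) scaler0.
- move=> a x y xE yE; rewrite /eigenspace /= (saD _ _ sa) (saZ _ _ sa) xE yE.
  by rewrite scalerDr !scalerA (mulrC a).
move=> u uE cu.
have h1 : (fun n => A (u n)) @ \oo --> A (limn u).
  have cA := sahs_continuous sA; exact: continuous_cvg (cA (limn u)) cu.
have h2 : (fun n => A (u n)) @ \oo --> c *: limn u.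
  by under eq_fun do rewrite uE; exact: cvgZr.
by rewrite /eigenspace /= -(cvg_lim _ h1)// (cvg_lim _ h2).
Qed.

Lemma orthobasis_bigcup_eigen A (E : R -> set U) : sahs A ->
  (forall c, orthobasis (eigenspace A c) (E c)) ->
  orthobasis [set: U] (\bigcup_c E c).
Proof.
move=> sA bE; split=> //.
  split=> [e [c _ Ece]|e f [c _ Ece] [d _ Edf] ef].
    by have [_ [+ _] _] := bE c; apply.
  have [cd|cd] := eqVneq c d.
    by subst d; have [_ [_ +] _] := bE c; apply.
  have [Ee _ _] := bE c; have [Ef _ _] := bE d.
  have := sA.1 e f; rewrite (Ee _ Ece) (Ef _ Edf) innerZl innerZr => /eqP.
  by rewrite -subr_eq0 -mulrBl mulf_eq0 subr_eq0 (negbTE cd) => /eqP.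
move=> x _ xE; apply: (eigenvectors_complete sA) => c v vE.
apply: (orthobasis_inner0 (eigenspace_closed c sA) (bE c) vE) => e Ee.
by apply: xE; exists c.
Qed.

End spectral_theorem.

(** * Eigenvalue sequences and the Carleman-Fredholm determinant *)

Lemma finsum_level_finite (R : realType) (T : choiceType) (E : set T) (f : T -> R)
    (t : R) : 0 < t -> (forall e, E e -> 0 <= f e) -> finsum E f ->
  finite_set (E `&` [set e | t < f e]).
Proof.
move=> t0 f0 fs; apply: contrapT => /infinite_set_fset inf.
set S := nnsum E f.
have S0 : 0 <= S by exact: nnsum_ge0.
have [X XE hX] := inf (Num.Def.archi_bound (S / t)).
have : \sum_(e <- X) f e <= S.
  by rewrite -lee_fin -nnsumE//; apply: esum_fset_ge => e /XE[].
have : \sum_(e <- X) t <= \sum_(e <- X) f e.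
  by rewrite big_seq [leRHS]big_seq; apply: ler_sum => e eX; have [_ /ltW] := XE _ eX.
have h : S / t < #|` X|%:R.
  have : 0 <= S / t by rewrite divr_ge0// ltW.
  by move=> /archi_boundP/lt_le_trans; apply; rewrite ler_nat.
rewrite big_const_seq count_predT iter_addr_0 -mulr_natl => h1 h2.
have := le_trans h1 h2; rewrite leNgt -ltr_pdivrMr ?h//.
Qed.

Lemma finsum_supp_countable (R : realType) (T : choiceType) (E : set T) (f : T -> R) :
  (forall e, E e -> 0 <= f e) -> finsum E f ->
  countable (E `&` [set e | 0 < f e]).
Proof.
move=> f0 fs.
apply: (@sub_countable _ _ _ (\bigcup_n (E `&` [set e | n.+1%:R^-1 < f e]))).
  apply: subset_card_le => e [Ee /= fe].
  have [k hk] := ltr_add_invr fe; exists k => //; split => //=.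
  by rewrite add0r in hk.
apply: bigcup_countable => // n _; apply/finite_set_countable.
by apply: finsum_level_finite.
Qed.

Section eigenvalue_sequences.
Variables (R : realType) (U : hilbertType R).
Implicit Types (A : U -> U) (E : set U).

(** The eigenvalue of a unit eigenvector [e] is recovered as [<A e, e>], so a basis carries no
    separate eigenvalue function. *)
Definition eigenbasis A E := orthobasis [set: U] E /\
  forall e, E e -> A e = inner (A e) e *: e.

Lemma eigenbasis_bigcup A (E : R -> set U) : sahs A ->
  (forall c, orthobasis (eigenspace A c) (E c)) ->
  eigenbasis A (\bigcup_c E c) /\
  (forall c e, E c e -> inner (A e) e = c).
Proof.
move=> sA bE.
have Ec c e : E c e -> inner (A e) e = c.
  move=> Ee; have [EW [E1 _] _] := bE c.
  by rewrite (EW _ Ee) innerZl E1// mulr1.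
split=> //; split; first exact: (orthobasis_bigcup_eigen sA bE).
by move=> e [c _ Ee]; rewrite (Ec _ _ Ee); have [EW _ _] := bE c; exact: EW.
Qed.

Lemma eigenspace_orthobasis A : sahs A ->
  exists E : R -> set U, forall c, orthobasis (eigenspace A c) (E c).
Proof.
move=> sA; have /choice[E bE] c : exists E, orthobasis (eigenspace A c) E.
  apply: exists_orthobasis => a x xE.
  by rewrite /eigenspace /= (saZ _ _ sA.1) xE !scalerA mulrC.
by exists E.
Qed.

(** The basis eigenvectors with nonzero eigenvalue are countable because the sum of [|A e|^2] is
    finite. An injection [f] into [nat] numbers them; indices outside its image receive 0, a value
    that [eigenvalue_seq] leaves unconstrained. *)
Lemma exists_eigenvalue_seq A : sahs A -> exists lam, eigenvalue_seq A lam.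
Proof.
move=> sA; have [E bE] := eigenspace_orthobasis sA.
have [[bcE cE] EcE] := eigenbasis_bigcup sA bE.
pose N := (\bigcup_c E c) `&` [set e | 0 < `|A e| ^+ 2].
have cN : countable N.
  by apply: finsum_supp_countable; [move=> e _; exact: sqr_ge0|exact: sahs_sqsum].
have [f finj] := countable_injP _ cN.
have NE c e : c != 0 -> E c e -> N e.
  move=> c0 Ee; split; first by exists c.
  have [EW [E1 _] _] := bE c.
  rewrite /= (EW _ Ee) exprn_gt0// normr_gt0 scaler_eq0 negb_or c0 /=.
  by apply/eqP => e0; have := E1 _ Ee; rewrite e0 inner0l => /eqP; rewrite eq_sym oner_eq0.
pose lam j := if pselect (exists2 e, N e & f e = j) is left h
  then inner (A (projT1 (cid2 h))) (projT1 (cid2 h)) else 0.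
have lamN e : N e -> lam (f e) = inner (A e) e.
  move=> Ne; rewrite /lam; case: pselect => [h|]; last by case; exists e.
  case: (cid2 h) => e' Ne' /= fe'.
  by rewrite (finj e' e)// inE.
exists lam => c c0; exists (E c); first exact: bE.
have -> : [set j | lam j = c] = f @` E c.
  apply/seteqP; split=> [j /=|_ [e Ee <-] /=].
    rewrite /lam; case: pselect => [h|_ c00]; last by rewrite c00 eqxx in c0.
    case: (cid2 h) => e [[d _ Ede] _] /= fe; rewrite (EcE _ _ Ede) => dc.
    by exists e => //; rewrite -dc.
  by rewrite lamN; [exact: EcE|exact: NE Ee].
rewrite card_eq_sym; apply: inj_card_eq => e1 e2.
by rewrite !inE => E1 E2; apply: finj; rewrite inE; apply: NE c0 _.
Qed.

(** The statement covers every enumeration, since [det2] picks an unspecified one. The bijections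
    between eigenspace bases and level sets of [lam] are glued over all [c != 0]; [g 0 = 0] makes
    the kernel vectors and the interspersed zeros invisible. *)
Lemma eigenvalue_seq_sum A lam : sahs A -> eigenvalue_seq A lam ->
  exists E, [/\ eigenbasis A E,
    forall g : R -> R, g 0 = 0 -> \esum_(e in E) (g (inner (A e) e))%:E =
      \esum_(j in [set: nat]) (g (lam j))%:E,
    forall j, lam j != 0 -> op_eigenvalue A (lam j) &
    forall e, E e -> inner (A e) e != 0 -> exists j, inner (A e) e = lam j].
Proof.
move=> sA lamP.
have [E0 bE0] := eigenspace_orthobasis sA.
have /choice[E hE] c : exists E, orthobasis (eigenspace A c) E /\
    (c != 0 -> (E #= [set j | lam j = c])%card).
  have [->|c0] := eqVneq c 0; first by exists (E0 0).
  by have [E bE cE] := lamP _ c0; exists E.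
have bE c := (hE c).1.
have [ebE EcE] := eigenbasis_bigcup sA bE.
have /choice[h hh] c : exists h : U -> nat, c != 0 -> set_bij (E c) [set j | lam j = c] h.
  have [c0|c0] := eqVneq c 0; first by exists (fun=> 0%N).
  by have /card_set_bijP[f fP] := (hE c).2 c0; exists f.
pose N := (\bigcup_c E c) `&` [set e | inner (A e) e != 0].
have NP e : N e -> E (inner (A e) e) e.
  by move=> [[c _ Ee] _]; rewrite (EcE _ _ Ee).
pose k e := h (inner (A e) e) e.
have kbij : set_bij N [set j | lam j != 0] k.
  split.
  - move=> e Ne; have [_ e0] := Ne.
    have [+ _ _] := hh _ e0 => /(_ e (NP _ Ne)) /= lk.
    by rewrite /= /k lk.
  - move=> e1 e2; rewrite !inE => N1 N2 k12.
    have [_ n1] := N1; have [_ n2] := N2.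
    have [f1 i1 _] := hh _ n1; have [f2 _ _] := hh _ n2.
    have e12 : inner (A e1) e1 = inner (A e2) e2.
      have := f1 _ (NP _ N1); have := f2 _ (NP _ N2); rewrite /= -/(k e1) -/(k e2) => <- <-.
      by rewrite k12.
    apply: i1; rewrite ?inE; [exact: NP|by rewrite e12; exact: NP|].
    by have := k12; rewrite /k -e12.
  - move=> j /= lj0; have [_ _ s] := hh _ lj0.
    have [e Ee he] := s j erefl; exists e; last by rewrite /k (EcE _ _ Ee).
    by split; [exists (lam j)|rewrite /= (EcE _ _ Ee)].
exists (\bigcup_c E c); split => //.
- move=> g g0.
  transitivity (\esum_(e in N) (g (inner (A e) e))%:E).
    rewrite esum_mkcondr; apply: eq_esum => e _; case: ifPn => //.
    by rewrite notin_setE /= => /negP; rewrite negbK => /eqP ->; rewrite g0.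
  transitivity (\esum_(j in [set j | lam j != 0]) (g (lam j))%:E).
    rewrite (reindex_esum N _ k)//; apply: eq_esum => e Ne.
    have [_ n1] := Ne; have [f1 _ _] := hh _ n1.
    by have /= := f1 _ (NP _ Ne); rewrite -/(k e) => ->.
  rewrite esum_mkcond; apply: eq_esum => j _; case: ifPn => //.
  by rewrite notin_setE /= => /negP; rewrite negbK => /eqP ->; rewrite g0.
- move=> j lj0; have [_ _ s] := kbij; have [e Ne ke] := s j lj0.
  have [_ n1] := Ne; have [f1 _ _] := hh _ n1.
  have /= := f1 _ (NP _ Ne); rewrite -/(k e) ke => ->.
  have [EW [E1 _] _] := bE (inner (A e) e).
  exists e; last exact: EW (NP _ Ne).
  by apply/eqP => e0; have := E1 _ (NP _ Ne); rewrite e0 inner0l => /eqP; rewrite eq_sym oner_eq0.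
- move=> e Ee e0; have Ne : N e by [].
  have [f1 _ _] := hh _ e0; exists (k e).
  by have /= := f1 _ (NP _ Ne).
Qed.

End eigenvalue_sequences.

(** The function [G] of the overview. *)
HB.lock Definition negldet (R : realType) (U : hilbertType R) (A : U -> U) : R :=
  - ln (det2 A).

Section carleman_fredholm.
Variable R : realType.

(** Minus the logarithm of the factor [(1 + t) e^(- t)] of [det_2]: nonnegative on [t > -1] and
    quadratic at 0, hence summable over square-summable eigenvalues that stay away from -1. *)
Definition phi (t : R) : R := t - ln (1 + t).

Lemma phi0 : phi 0 = 0.
Proof. by rewrite /phi addr0 ln1 subr0. Qed.

Lemma phi_ge0 t : -1 < t -> 0 <= phi t.
Proof. by move=> t1; rewrite subr_ge0 le_ln1Dx. Qed.

(** The inequality [log x <= x - 1] at [x = 1 / (1 + t)] gives [phi t <= t^2 / (1 + t)]. *)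
Lemma phi_le t d : 0 < d -> d <= 1 + t -> phi t <= d^-1 * t ^+ 2.
Proof.
move=> d0 dt; have t0 : 0 < 1 + t by exact: lt_le_trans dt.
have h : - ln (1 + t) <= (1 + t)^-1 - 1.
  rewrite -lnV ?posrE// -[X in ln X](subrK 1) [_ - 1 + 1]addrC le_ln1Dx//.
  by rewrite ltrBrDr addNr invr_gt0.
apply: (@le_trans _ _ ((1 + t)^-1 * t ^+ 2)).
  have -> : (1 + t)^-1 * t ^+ 2 = t + ((1 + t)^-1 - 1) by field; rewrite gt_eqF.
  by rewrite /phi lerD2l.
by rewrite ler_wpM2r ?sqr_ge0// lef_pV2.
Qed.

Lemma phi_lower t (C : R) : -1 < t -> phi t <= C -> expR (- 1 - C) <= 1 + t.
Proof.
move=> t1 tC; have t0 : 0 < 1 + t by lra.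
rewrite -[leRHS]lnK ?posrE// ler_expR; move: tC; rewrite /phi; lra.
Qed.

Lemma expR_phi t : -1 < t -> (1 + t) * expR (- t) = expR (- phi t).
Proof.
move=> t1; have t0 : 0 < 1 + t by lra.
by rewrite /phi opprB expRD lnK ?posrE.
Qed.

Lemma series_finsum (f : nat -> R) : (forall j, 0 <= f j) -> finsum [set: nat] f ->
  (fun n => \sum_(0 <= j < n) f j) @ \oo --> nnsum [set: nat] f.
Proof.
move=> f0 fs.
have h : (fun n => \sum_(0 <= j < n) (f j)%:E)%E @ \oo --> (nnsum [set: nat] f)%:E.
  rewrite -nnsumE//.
  rewrite -nneseries_esumT; last by move=> j; rewrite lee_fin.
  by apply: is_cvg_nneseries => j _ _; rewrite lee_fin.
have /fine_cvg := h; apply: cvg_trans; apply: near_eq_cvg; apply: nearW => n /=.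
by rewrite sumEFin.
Qed.

Variable U : hilbertType R.
Implicit Types (A : U -> U) (E : set U).

(* [d] witnesses that [I + A] is bounded below. *)
Definition spectral_data A E (d : R) : Prop := [/\ eigenbasis A E, 0 < d,
  forall e, E e -> d <= 1 + inner (A e) e &
  \esum_(e in E) (phi (inner (A e) e))%:E = (negldet A)%:E].

(** Square-summability forces [lam j] to 0, so all but finitely many eigenvalues exceed [-1/2] and
    the pointwise condition [lam j > -1] becomes a uniform bound [d]. With it the sum of
    [phi (lam j)] converges, and the partial products of [det2] are exponentials of minus its
    partial sums. *)
Lemma exists_spectral_data A : sahs A -> id_plus_pos A ->
  exists E d, spectral_data A E d.
Proof.
move=> sA [_ pA].
have [lam0 lam0P] := exists_eigenvalue_seq sA.
pose lam := xget (fun=> 0) (eigenvalue_seq A).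
have lamP : eigenvalue_seq A lam by apply: xgetPex; exists lam0.
have [E [eE sumE lamA Elam]] := eigenvalue_seq_sum sA lamP.
have lam1 j : -1 < lam j.
  have [->|/lamA/pA//] := eqVneq (lam j) 0.
  by rewrite ltrN10.
have sqE : \esum_(j in [set: nat]) (lam j ^+ 2)%:E = (hsn A)%:E.
  rewrite -(sumE (fun t => t ^+ 2)) ?expr0n//.
  rewrite -(esum_sahs eE.1 sA); apply: eq_esum => e Ee.
  rewrite [in RHS](eE.2 _ Ee) normrZ exprMn real_normK ?num_real//.
  by have [[_ [E1 _] _] _] := eE; rewrite -inner_norm E1// mulr1.
have sqs : finsum [set: nat] (fun j => lam j ^+ 2) by rewrite /finsum sqE ltry.
have sqc := series_finsum (fun j => sqr_ge0 (lam j)) sqs.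
have lam0c : (fun j => lam j ^+ 2) @ \oo --> (0 : R).
  by apply: cvg_series_cvg_0; apply/cvg_ex; exists (nnsum [set: nat] (fun j => lam j ^+ 2)).
have q0 : 0 < 4^-1 :> R by rewrite invr_gt0.
have [n0 _ hn0] : \forall n \near \oo, lam n ^+ 2 < 4^-1.
  move/cvgrPdist_lt : lam0c => /(_ _ q0); apply: filterS => n.
  by rewrite sub0r normrN ger0_norm ?sqr_ge0.
have [d d0 dP] : exists2 d, 0 < d & forall j, d <= 1 + lam j.
  have [d1 d10 d1P] : exists2 d, 0 < d & forall j, (j < n0)%N -> d <= 1 + lam j.
    elim: n0 {hn0} => [|n [d d0 ih]]; first by exists 1.
    exists (Num.min d (1 + lam n)); first by rewrite lt_min d0 /=; have := lam1 n; lra.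
    move=> j; rewrite ltnS leq_eqVlt => /orP[/eqP ->|jn].
      by rewrite ge_min lexx orbT.
    by rewrite ge_min ih.
  exists (Num.min d1 2^-1); first by rewrite lt_min d10 /= invr_gt0.
  move=> j; have [jn|jn] := ltnP j n0; first by rewrite ge_min d1P.
  rewrite ge_min; apply/orP; right; have := hn0 j jn => /= h.
  by have := sqr_ge0 (lam j - 1); nra.
have fs : finsum [set: nat] (phi \o lam).
  apply: (@le_finsum _ _ _ _ (fun j => d^-1 * lam j ^+ 2)).
    by move=> j _; apply: phi_le.
  apply: finsumZ => //; first by rewrite invr_ge0 ltW.
  by move=> j _; rewrite sqr_ge0.
have f0 j : 0 <= (phi \o lam) j by exact: phi_ge0.
(* The 1 serves the kernel vectors of [E], whose eigenvalue 0 need not occur in [lam]. *)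
exists E, (Num.min d 1); split => //.
- by rewrite lt_min d0 /= ltr01.
- move=> e Ee; have [->|/(Elam _ Ee)[j ->]] := eqVneq (inner (A e) e) 0.
    by rewrite addr0 ge_min lexx orbT.
  by rewrite ge_min dP.
rewrite (sumE phi phi0) (nnsumE (fun j _ => f0 j) fs); congr EFin.
set S := nnsum _ _.
have cS : (fun n => \sum_(0 <= j < n) phi (lam j)) @ \oo --> S.
  exact: series_finsum.
suff h : det2 A = expR (- S) by rewrite negldet.unlock h expRK opprK.
rewrite /det2 -/lam; apply: cvg_lim => //.
  have : (fun n => expR (- \sum_(0 <= j < n) phi (lam j))) @ \oo --> expR (- S).
    by apply: continuous_cvg; [exact: continuous_expR|exact: cvgN].
  apply: cvg_trans; apply: near_eq_cvg; apply: nearW => n.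
  by rewrite -sumrN expR_sum; apply: eq_bigr => j _; rewrite expR_phi.
Qed.

End carleman_fredholm.

(** * The Fenchel gap *)

Section fenchel.
Variable R : realType.

Definition psi (s : R) : R := s - 1 - ln s.

(** With [r = sqrt s], the bound [log r <= r - 1] gives [psi s >= (r - 1)^2]; then
    [(r + 1)^2 <= 2 (1 + r^2)], the difference being [(r - 1)^2]. *)
Lemma psi_lower s : 0 < s -> (s - 1) ^+ 2 / (2 * (1 + s)) <= psi s.
Proof.
move=> s0; pose r := Num.sqrt s.
have r0 : 0 < r by rewrite sqrtr_gt0.
have rs : s = r ^+ 2 by rewrite sqr_sqrtr// ltW.
have lnr : ln r <= r - 1.
  rewrite -[X in ln X](subrK 1) addrC; apply: le_ln1Dx; lra.
rewrite /psi rs lnXn// ler_pdivrMr; last by rewrite mulr_gt0// ltr_pwDl// sqr_ge0.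
have h : (r - 1) ^+ 2 <= r ^+ 2 - 1 - ln r *+ 2 by rewrite mulr2n; nra.
have k : 0 <= 2 * (1 + r ^+ 2) by rewrite mulr_ge0// addr_ge0// sqr_ge0.
apply: le_trans (ler_wpM2r k h).
have : 0 <= (r - 1) ^+ 2 * (r - 1) ^+ 2 by rewrite mulr_ge0 ?sqr_ge0.
nra.
Qed.

Lemma psi_ge0 s : 0 < s -> 0 <= psi s.
Proof.
move=> s0; apply: le_trans (psi_lower s0).
by rewrite divr_ge0 ?sqr_ge0// mulr_ge0// addr_ge0// ltW.
Qed.

Lemma psi_eq0 s : 0 < s -> psi s = 0 -> s = 1.
Proof.
move=> s0 p0; have := psi_lower s0; rewrite p0.
rewrite ler_pdivrMr; last by rewrite mulr_gt0// addr_gt0.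
rewrite mul0r => h; have : (s - 1) ^+ 2 == 0 by rewrite eq_le h sqr_ge0.
by rewrite sqrf_eq0 subr_eq0 => /eqP.
Qed.

Variable U : hilbertType R.
Implicit Types (A B : U -> U) (E F : set U).

Definition dsum E F (w : U -> U -> R) : \bar R :=
  \esum_(e in E) \esum_(f in F) (w e f)%:E.

Lemma dsumD E F w v : (forall e f, E e -> F f -> 0 <= w e f) ->
  (forall e f, E e -> F f -> 0 <= v e f) ->
  (dsum E F (fun e f => w e f + v e f)%R = dsum E F w + dsum E F v)%E.
Proof.
move=> w0 v0; rewrite /dsum -esumD; last 2 first.
- by move=> e Ee; apply: esum_ge0 => f Ff; rewrite lee_fin w0.
- by move=> e Ee; apply: esum_ge0 => f Ff; rewrite lee_fin v0.
apply: eq_esum => e Ee; rewrite -esumD; last 2 first.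
- by move=> f Ff; rewrite lee_fin w0.
- by move=> f Ff; rewrite lee_fin v0.
by apply: eq_esum => f Ff; rewrite EFinD.
Qed.

Lemma eq_dsum E F w v : (forall e f, E e -> F f -> w e f = v e f) ->
  dsum E F w = dsum E F v.
Proof. by move=> wv; apply: eq_esum => e Ee; apply: eq_esum => f Ff; rewrite wv. Qed.

Lemma le_dsum E F w v : (forall e f, E e -> F f -> w e f <= v e f) ->
  (dsum E F w <= dsum E F v)%E.
Proof.
by move=> wv; apply: le_esum => e Ee; apply: le_esum => f Ff; rewrite lee_fin wv.
Qed.

Lemma dsumZ E F (c : R) w : 0 <= c -> (forall e f, E e -> F f -> 0 <= w e f) ->
  dsum E F (fun e f => c * w e f) = (c%:E * dsum E F w)%E.
Proof.
move=> c0 w0; rewrite /dsum !esum_esum; last 2 first.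
- by move=> e f Ee Ff; rewrite lee_fin w0.
- by move=> e f Ee Ff; rewrite lee_fin mulr_ge0// w0.
by rewrite esumZl// => -[e f] [Ee Ff]; exact: w0.
Qed.

Lemma dsum_eq0 E F w : (forall e f, E e -> F f -> 0 <= w e f) ->
  dsum E F w = 0%E -> forall e f, E e -> F f -> w e f = 0.
Proof.
move=> w0 dw e f Ee Ff; apply/eqP; rewrite eq_le w0// andbT.
suff : ((w e f)%:E <= dsum E F w)%E by rewrite dw lee_fin.
apply: (@le_trans _ _ (\esum_(f in F) (w e f)%:E)).
  rewrite (esumID [set f])//; last by move=> g Fg; rewrite lee_fin w0.
  rewrite setI1 mem_set// esum_set1 ?lee_fin ?w0// leeDl// esum_ge0// => g [Fg _].
  by rewrite lee_fin w0.
rewrite /dsum [leRHS](esumID [set e])//; last first.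
  by move=> g Eg; apply: esum_ge0 => h Fh; rewrite lee_fin w0.
rewrite setI1 mem_set// esum_set1; last first.
  by apply: esum_ge0 => h Fh; rewrite lee_fin w0.
by rewrite leeDl// esum_ge0// => g [Eg _]; apply: esum_ge0 => h Fh; rewrite lee_fin w0.
Qed.

Lemma dsum_weight_l E F (u : U -> R) : orthonormal_set E -> orthobasis [set: U] F ->
  (forall e, E e -> 0 <= u e) ->
  dsum E F (fun e f => u e * inner e f ^+ 2) = \esum_(e in E) (u e)%:E.
Proof.
move=> [E1 _] bF u0; apply: eq_esum => e Ee.
rewrite esumZl ?u0//; last by move=> f _; rewrite sqr_ge0.
by rewrite parseval// -inner_norm E1// mule1.
Qed.

Lemma dsum_weight_r E F (u : U -> R) : orthobasis [set: U] E -> orthonormal_set F ->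
  (forall f, F f -> 0 <= u f) ->
  dsum E F (fun e f => u f * inner e f ^+ 2) = \esum_(f in F) (u f)%:E.
Proof.
move=> bE oF u0; rewrite /dsum exchange_esum; last first.
  by move=> e f _ Ff; rewrite lee_fin mulr_ge0 ?u0 ?sqr_ge0.
rewrite -(dsum_weight_l (E := F) oF bE u0); apply: eq_esum => f _.
by apply: eq_esum => e _; rewrite innerC.
Qed.

Definition posop A := sahs A /\ id_plus_pos A.

Lemma hsipE A B : sahs A -> sahs B ->
  hsip A B = (hsn (fun x => A x + B x) - hsn A - hsn B) / 2.
Proof.
move=> sA sB; rewrite hsip.unlock hsn.unlock fip_polar//; first exact: sA.2.
exact: sB.2.
Qed.

(** Parseval applied to [<(A + B) e, f> = (a_e + b_f) <e, f>], with [A] diagonalised on the left and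
    [B] on the right. *)
Lemma dsum_sqnorm E F A B : sahs A -> sahs B -> eigenbasis A E -> eigenbasis B F ->
  dsum E F (fun e f => (inner (A e) e + inner (B f) f) ^+ 2 * inner e f ^+ 2) =
  (hsn (fun x => A x + B x))%:E.
Proof.
move=> sA sB [bE aE] [bF bEq]; rewrite -(esum_sahs bE (sahsD sA sB)).
apply: eq_esum => e Ee; rewrite -(parseval _ bF); apply: eq_esum => f Ff.
congr EFin; rewrite innerDl [inner (B e) f]sB.1 [in RHS](aE _ Ee) [in RHS](bEq _ Ff).
by rewrite innerZl innerZr -mulrDl exprMn.
Qed.

(* The weights [inner e f ^+ 2] are doubly stochastic, so every trace in
   the Fenchel gap becomes a sum over pairs of eigenvectors. *)
Lemma fenchel_dsum A B E F d d' : sahs A -> sahs B ->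
  spectral_data A E d -> spectral_data B F d' ->
  dsum E F (fun e f =>
    psi ((1 + inner (A e) e) * (1 + inner (B f) f)) * inner e f ^+ 2) =
  (negldet A + negldet B + hsip A B)%:E.
Proof.
move=> sA sB [eE d0 dE GA] [eF d'0 dF GB].
pose a e := inner (A e) e; pose b f := inner (B f) f.
have [bE _] := eE; have [bF _] := eF.
have [_ oE _] := bE; have [_ oF _] := bF.
have a0 e : E e -> 0 < 1 + a e by move=> /dE; exact: lt_le_trans.
have b0 f : F f -> 0 < 1 + b f by move=> /dF; exact: lt_le_trans.
have w0 e f : 0 <= inner e f ^+ 2 by rewrite sqr_ge0.
have pa e : E e -> 0 <= phi (a e) by move=> /a0 h; apply: phi_ge0; lra.
have pb f : F f -> 0 <= phi (b f) by move=> /b0 h; apply: phi_ge0; lra.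
have ps e f : E e -> F f -> 0 <= psi ((1 + a e) * (1 + b f)).
  by move=> /a0 h1 /b0 h2; rewrite psi_ge0// mulr_gt0.
have sqa : \esum_(e in E) (a e ^+ 2)%:E = (hsn A)%:E.
  rewrite -(esum_sahs bE sA); apply: eq_esum => e Ee.
  rewrite [in RHS](eE.2 _ Ee) normrZ exprMn real_normK ?num_real//.
  by rewrite -inner_norm oE.1// mulr1.
have sqb : \esum_(e in F) (b e ^+ 2)%:E = (hsn B)%:E.
  rewrite -(esum_sahs bF sB); apply: eq_esum => e Ee.
  rewrite [in RHS](eF.2 _ Ee) normrZ exprMn real_normK ?num_real//.
  by rewrite -inner_norm oF.1// mulr1.
set D := dsum _ _ _.
(* Since [psi ((1 + a) (1 + b)) = phi a + phi b + a b] and [a b] has no fixed sign, the identity is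
   doubled and [2 a b] written as [(a + b)^2 - a^2 - b^2], with the negative squares moved to the
   left: every sum has nonnegative terms. *)
have : (D + D + ((hsn A)%:E + (hsn B)%:E) =
  (negldet A)%:E + (negldet A)%:E + ((negldet B)%:E + (negldet B)%:E) +
  (hsn (fun x => A x + B x))%:E)%E.
  rewrite -(dsum_sqnorm sA sB eE eF).
  rewrite -sqa.
  rewrite -sqb.
  rewrite -GA -GB.
  rewrite -(@dsum_weight_l E F (fun e => a e ^+ 2))//; last by move=> e _; exact: sqr_ge0.
  rewrite -(@dsum_weight_r E F (fun e => b e ^+ 2))//; last by move=> e _; exact: sqr_ge0.
  rewrite -(@dsum_weight_l E F (fun e => phi (a e)))//.
  rewrite -(@dsum_weight_r E F (fun e => phi (b e)))//.
  rewrite /D.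
  rewrite -!dsumD; try by move=> e f Ee Ff; do ?[exact: sqr_ge0|exact: ps|
    exact: pa|exact: pb|apply: addr_ge0|apply: mulr_ge0].
  apply: eq_dsum => e f Ee Ff.
  rewrite -/(a e) -/(b f) /psi /phi lnM ?posrE ?a0 ?b0//. 
  ring.
rewrite (hsipE sA sB).
(* The finiteness of the right-hand side also rules out an infinite [D]. *)
case: D => [r||] //=. case=> h; congr EFin; lra.
Qed.
End fenchel.

(** * Equality in the Fenchel inequality and strong convexity *)

Section fenchel_consequences.
Variables (R : realType) (U : hilbertType R).
Implicit Types (A B : U -> U) (E F : set U).

Lemma cancel_idD A B : cancel (idfun \+ B) (idfun \+ A) <->
  forall x, x + B x + A (x + B x) = x.
Proof. by []. Qed.

Lemma spectral_pos A E d e : spectral_data A E d -> E e -> 0 < 1 + inner (A e) e.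
Proof. by move=> [_ d0 dE _] /dE; exact: lt_le_trans. Qed.

Lemma eigenbasis_innerr B F f x : eigenbasis B F -> F f ->
  inner x (B f) = inner (B f) f * inner x f.
Proof. by move=> [_ bF] Ff; rewrite {1}(bF _ Ff) innerZr. Qed.

Lemma fenchel_ge0 A B : posop A -> posop B ->
  0 <= negldet A + negldet B + hsip A B.
Proof.
move=> [sA pA] [sB pB].
have [E [d dA]] := exists_spectral_data sA pA.
have [F [d' dB]] := exists_spectral_data sB pB.
rewrite -lee_fin -(fenchel_dsum sA sB dA dB).
apply: esum_ge0 => e Ee; apply: esum_ge0 => f Ff.
rewrite lee_fin mulr_ge0 ?sqr_ge0// psi_ge0// mulr_gt0//.
  exact: spectral_pos dA Ee.
exact: spectral_pos dB Ff.
Qed.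

(** A vanishing sum of nonnegative terms gives [psi = 0] or [<e, f> = 0] for each pair, so
    [(1 + a_e) (1 + b_f) <e, f> = <e, f>] always; these are the matrix coefficients of
    [(I + A) (I + B) = I]. *)
Lemma fenchel_eq0 A B : posop A -> posop B ->
  negldet A + negldet B + hsip A B = 0 -> cancel (idfun \+ B) (idfun \+ A).
Proof.
move=> [sA pA] [sB pB] h0.
have [E [d dA]] := exists_spectral_data sA pA.
have [F [d' dB]] := exists_spectral_data sB pB.
have := fenchel_dsum sA sB dA dB; rewrite h0 => /dsum_eq0 hw.
have [eE _ _ _] := dA; have [eF _ _ _] := dB; have [bE aE] := eE; have [bF bEq] := eF.
have w1 e f : E e -> F f ->
    (1 + inner (A e) e) * (1 + inner (B f) f) * inner e f = inner e f.
  move=> Ee Ff.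
  have p : 0 < (1 + inner (A e) e) * (1 + inner (B f) f).
    by rewrite mulr_gt0//; [exact: spectral_pos dA Ee|exact: spectral_pos dB Ff].
  have /eqP : psi ((1 + inner (A e) e) * (1 + inner (B f) f)) * inner e f ^+ 2 = 0.
    apply: hw => // e' f' Ee' Ff'; rewrite mulr_ge0 ?sqr_ge0// psi_ge0// mulr_gt0//.
      exact: spectral_pos dA Ee'.
    exact: spectral_pos dB Ff'.
  rewrite mulf_eq0 sqrf_eq0 => /orP[/eqP/(psi_eq0 p) ->|/eqP ->].
    by rewrite mul1r.
  by rewrite mulr0.
have BA e : E e -> (1 + inner (A e) e) *: (e + B e) = e.
  move=> Ee; apply/eqP; rewrite -subr_eq0; apply/eqP.
  have [_ _ cF] := bF; apply: cF => // f Ff.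
  rewrite innerBl innerZl innerDl [inner (B e) f]sB.1 (eigenbasis_innerr _ eF Ff).
  by rewrite -[X in _ * (X + _)]mul1r -mulrDl mulrA w1// subrr.
apply/cancel_idD => x; apply/eqP; rewrite -subr_eq0; apply/eqP.
have [_ _ cE] := bE; apply: cE => // e Ee.
rewrite innerBl innerDl [inner (A _) e]sA.1 (eigenbasis_innerr _ eE Ee).
rewrite -[X in X + _ - _]mul1r -mulrDl innerDl sB.1 -innerDr -innerZr BA//.
by rewrite subrr.
Qed.

Lemma cancel_weight A B E F d d' : posop A -> posop B ->
  cancel (idfun \+ B) (idfun \+ A) -> spectral_data A E d -> spectral_data B F d' ->
  forall e f, E e -> F f -> inner e f != 0 ->
  (1 + inner (A e) e) * (1 + inner (B f) f) = 1.
Proof.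
move=> [sA pA] [sB pB] /cancel_idD AB dA dB e f Ee Ff ef0.
have [eE _ _ _] := dA; have [eF _ _ _] := dB; have [bE aE] := eE; have [bF bEq] := eF.
apply: (mulIf ef0); rewrite mul1r.
have : inner e (f + B f + A (f + B f)) = inner e f by rewrite AB.
rewrite innerDr -sA.1 [inner (A e) _]innerC (eigenbasis_innerr _ eE Ee).
rewrite [inner (f + B f) e]innerC -[X in X + _ = _]mul1r -mulrDl innerDr.
rewrite (eigenbasis_innerr _ eF Ff).
by rewrite -[X in _ * (X + _) = _]mul1r -mulrDl mulrA => ->.
Qed.

Lemma fenchel_cancel A B : posop A -> posop B ->
  cancel (idfun \+ B) (idfun \+ A) -> negldet A + negldet B + hsip A B = 0.
Proof.
move=> pA pB AB; have [sA qA] := pA; have [sB qB] := pB.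
have [E [d dA]] := exists_spectral_data sA qA.
have [F [d' dB]] := exists_spectral_data sB qB.
suff : (negldet A + negldet B + hsip A B)%:E = 0%:E by move=> [].
rewrite -(fenchel_dsum sA sB dA dB).
apply: esum1 => e Ee; apply: esum1 => f Ff; congr EFin.
have [->|ef0] := eqVneq (inner e f) 0; first by rewrite expr0n mulr0.
rewrite (cancel_weight pA pB AB dA dB)//.
by rewrite /psi ln1 !subrr mul0r.
Qed.

Lemma eigenbasis_eigenvalue_le A E e : sahs A -> eigenbasis A E -> E e ->
  `|inner (A e) e| <= Num.sqrt (hsn A).
Proof.
move=> sA [[_ [E1 _] _] _] Ee; apply: le_trans (cauchy_schwarz _ _) _.
have n1 : `|e| = 1.
  by apply/eqP; rewrite -(@eqrXn2 _ 2)// -inner_norm E1// expr1n.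
by rewrite n1 mulr1; apply: le_trans (sahs_norm_bound _ sA) _; rewrite n1 mulr1.
Qed.

(* Strong convexity of [negldet] on Hilbert-Schmidt balls, with [- A] the
   gradient at [B0]. *)
Lemma negldet_strong_convex A B0 B1 (K : R) : posop A -> posop B0 -> posop B1 ->
  cancel (idfun \+ B0) (idfun \+ A) -> cancel (idfun \+ A) (idfun \+ B0) ->
  1 + Num.sqrt (hsn B0) <= K -> 1 + Num.sqrt (hsn B1) <= K ->
  hsn (fun x => B1 x - B0 x) / (4 * K ^+ 2) <= negldet A + negldet B1 + hsip A B1.
Proof.
move=> [sA pA] [sB0 pB0] [sB1 pB1] AB0 BA0 K0 K1.
have Kp : 0 < K by apply: lt_le_trans K0; rewrite ltr_pwDl ?sqrtr_ge0.
have [E [d dA]] := exists_spectral_data sA pA.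
have [F [d' dB]] := exists_spectral_data sB1 pB1.
have [eE _ _ _] := dA; have [eF _ _ _] := dB; have [bE aE] := eE; have [bF bEq] := eF.
(* As [I + A] inverts [I + B0], the eigenbasis of [A] diagonalises [B0] too, with
   [1 + b0 = 1 / (1 + a)]. The gap thus compares eigenvalues of [B1] directly with those of [B0]. *)
have B0E e : E e -> B0 e = inner (B0 e) e *: e /\ (1 + inner (A e) e) * (1 + inner (B0 e) e) = 1.
  move=> Ee; have a0 := spectral_pos dA Ee.
  have Ae : e + A e = (1 + inner (A e) e) *: e.
    by rewrite scalerDl scale1r -(aE _ Ee).
  have /cancel_idD/(_ e) := BA0; rewrite Ae (saZ _ _ sB0.1) => h.
  have [_ [E1 _] _] := bE.
  have := congr1 (fun v => inner v e) h; rewrite innerDl !innerZl E1// => h1.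
  split; last by rewrite mulrDr mulr1 -[X in X + _]mulr1.
  have -> : inner (B0 e) e = (1 + inner (A e) e)^-1 - 1.
    have -> : inner (B0 e) e = (1 + inner (A e) e)^-1 * ((1 + inner (A e) e) * inner (B0 e) e).
      by rewrite mulrA mulVf ?mul1r// gt_eqF.
    have -> : (1 + inner (A e) e) * inner (B0 e) e = 1 - (1 + inner (A e) e) by lra.
    by field; rewrite gt_eqF.
  apply: (scalerI (lt0r_neq0 a0)).
  rewrite scalerA mulrBr mulfV ?gt_eqF// mulr1 scalerBl scale1r.
  by apply/eqP; rewrite eq_sym subr_eq; apply/eqP; rewrite [RHS]addrC h.
have eB0 : eigenbasis B0 E by split => // e /B0E[].
rewrite -lee_fin -(fenchel_dsum sA sB1 dA dB).
pose w e f := (inner (B1 f) f - inner (B0 e) e) ^+ 2 * inner e f ^+ 2.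
have hw : dsum E F w = (hsn (fun x => B1 x - B0 x))%:E.
  have snB0 : sahs (fun x => - B0 x).
    rewrite (_ : (fun x => - B0 x) = (fun x => (-1) *: B0 x)); first exact: sahsZ.
    by apply/funext => x; rewrite scaleN1r.
  have eN : eigenbasis (fun x => - B0 x) E.
    by split => // e Ee; rewrite innerNl scaleNr -(eB0.2 _ Ee).
  rewrite (_ : (fun x => B1 x - B0 x) = (fun x => - B0 x + B1 x)); last first.
    by apply/funext => x; rewrite addrC.
  rewrite -(dsum_sqnorm snB0 sB1 eN eF); apply: eq_dsum => e f Ee Ff.
  by rewrite /w innerNl addrC.
rewrite EFinM -hw muleC.
have K4 : 0 <= (4 * K ^+ 2)^-1 by rewrite invr_ge0 mulr_ge0// sqr_ge0.
apply: (@le_trans _ _ (dsum E F (fun e f => (4 * K ^+ 2)^-1 * w e f))).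
  by rewrite dsumZ// => e f _ _; rewrite mulr_ge0 ?sqr_ge0.
apply: le_dsum => e f Ee Ff.
rewrite mulrA ler_wpM2r ?sqr_ge0//.
have [_ ab] := B0E _ Ee.
have hb := eigenbasis_eigenvalue_le sB1 eF Ff.
have hb0 := eigenbasis_eigenvalue_le sB0 eB0 Ee.
have b1p := spectral_pos dB Ff.
have a1p := spectral_pos dA Ee.
move: (inner (A e) e) (inner (B0 e) e) (inner (B1 f) f) ab hb hb0 b1p a1p => a b0 b ab hb hb0 b1p a1p.
have b0p : 0 < 1 + b0 by rewrite -(pmulr_rgt0 _ a1p) ab.
have bK : 1 + b <= K by have := ler_norm b; lra.
have b0K : 1 + b0 <= K by have := ler_norm b0; lra.
have sp : 0 < (1 + a) * (1 + b) by rewrite mulr_gt0.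
apply: le_trans (psi_lower sp).
have -> : (1 + a) * (1 + b) = (1 + b) / (1 + b0).
  have -> : 1 + a = (1 + b0)^-1 by apply: (mulIf (lt0r_neq0 b0p)); rewrite ab mulVf ?gt_eqF.
  by rewrite mulrC.
(* Both [1 + b] and [1 + b0] are at most [K], so the new denominator is at most [2 K (2 K)], whence
   [4 K^2]. *)
have -> : ((1 + b) / (1 + b0) - 1) ^+ 2 / (2 * (1 + (1 + b) / (1 + b0))) =
    (b - b0) ^+ 2 / (2 * (1 + b0) * ((1 + b) + (1 + b0))).
  by field; rewrite !gt_eqF// addr_gt0.
rewrite mulrC ler_wpM2l ?sqr_ge0// lef_pV2 ?posrE; last 2 first.
- by rewrite mulr_gt0// exprn_gt0.
- by rewrite !mulr_gt0// addr_gt0.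
have h1 : (1 + b0) * (1 + b + (1 + b0)) <= K * (K + K).
  by apply: ler_pM => //; [exact: ltW|rewrite addr_ge0 ?ltW|rewrite lerD].
by rewrite expr2; lra.
Qed.

End fenchel_consequences.

(** * Inverse pairs *)

Section inverse_pairs.
Variables (R : realType) (U : hilbertType R).
Implicit Types (A B : U -> U).

Definition coercive B (d : R) : Prop := forall x, d * `|x| ^+ 2 <= inner (x + B x) x.

Lemma spectral_data_coercive B E d : sahs B -> spectral_data B E d -> coercive B d.
Proof.
move=> sB [eE d0 dE _] x; have [bE bEq] := eE.
pose b e := inner (B e) e.
have wb e : E e -> inner (B x) e = b e * inner x e.
  by move=> Ee; rewrite sB.1 (eigenbasis_innerr _ eE Ee).
(* The identity [4 <x + B x, x> = |2 x + B x|^2 - |B x|^2] turns the signed quadratic form into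
   squared norms, which are compared coefficientwise. *)
have : ((`|B x| ^+ 2)%:E + (4 * d)%:E * (`|x| ^+ 2)%:E <= (`|2 *: x + B x| ^+ 2)%:E)%E.
  rewrite -!(parseval _ bE) -esumZl; last 2 first.
  - by rewrite mulr_ge0// ltW.
  - by move=> e _; rewrite sqr_ge0.
  rewrite -esumD; last 2 first.
  - by move=> e _; rewrite lee_fin sqr_ge0.
  - by move=> e _; rewrite lee_fin mulr_ge0 ?sqr_ge0// mulr_ge0// ltW.
  apply: le_esum => e Ee; rewrite -EFinD lee_fin innerDl innerZl wb//.
  have := dE _ Ee; rewrite -/(b e) => h.
  have : 0 <= (1 + b e - d) * inner x e ^+ 2 by rewrite mulr_ge0 ?sqr_ge0// subr_ge0.
  nra.
rewrite -EFinM -EFinD lee_fin normD_sqr normrZ innerZl exprMn normr_nat.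
rewrite innerDl inner_norm (innerC x (B x)); lra.
Qed.

Lemma posop_coercive B : posop B -> exists2 d, 0 < d & coercive B d.
Proof.
move=> [sB pB]; have [E [d dB]] := exists_spectral_data sB pB.
by exists d; [have [] := dB|exact: spectral_data_coercive dB].
Qed.

Lemma coercive_posop B d : 0 < d -> sahs B -> coercive B d -> posop B.
Proof.
move=> d0 sB cB; split => //; split; first exact: sB.1.
move=> c [x x0 Bx]; have := cB x; rewrite Bx innerDl innerZl inner_norm.
have nx : 0 < `|x| ^+ 2 by rewrite exprn_gt0// normr_gt0.
rewrite -[X in X + _]mul1r -mulrDl => h.
have : 0 < (1 + c) * `|x| ^+ 2 by apply: lt_le_trans h; rewrite mulr_gt0.
by rewrite pmulr_lgt0//; lra.
Qed.

Lemma coercive_norm B d x : 0 < d -> coercive B d -> `|x| <= d^-1 * `|x + B x|.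
Proof.
move=> d0 cB; have [->|x0] := eqVneq x 0.
  by rewrite normr0 mulr_ge0// invr_ge0 ltW.
have nx : 0 < `|x| by rewrite normr_gt0.
rewrite ler_pdivlMl// -(ler_pM2r nx) -mulrA -expr2.
by apply: le_trans (cB x) _; apply: le_trans (ler_norm _) _; exact: cauchy_schwarz.
Qed.

(** The range of [T = I + B] is closed, as preimages of a Cauchy sequence are Cauchy by coercivity,
    and dense, as [z] orthogonal to it satisfies [d |z|^2 <= <T z, z> = 0]. *)
Lemma coercive_surjective B d : 0 < d -> sahs B -> coercive B d ->
  forall y, exists x, x + B x = y.
Proof.
move=> d0 sB cB; pose T x := x + B x.
have sT : selfadjoint T by move=> x y; rewrite innerDl innerDr sB.1.
have TN x y : T x - T y = (x - y) + B (x - y) by rewrite /T (saB _ _ sB.1) opprD addrACA.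
pose W := range T.
have cW : closed_subspace W.
  split.
  - by exists 0; rewrite // (sa0 sT).
  - move=> a _ _ [x _ <-] [y _ <-]; exists (a *: x + y) => //.
    by rewrite (saD _ _ sT) (saZ _ _ sT).
  move=> u uW cu.
  have /choice[x hx] n : exists x, T x = u n by have [x _ xE] := uW n; exists x.
  have cx : cvgn x.
    apply: (@hilbert_cauchy_cvg _ _ _ \oo) => e e0.
    have de : 0 < d * e / 2 by rewrite divr_gt0// mulr_gt0.
    have /cvgrPdist_lt/(_ _ de)[N _ hN] := cu.
    exists (x N); exists N => // n /= Nn.
    apply: le_lt_trans (coercive_norm _ d0 cB) _.
    rewrite -TN !hx mulrC ltr_pdivrMr//.
    have -> : u N - u n = (limn u - u n) - (limn u - u N) by rewrite opprB [RHS]addrC subrKA.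
    apply: le_lt_trans (ler_normB _ _) _.
    have := hN N (leqnn N); have := hN n Nn => /=; lra.
  exists (limn x) => //.
  have h1 : (fun n => T (x n)) @ \oo --> T (limn x).
    apply: cvgD; first exact: cx.
    have cBc := sahs_continuous sB.
    exact: continuous_cvg (cBc (limn x)) cx.
  rewrite -(cvg_lim _ h1)//; congr (limn _); apply/funext => n; exact: hx.
have [E [EW oE cE]] : exists E, orthobasis W E.
  apply: exists_orthobasis => a _ [x _ <-]; exists (a *: x) => //.
  by rewrite (saZ _ _ sT).
have bT : orthobasis [set: U] E.
  split => // z _ zE.
  have zT : inner z (T z) = 0.
    by apply: (orthobasis_inner0 cW (And3 EW oE cE)) => //; exists z.
  have := cB z; rewrite innerC zT pmulr_rle0// => h.
  by apply/eqP; rewrite -normr_eq0 -sqrf_eq0 eq_le h sqr_ge0.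
move=> y.
have [F [FE cF]] := orthobasis_expansion (closed_subspaceT U) bT (x := y) Logic.I.
have [x _ <-] : W y; last by exists x.
have [_ _ Wlim] := cW; rewrite -(cvg_lim _ cF)//; apply: Wlim.
  by move=> n; exact: closed_subspace_proj cW EW (FE n).
by apply/cvg_ex; exists y.
Qed.

(** With [P] the inverse of [I + B], [A = P - I = - P B] is Hilbert-Schmidt as a bounded operator
    after a Hilbert-Schmidt one. If [A x = c x], then [(1 + c) |x|^2 = <x, P x>], which is positive
    by coercivity at [P x]. *)
Lemma exists_inverse_pair B d : 0 < d -> sahs B -> coercive B d ->
  exists A, [/\ posop A, cancel (idfun \+ B) (idfun \+ A),
    cancel (idfun \+ A) (idfun \+ B) & forall x, `|x + A x| <= d^-1 * `|x|].
Proof.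
move=> d0 sB cB.
have /choice[P TP] := coercive_surjective d0 sB cB.
have inj x y : x + B x = y + B y -> x = y.
  move=> xy; apply/eqP; rewrite -subr_eq0 -normr_le0.
  apply: le_trans (coercive_norm _ d0 cB) _.
  by rewrite (saB _ _ sB.1) addrACA -opprD xy subrr normr0 mulr0.
have PT x : P (x + B x) = x by apply: inj; rewrite TP.
have sP : selfadjoint P.
  move=> x y; rewrite -{1}(TP y) -{2}(TP x) innerDl innerDr.
  by rewrite sB.1.
have nP x : `|P x| <= d^-1 * `|x|.
  by have := coercive_norm (P x) d0 cB; rewrite TP.
pose A x := P x - x.
have AE x : A x = - P (B x).
  by rewrite /A -{2}[x]PT (saD _ _ sP) opprD addNKr.
exists A; split.
- split.
    split; first by move=> x y; rewrite innerBl innerBr sP.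
    have di : 0 <= d^-1 by rewrite invr_ge0 ltW.
    have hP x : `|- P x| <= d^-1 * `|x| by rewrite normrN.
    have [h _] := sqnorm_comp_bound di sB.2 hP.
    by rewrite (_ : A = (fun x => - P x) \o B)//; apply/funext => x; rewrite AE.
  split; first by move=> x y; rewrite innerBl innerBr sP.
  move=> c [x x0 Ax].
  have Px : P x = (1 + c) *: x by rewrite scalerDl scale1r -Ax /A addrC subrK.
  have Px0 : P x != 0.
    by apply: contra x0 => /eqP P0; rewrite -(TP x) P0 (sa0 sB.1) addr0.
  have := cB (P x); rewrite TP {2}Px innerZr inner_norm => h.
  have : 0 < (1 + c) * `|x| ^+ 2.
    by apply: lt_le_trans h; rewrite mulr_gt0// exprn_gt0// normr_gt0.
  by rewrite pmulr_lgt0 ?exprn_gt0 ?normr_gt0//; lra.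
- by apply/cancel_idD => x; rewrite /A addrC subrK PT.
- by apply/cancel_idD => x; rewrite /A [x + _]addrC subrK TP.
- by move=> x; rewrite /A addrC subrK.
Qed.

End inverse_pairs.

(** * Constrained minimisation *)

Section constrained_minimisation.
Variables (R : realType) (U : hilbertType R).
Implicit Types (A B C : U -> U).

Lemma hsipC A B : hsip A B = hsip B A.
Proof. by rewrite hsip.unlock fipC. Qed.

Lemma hsipDr A B C : sahs A -> sahs B -> sahs C ->
  hsip A (fun x => B x + C x) = hsip A B + hsip A C.
Proof.
by move=> [_ sA] [_ sB] [_ sC]; rewrite hsip.unlock fipC fipDl// !(fipC _ A).
Qed.

Lemma hsipZr (a : R) A B : sahs A -> sahs B ->
  hsip A (fun x => a *: B x) = a * hsip A B.
Proof. by move=> [_ sA] [_ sB]; rewrite hsip.unlock fipC fipZl// (fipC _ B A). Qed.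

Lemma hsipBr A B C : sahs A -> sahs B -> sahs C ->
  hsip A (fun x => B x - C x) = hsip A B - hsip A C.
Proof.
by move=> [_ sA] [_ sB] [_ sC]; rewrite hsip.unlock fipC fipBl// !(fipC _ A).
Qed.

Lemma hsnZ (a : R) A : sahs A -> hsn (fun x => a *: A x) = a ^+ 2 * hsn A.
Proof. by move=> [_ sA]; rewrite hsn.unlock sqnormZ. Qed.

Lemma hsip_le A B : sahs A -> sahs B ->
  hsip A B <= Num.sqrt (hsn A) * Num.sqrt (hsn B).
Proof. by move=> [_ sA] [_ sB]; by rewrite hsip.unlock hsn.unlock; exact: fip_le. Qed.

Lemma spectral_data_phi_ge0 B E d e : spectral_data B E d -> E e ->
  0 <= phi (inner (B e) e).
Proof. by move=> dB Ee; apply: phi_ge0; have := spectral_pos dB Ee; lra. Qed.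

Lemma negldet_ge0 B : posop B -> 0 <= negldet B.
Proof.
move=> [sB pB]; have [E [d dB]] := exists_spectral_data sB pB.
have [_ _ _ GB] := dB.
rewrite -lee_fin -GB; apply: esum_ge0 => e Ee.
by rewrite lee_fin; exact: spectral_data_phi_ge0 dB Ee.
Qed.

(** The nonnegative terms [phi (b_e)] sum to [negldet B], so each is at most [c], and [phi_lower]
    bounds every [1 + b_e] from below. The constant depends on [c] only. *)
Lemma coercive_negldet_le B (c : R) : posop B -> negldet B <= c ->
  coercive B (expR (- 1 - c)).
Proof.
move=> [sB pB] Bc; have [E [d dB]] := exists_spectral_data sB pB.
apply: (@spectral_data_coercive _ _ _ E) => //.
have [eE d0 dE GB] := dB; split; rewrite ?expR_gt0//.
move=> e Ee; apply: phi_lower; first by have := spectral_pos dB Ee; lra.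
apply: le_trans Bc; rewrite -lee_fin -GB.
rewrite (esumID [set e])//; last first.
  by move=> f Ef; rewrite lee_fin; exact: spectral_data_phi_ge0 dB Ef.
rewrite setI1 mem_set// esum_set1; last first.
  by rewrite lee_fin; exact: spectral_data_phi_ge0 dB Ee.
rewrite leeDl// esum_ge0// => f [Ef _].
by rewrite lee_fin; exact: spectral_data_phi_ge0 dB Ef.
Qed.

Definition convex_comb (t : R) B C x : U := (1 - t) *: B x + t *: C x.

Lemma sahs_convex_comb t B C : sahs B -> sahs C -> sahs (convex_comb t B C).
Proof. by move=> sB sC; apply: sahsD; exact: sahsZ. Qed.

Lemma posop_midpoint B C : posop B -> posop C -> posop (convex_comb 2^-1 B C).
Proof.
move=> pB pC; have [d d0 cB] := posop_coercive pB; have [d' d'0 cC] := posop_coercive pC.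
apply: (@coercive_posop _ _ _ (2^-1 * (d + d'))).
- by rewrite mulr_gt0// ?invr_gt0// addr_gt0.
- by apply: sahs_convex_comb; [exact: pB.1|exact: pC.1].
move=> x; have := cB x; have := cC x; rewrite /convex_comb !innerDl !innerZl; lra.
Qed.

Variables (K : set (U -> U)) (M : R).
Hypothesis K_sahs : forall B, K B -> sahs B.
Hypothesis K_convex : forall t B C, 0 <= t <= 1 -> K B -> K C ->
  K (convex_comb t B C).
Hypothesis K_bounded : forall B, K B -> hsn B <= M.
Hypothesis K_closed : forall (B_ : nat -> U -> U) B, (forall n, K (B_ n)) ->
  (forall x, (fun n => B_ n x) @ \oo --> B x) -> K B.

(** Strong convexity is used at the midpoint [D] towards [B] and [C], both at distance
    [|B - C| / 2]. In the sum the linear terms combine to [2 tr (A D)], leaving [|B - C|^2 / (8 L^2)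
    <= G B + G C - 2 G D <= 2 b] with [L = 1 + sqrt M]. *)
Lemma strong_convex_midpoint B C (m b : R) : K B -> K C -> posop B -> posop C ->
  (forall D, K D -> posop D -> m <= negldet D) ->
  negldet B <= m + b -> negldet C <= m + b ->
  hsn (fun x => B x - C x) <= 16 * (1 + Num.sqrt M) ^+ 2 * b.
Proof.
move=> KB KC pB pC hm Bm Cm.
pose D := convex_comb 2^-1 B C.
have h2 : 0 <= (2^-1 : R) <= 1 by rewrite invr_ge0 ler0n invf_le1 ?ltr0n// ler1n.
have KD : K D by exact: K_convex.
have pD : posop D by exact: posop_midpoint.
have [d d0 cD] := posop_coercive pD.
have [A [pA AD DA _]] := exists_inverse_pair d0 pD.1 cD.
have MK X : K X -> 1 + Num.sqrt (hsn X) <= 1 + Num.sqrt M.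
  by move=> KX; rewrite lerD2l ler_wsqrtr// K_bounded.
have h3 := negldet_strong_convex pA pD pB AD DA (MK _ KD) (MK _ KB).
have h4 := negldet_strong_convex pA pD pC AD DA (MK _ KD) (MK _ KC).
have h5 := fenchel_cancel pA pD AD.
have hD : hsip A D = 2^-1 * (hsip A B + hsip A C).
  rewrite /D /convex_comb (hsipDr pA.1 (sahsZ _ pB.1) (sahsZ _ pC.1)).
  rewrite (hsipZr _ pA.1 pB.1) (hsipZr _ pA.1 pC.1); lra.
have sBC : sahs (fun x => B x - C x) by apply: sahsB; [exact: pB.1|exact: pC.1].
have e1 : hsn (fun x => B x - D x) = 4^-1 * hsn (fun x => B x - C x).
  rewrite (_ : (fun x => B x - D x) = (fun x => 2^-1 *: (B x - C x))).
    rewrite (hsnZ _ sBC); congr (_ * _); lra.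
  apply/funext => x; rewrite /D /convex_comb scalerBr opprD addrA; congr (_ - _).
  rewrite -{1}[B x]scale1r -scalerBl; congr (_ *: _); lra.
have e2 : hsn (fun x => C x - D x) = 4^-1 * hsn (fun x => B x - C x).
  rewrite (_ : (fun x => C x - D x) = (fun x => (- 2^-1) *: (B x - C x))).
    rewrite (hsnZ _ sBC); congr (_ * _); lra.
  apply/funext => x; rewrite /D /convex_comb scalerBr !scaleNr opprK opprD addrCA.
  rewrite -{1}[C x]scale1r -scalerBl; congr (- (_ *: _) + _ *: _); lra.
rewrite e1 in h3; rewrite e2 in h4.
have k0 : 0 < 1 + Num.sqrt M by rewrite ltr_pwDl ?sqrtr_ge0.
have k1 : 0 < 4 * (1 + Num.sqrt M) ^+ 2 by rewrite mulr_gt0// exprn_gt0.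
have := hm _ KD pD.
have : 2 * (4^-1 * hsn (fun x => B x - C x) / (4 * (1 + Num.sqrt M) ^+ 2)) <=
   2 * b + 2 * m - 2 * negldet D by lra.
move=> h6 h7.
have : 4^-1 * hsn (fun x => B x - C x) / (4 * (1 + Num.sqrt M) ^+ 2) <= b by lra.
rewrite ler_pdivrMr//; lra.
Qed.

Lemma exists_constrained_minimizer : (exists2 B, K B & posop B) ->
  exists B, [/\ K B, posop B &
    forall C, K C -> posop C -> negldet B <= negldet C].
Proof.
move=> [B0 KB0 pB0].
pose S := [set negldet B | B in [set B | K B /\ posop B]].
have infS : has_inf S.
  split; first by exists (negldet B0), B0.
  by exists 0 => _ [B [_ pB] <-]; exact: negldet_ge0.
pose m := inf S.
have hm D : K D -> posop D -> m <= negldet D.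
  by move=> KD pD; apply: ge_inf; [exact: infS.2|exists D].
have /choice[B_ hB] n : exists B, [/\ K B, posop B & negldet B <= m + n.+1%:R^-1].
  have n0 : 0 < n.+1%:R^-1 :> R by rewrite invr_gt0.
  by have [_ [B [KB pB] <-] /ltW hB] := inf_adherent n0 infS; exists B.
have KB n : K (B_ n) by have [] := hB n.
have pB n : posop (B_ n) by have [] := hB n.
have sB n := (pB n).1.
pose c := 16 * (1 + Num.sqrt M) ^+ 2.
have c0 : 0 <= c by rewrite mulr_ge0// sqr_ge0.
have close n k : (n <= k)%N -> hsn (fun x => B_ n x - B_ k x) <= c * n.+1%:R^-1.
  move=> nk; apply: strong_convex_midpoint hm _ _ => //; first by have [] := hB n.
  have [_ _ h] := hB k; apply: le_trans h _; rewrite lerD2l.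
  by rewrite lef_pV2 ?posrE ?ltr0n// ler_nat.
have cN0 (a : R) : (fun n => a * n.+1%:R^-1) @ \oo --> (0 : R).
  rewrite -(mulr0 a); apply: cvgM; first exact: cvg_cst.
  exact: (@cvg_harmonic R).
have cB x : cvgn (fun n => B_ n x).
  apply: (@hilbert_cauchy_seq_cvg _ _ _ (fun n => `|x| ^+ 2 * c * n.+1%:R^-1)) => //.
  move=> n k nk; apply: le_trans (sahs_bound x (sahsB (sB n) (sB k))) _.
  by rewrite -mulrA ler_wpM2l ?sqr_ge0// close.
pose B x := limn (fun n => B_ n x).
have KBl : K B by apply: (@K_closed B_) => // x; exact: cB.
have sBl := K_sahs KBl.
(* Since [1 / (n + 1) <= 1], the value [m + 1] bounds [negldet] along the whole sequence and gives
   one coercivity constant for all [n]. *)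
have coB : coercive B (expR (- 1 - (m + 1))).
  move=> x.
  have cx : (fun n => inner (x + B_ n x) x) @ \oo --> inner (x + B x) x.
    by apply: cvg_inner_l; apply: cvgD; [exact: cvg_cst|exact: cB].
  apply: (cvgr_to_ge cx); apply: nearW => n.
  apply: coercive_negldet_le => //; have [_ _ h] := hB n; apply: le_trans h _.
  by rewrite lerD2l invf_le1// ler1n.
have e0 : 0 < expR (- 1 - (m + 1)) by exact: expR_gt0.
have pBl : posop B by exact: coercive_posop e0 sBl coB.
exists B; split => // C KC pC; apply: le_trans (hm _ KC pC).
have distB n : hsn (fun x => B_ n x - B x) <= c * n.+1%:R^-1.
  have h : (\esum_(x in @onb R U) (`|B_ n x - B x| ^+ 2)%:E <= (c * n.+1%:R^-1)%:E)%E.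
    apply: (@esum_sqnorm_lim _ _ _ _ nat \oo _ (fun k x => B_ n x - B_ k x)).
      by move=> x _; apply: cvgB; [exact: cvg_cst|exact: cB].
    exists n => // k /= nk; rewrite esum_sqnorm; last exact: (sahsB (sB n) (sB k)).2.
    by rewrite lee_fin; have := close _ _ nk; rewrite hsn.unlock.
  by have [_] := esum_sqnorm_le h; rewrite hsn.unlock.
have [A [pA AB BA _]] := exists_inverse_pair e0 sBl coB.
have h1 := fenchel_cancel pA pBl AB.
(* The gap is 0 at [(A, B)] and nonnegative at [(A, B_ n)], hence
   [G B <= G (B_ n) + tr (A (B_ n - B))]; the trace tends to 0 with the Hilbert-Schmidt distance. *)
have h2 n : negldet B <= m + (n.+1%:R^-1 + Num.sqrt (hsn A) * Num.sqrt (c * n.+1%:R^-1)).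
  have := fenchel_ge0 pA (pB n); have [_ _] := hB n.
  have : hsip A (fun x => B_ n x - B x) <= Num.sqrt (hsn A) * Num.sqrt (c * n.+1%:R^-1).
    apply: le_trans (hsip_le pA.1 (sahsB (sB n) sBl)) _.
    by rewrite ler_wpM2l ?sqrtr_ge0// ler_wsqrtr.
  rewrite hsipBr//; last exact: pA.1.
  set q := _ * Num.sqrt (c * _); set i := n.+1%:R^-1.
  by clearbody q i; lra.
have cl : (fun n => m + (n.+1%:R^-1 + Num.sqrt (hsn A) * Num.sqrt (c * n.+1%:R^-1))) @ \oo -->
   m + (0 + Num.sqrt (hsn A) * Num.sqrt 0).
  apply: cvgD; first exact: cvg_cst.
  apply: cvgD; first exact: (@cvg_harmonic R).
  apply: cvgM; first exact: cvg_cst.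
  apply: continuous_cvg; first exact: sqrt_continuous.
  exact: cN0.
rewrite sqrtr0 mulr0 !addr0 in cl.
by apply: (cvgr_to_ge cl); apply: nearW.
Qed.

End constrained_minimisation.

(** * First-order optimality *)

Section optimality.
Variables (R : realType) (U : hilbertType R).
Implicit Types (A B C : U -> U).

(** If [q > 0], the choice [t = min (t0, q / (2 c))] would give [q <= q / 2]. *)
Lemma le0_small (q c t0 : R) : 0 < t0 -> (forall t, 0 < t -> t <= t0 -> q <= t * c) ->
  q <= 0.
Proof.
move=> t00 h; rewrite leNgt; apply/negP => q0.
have c0 : 0 < c.
  have := lt_le_trans q0 (h _ t00 (lexx _)); rewrite pmulr_rgt0//.
pose t := Num.min t0 (q / (2 * c)).
have t1 : 0 < t by rewrite lt_min t00 /= divr_gt0// mulr_gt0.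
have t2 : t <= t0 by rewrite ge_min lexx.
have t3 : t * c <= q / 2.
  rewrite -ler_pdivlMr// ge_min; apply/orP; right.
  by rewrite invfM mulrA.
have := h _ t1 t2; lra.
Qed.

(** Let [D = B + t H] with inverse partner [A']. The gap is 0 at [(A', D)] and nonnegative at
    [(A', B)], so [G B <= G D] forces [tr (A' H) <= 0]. Replacing [A'] by [A] costs [O(t)]. Only
    [sahs C] is assumed because the extremal [C] need not satisfy [I + C > 0]. *)
Lemma minimizer_variational (K : set (U -> U)) A B C :
  (forall t B C, 0 <= t <= 1 -> K B -> K C -> K (convex_comb t B C)) ->
  K B -> K C -> posop B -> sahs C ->
  (forall D, K D -> posop D -> negldet B <= negldet D) ->
  posop A -> cancel (idfun \+ B) (idfun \+ A) -> cancel (idfun \+ A) (idfun \+ B) ->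
  hsip A C <= hsip A B.
Proof.
move=> Kconv KB KC pB sC minB pA AB BA.
have [d d0 cB] := posop_coercive pB.
have sB := pB.1; have sA := pA.1.
pose H x := C x - B x.
have sH : sahs H by exact: sahsB.
pose h := Num.sqrt (hsn H).
have h0 : 0 <= h by rewrite sqrtr_ge0.
pose HP := fun x => H (x + A x).
have HPs : sqsum (onb (U := U)) HP.
  rewrite /sqsum (_ : HP = (fun x => H x + (H \o A) x)); last first.
    by apply/funext => x; rewrite /HP (saD _ _ sH.1).
  apply: sqsumD; first exact: sH.2.
  by have [+ _] := sqnorm_comp_bound h0 sA.2 (fun x => sahs_norm_bound x sH).
pose c := Num.sqrt ((2 / d) ^+ 2 * sqnorm (onb (U := U)) HP) * h.
rewrite -subr_le0 -hsipBr//.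
(* This range keeps [t |H| <= d / 2], so that [D] remains coercive with constant [d / 2]; the [+ 1]
   guards against [h = 0]. *)
apply: (@le0_small _ c (Num.min 1 (d / (2 * (h + 1))))).
  by rewrite lt_min ltr01 /= divr_gt0// mulr_gt0// ltr_wpDl.
move=> t t0; rewrite le_min => /andP[t1 tle].
have th : t * h <= d / 2.
  have : t * (2 * (h + 1)) <= d by rewrite -ler_pdivlMr// mulr_gt0// ltr_wpDl.
  have : 0 <= t by exact: ltW.
  nra.
pose D := convex_comb t B C.
have DE x : D x = B x + t *: H x.
  by rewrite /D /convex_comb /H scalerBl scale1r scalerBr -addrA [- _ + _]addrC.
have KD : K D by apply: Kconv => //; apply/andP; split => //; exact: ltW.
have sD : sahs D by exact: sahs_convex_comb.
have cD : coercive D (d / 2).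
  move=> x; rewrite DE addrA innerDl innerZl.
  have := cB x.
  have : `|inner (H x) x| <= h * `|x| ^+ 2.
    apply: le_trans (cauchy_schwarz _ _) _.
    by rewrite expr2 mulrA ler_wpM2r// sahs_norm_bound.
  have := ler_norm (- inner (H x) x); rewrite normrN => g1 g2 g3.
  have x0 : 0 <= `|x| ^+ 2 by rewrite sqr_ge0.
  have g4 : t * - inner (H x) x <= t * (h * `|x| ^+ 2).
    by rewrite ler_wpM2l ?(ltW t0)//; exact: le_trans g1 g2.
  have g5 : t * h * `|x| ^+ 2 <= d / 2 * `|x| ^+ 2 by rewrite ler_wpM2r.
  lra.
have d20 : 0 < d / 2 by rewrite divr_gt0.
have pD : posop D by exact: coercive_posop d20 sD cD.
have [A' [pA' AD' DA' nA']] := exists_inverse_pair d20 sD cD.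
have sA' := pA'.1.
have h1 := fenchel_cancel pA' pD AD'.
have h2 := fenchel_ge0 pA' pB.
have h3 := minB _ KD pD.
have hD : hsip A' D = hsip A' B + t * hsip A' H.
  rewrite -(hsipZr _ sA' sH) -(hsipDr sA' sB (sahsZ t sH)).
  by rewrite (_ : D = (fun x => B x + t *: H x))//; apply/funext.
have h4 : hsip A' H <= 0 by rewrite -(pmulr_rle0 _ t0); lra.
have sAA' : sahs (fun x => A x - A' x) by exact: sahsB.
(* The resolvent identity [(I + A) - (I + A') = t (I + A') H (I + A)]. Its factor [HP = H (I + A)]
   need not be self-adjoint, hence is measured as a square-summable family. *)
have AA'E x : A x - A' x = t *: ((fun y => y + A' y) \o HP) x.
  have /cancel_idD inv1 := AD'; have /cancel_idD inv2 := BA.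
  have e1 : D (x + A x) = B (x + A x) + t *: HP x by rewrite DE.
  have e2 : x + A x + D (x + A x) = x + t *: HP x by rewrite e1 addrA inv2.
  have := inv1 (x + A x); rewrite e2 (saD _ _ sA'.1) (saZ _ _ sA'.1) => e3.
  rewrite /= scalerDr; apply: (addrI (x + A' x)).
  by rewrite [RHS]addrACA e3 addrACA subrr addr0.
have nAA' : hsn (fun x => A x - A' x) <= t ^+ 2 * ((2 / d) ^+ 2 * sqnorm (onb (U := U)) HP).
  have d2 : 0 <= 2 / d by rewrite divr_ge0// ltW.
  have nA2 x : `|x + A' x| <= 2 / d * `|x| by have := nA' x; rewrite invf_div.
  have [s1 s2] := sqnorm_comp_bound (S := fun y => y + A' y) d2 HPs nA2.
  rewrite (_ : (fun x => A x - A' x) = (fun x => t *: ((fun y => y + A' y) \o HP) x)); last exact/funext.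
  by rewrite hsn.unlock sqnormZ// ler_wpM2l ?sqr_ge0.
have h5 : hsip A H = hsip A' H + hsip (fun x => A x - A' x) H.
  by rewrite ![hsip _ H]hsipC hsipBr// addrC subrK.
have h6 : hsip (fun x => A x - A' x) H <= t * c.
  apply: le_trans (hsip_le sAA' sH) _.
  rewrite /c mulrA ler_wpM2r ?sqrtr_ge0//.
  apply: le_trans (ler_wsqrtr nAA') _.
  by rewrite sqrtrM ?sqr_ge0// sqrtr_sqr gtr0_norm.
rewrite h5; lra.
Qed.

End optimality.

(** * Operator matrices *)

Arguments entry {R p H} A i j _.

Section blocks.
Variables (R : realType) (p : nat) (H : 'I_p -> hilbertType R).
Implicit Types (A B C : hprod H -> hprod H) (f g : hprod H).

Definition hinj j (x : H j) : hprod H := @dfwith _ H (fun=> 0) j x.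

Lemma hinj_same j (x : H j) : hinj x j = x.
Proof. exact: dfwithin. Qed.

Lemma hinj_neq i j (x : H j) : i != j -> hinj x i = 0.
Proof. by move=> ij; rewrite /hinj dfwithout// eq_sym. Qed.

Lemma hprod_innerE f g : inner f g = \sum_j inner (f j) (g j).
Proof. by []. Qed.

Lemma inner_hinj f j (x : H j) : inner f (hinj x) = inner (f j) x.
Proof.
rewrite hprod_innerE (bigD1 j)//= hinj_same big1 ?addr0// => i ij.
by rewrite hinj_neq// inner0r.
Qed.

Lemma hinj0 j : hinj (0 : H j) = 0.
Proof.
apply: functional_extensionality_dep => i; have [->|ij] := eqVneq i j.
  by rewrite hinj_same.
by rewrite hinj_neq.
Qed.

Lemma entry_adjoint A i j (x : H j) (y : H i) : selfadjoint A ->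
  inner (entry A i j x) y = inner x (entry A j i y).
Proof.
move=> sA; rewrite /entry -/(hinj x) -/(hinj y) -inner_hinj sA.
by rewrite innerC inner_hinj innerC.
Qed.

Lemma entry0 A i j : selfadjoint A -> entry A i j 0 = 0.
Proof. by move=> sA; rewrite /entry -/(hinj 0) hinj0 (sa0 sA). Qed.

Lemma entry_cvg (I : Type) (F : set_system I) {FF : Filter F}
    (A_ : I -> hprod H -> hprod H) A i j (x : H j) :
  (forall f, (fun t => A_ t f) @ F --> A f) ->
  (fun t => entry (A_ t) i j x) @ F --> entry A i j x.
Proof.
move=> cA; apply/cvgrPdist_lt => e e0.
have /cvgrPdist_lt/(_ _ e0) := cA (hinj x); apply: filterS => t.
exact: le_lt_trans (ler_hprod_proj (A (hinj x) - A_ t (hinj x)) i).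
Qed.

Definition nentry A i j : R := sqnorm (@onb R (H j)) (entry A i j).

(** The chosen basis of the product is not adapted to the blocks. Each block of [A e] is expanded in
    the basis of its factor, the sums are exchanged, and symmetry lets the sum over [e] be
    contracted to [|A (hinj f)|^2]. *)
Lemma esum_sqnorm_blocks A : selfadjoint A ->
  \esum_(e in @onb R (hprod H)) (`|A e| ^+ 2)%:E =
  (\sum_j \sum_i \esum_(f in @onb R (H j)) (`|entry A i j f| ^+ 2)%:E)%E.
Proof.
move=> sA.
transitivity (\esum_(e in @onb R (hprod H)) \sum_j
    \esum_(f in @onb R (H j)) (inner (A e) (hinj f) ^+ 2)%:E)%E.
  apply: eq_esum => e _; rewrite hprod_normE -sumEFin; apply: eq_bigr => j _.
  rewrite -(parseval _ (@onbP R (H j))); apply: eq_esum => f _.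
  by rewrite inner_hinj.
rewrite esum_sum; last first.
  by move=> e j _ _; apply: esum_ge0 => f _; rewrite lee_fin sqr_ge0.
apply: eq_bigr => j _.
rewrite exchange_esum; last by move=> e f _ _; rewrite lee_fin sqr_ge0.
rewrite -esum_sum; last by move=> f i _ _; rewrite lee_fin sqr_ge0.
apply: eq_esum => f _.
transitivity (`|A (hinj f)| ^+ 2)%:E.
  rewrite -(parseval _ (@onbP R (hprod H))); apply: eq_esum => e _.
  by rewrite sA innerC.
by rewrite hprod_normE -sumEFin.
Qed.

Lemma sahs_entry_sqsum A i j : sahs A -> sqsum (@onb R (H j)) (entry A i j).
Proof.
move=> sA; apply: (@le_lt_trans _ _ (hsn A)%:E); last exact: ltry.
rewrite hsn.unlock -esum_sqnorm; last exact: sA.2.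
rewrite esum_sqnorm_blocks; last exact: sA.1.
have pos k l : (0 <= \esum_(f in @onb R (H l)) (`|entry A k l f| ^+ 2)%:E)%E.
  by apply: esum_ge0 => f _; rewrite lee_fin sqr_ge0.
rewrite (bigD1 j)//= (bigD1 i)//= -addeA leeDl// adde_ge0//.
  exact: sume_ge0.
by apply: sume_ge0 => l _; exact: sume_ge0.
Qed.

Lemma entries_sahs A : selfadjoint A ->
  (forall i j, sqsum (@onb R (H j)) (entry A i j)) -> sahs A.
Proof.
move=> sA As; split=> //; rewrite /sqsum /finsum esum_sqnorm_blocks//.
rewrite lt_neqAle leey andbT; apply/eqP.
under eq_bigr => j _ do under eq_bigr => i _ do rewrite esum_sqnorm//.
by under eq_bigr => j _ do rewrite sumEFin; rewrite sumEFin.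
Qed.

Lemma hsn_blocks A : sahs A -> hsn A = \sum_j \sum_i nentry A i j.
Proof.
move=> sA; apply/EFin_inj.
rewrite {1}hsn.unlock -esum_sqnorm; last exact: sA.2.
rewrite esum_sqnorm_blocks; last exact: sA.1.
rewrite -sumEFin; apply: eq_bigr => j _; rewrite -sumEFin; apply: eq_bigr => i _.
by rewrite esum_sqnorm//; exact: sahs_entry_sqsum.
Qed.

Lemma hsip_blocks A B : sahs A -> sahs B ->
  hsip A B = \sum_j \sum_i fip (@onb R (H j)) (entry A i j) (entry B i j).
Proof.
move=> sA sB; rewrite hsipE// !hsn_blocks//; last exact: sahsD.
rewrite -!sumrB mulr_suml; apply: eq_bigr => j _.
rewrite -!sumrB mulr_suml; apply: eq_bigr => i _.
by rewrite fip_polar//; exact: sahs_entry_sqsum.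
Qed.

Lemma nentry_sym A i j : selfadjoint A -> nentry A i j = nentry A j i.
Proof.
move=> sA; congr fine; apply: esum_sqnorm_adjoint; try exact: onbP.
by move=> x y; exact: entry_adjoint.
Qed.

Lemma dg_eq0 A : dg A = (fun=> 0) <-> forall i x, entry A i i x = 0.
Proof.
split=> [A0 i x|A0].
  have := congr1 (fun D => D (hinj x) i) A0; rewrite /dg hinj_same => ->.
  by [].
by apply/funext => f; apply: functional_extensionality_dep => i; exact: A0.
Qed.

Lemma offdg_id A : dg A = (fun=> 0) -> offdg A = A.
Proof. by move=> A0; apply/funext => f; rewrite /offdg /= A0 subr0. Qed.

Lemma entry_offdg A i j : selfadjoint A ->
  entry (offdg A) i j = if i == j then (fun=> 0) else entry A i j.
Proof.
move=> sA; apply/funext => x.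
rewrite {1}/entry -/(hinj x).
have -> : offdg A (hinj x) i = entry A i j x - entry A i i (hinj x i) by [].
have [ij|ij] := eqVneq i j; last by rewrite hinj_neq// entry0// subr0.
by subst j; rewrite hinj_same subrr.
Qed.

Definition of_entries (C : forall i j, H j -> H i) : hprod H -> hprod H :=
  fun f i => \sum_j C i j (f j).

Lemma entry_of_entries (C : forall i j, H j -> H i) i j :
  (forall i j, C i j 0 = 0) -> entry (of_entries C) i j = C i j.
Proof.
move=> C0; apply/funext => x; rewrite /entry -/(hinj x) /of_entries.
rewrite (bigD1 j)//= hinj_same big1 ?addr0// => k kj.
by rewrite hinj_neq.
Qed.

Lemma of_entries_selfadjoint (C : forall i j, H j -> H i) :
  (forall i j x y, inner (C i j x) y = inner x (C j i y)) ->
  selfadjoint (of_entries C).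
Proof.
move=> CC f g; rewrite !hprod_innerE /of_entries.
under eq_bigr do rewrite inner_suml.
rewrite exchange_big/=; apply: eq_bigr => j _.
by rewrite inner_sumr; apply: eq_bigr => i _.
Qed.

End blocks.

(** * Duality *)

Section duality.
Variables (R : realType) (p : nat) (H : 'I_p -> hilbertType R).
Implicit Types (A B C : hprod H -> hprod H).
Variables (lam : R) (R0 : hprod H -> hprod H).
Hypotheses (lam_gt0 : 0 < lam) (pR0 : posop R0) (dgR0 : dg R0 = (fun=> 0)).

Let sR0 : sahs R0 := pR0.1.

Let onbH j := @onb R (H j).
Arguments onbH : clear implicits.

Definition ndiff B i j : R := sqnorm (onbH j) (fun x => entry B i j x - entry R0 i j x).

(** The feasible set without the condition [I + B > 0], which would not be preserved by pointwise
    limits. *)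
Definition Kset : set (hprod H -> hprod H) :=
  [set B | [/\ sahs B, dg B = (fun=> 0) & forall i j, ndiff B i j <= lam ^+ 2]].

Lemma posopP A : posop A <-> glasso_dom A.
Proof.
split=> [[sA pA]|[hA pA]]; first by split => //; exact: ((sahsP A).1 sA).1.
by split => //; apply/sahsP; split => //; exact: pA.1.
Qed.

Lemma norm21_offdg A : selfadjoint A ->
  norm21 (offdg A) = \sum_j \sum_(i | i != j) Num.sqrt (nentry A i j).
Proof.
move=> sA; rewrite /norm21 exchange_big/=; apply: eq_bigr => j _.
rewrite [RHS]big_mkcond/=; apply: eq_bigr => i _.
rewrite entry_offdg//; case: eqVneq => [->|ij] //=.
rewrite /hs_norm /hs_norm_sqr esum1 ?sqrtr0// => e _.
by rewrite normr0 expr0n.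
Qed.

Lemma norm2oo_le (T : hprod H -> hprod H) : norm2oo T <= lam <->
  forall i j, hs_norm (entry T i j) <= lam.
Proof.
split=> [Tl i j|Tl].
  apply: le_trans Tl; apply: le_trans (le_bigmax _ _ i).
  exact: (le_bigmax _ (fun j => hs_norm (entry T i j))).
apply: bigmax_le => [|i _]; first exact: ltW.
by apply: bigmax_le => [|j _]; [exact: ltW|exact: Tl].
Qed.

Lemma sqrt_le_lam (x : R) : 0 <= x -> (Num.sqrt x <= lam) = (x <= lam ^+ 2).
Proof.
move=> x0; rewrite -[lam in LHS]gtr0_norm// -sqrtr_sqr ler_sqrt// sqr_ge0//.
Qed.

Lemma KLdiv_domP B : KLdiv_dom lam R0 B <-> Kset B /\ posop B.
Proof.
have key T i j : dg T = (fun=> 0) -> hs_norm (entry (offdg T \- R0) i j) = Num.sqrt (ndiff T i j).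
  by move=> T0; rewrite offdg_id.
split=> [[hB pB B0 /norm2oo_le Bl]|[[sB B0 Bl] pB]].
  have sB : sahs B by apply/sahsP; split => //; exact: pB.1.
  split; last by split.
  by split => // i j; rewrite -sqrt_le_lam ?sqnorm_ge0// -key.
split => //; [exact: ((sahsP B).1 sB).1|exact: pB.2|].
by apply/norm2oo_le => i j; rewrite key// sqrt_le_lam ?sqnorm_ge0.
Qed.

Lemma Kset_R0 : Kset R0.
Proof.
split => // i j; rewrite /ndiff /sqnorm /nnsum esum1 ?sqr_ge0//= => e _.
by rewrite subrr normr0 expr0n.
Qed.

Lemma glassoE A : selfadjoint A ->
  glasso lam R0 A = hsip A R0 + negldet A + lam * norm21 (offdg A).
Proof. by move=> sA; rewrite /glasso trace_comp// negldet.unlock. Qed.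

Lemma fip_dg0 A B j : dg B = (fun=> 0) ->
  fip (onbH j) (entry A j j) (entry B j j) = 0.
Proof.
move=> /dg_eq0 B0; rewrite /fip (eq_rsum (g := fun=> 0)).
  rewrite /rsum !esum1 ?subrr//= => e _;
    by rewrite ?funeposE ?funenegE /= ?oppr0 ?oppe0 maxxx.
by move=> e _; rewrite B0 inner0r.
Qed.

(** Diagonal blocks contribute 0 on both sides; off the diagonal, Cauchy-Schwarz bounds
    [<B_ij - R0_ij, A_ij>] by [lam |A_ij|]. *)
Lemma Kset_weak A B : sahs A -> Kset B ->
  hsip A B <= hsip A R0 + lam * norm21 (offdg A).
Proof.
move=> sA [sB B0 Bl]; have sa := sA.1.
rewrite norm21_offdg// !hsip_blocks// mulr_sumr -big_split/=.
apply: ler_sum => j _; rewrite mulr_sumr (bigD1 j)//= [in leRHS](bigD1 j)//=.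
rewrite !fip_dg0// !add0r -big_split/=; apply: ler_sum => i ij.
have sAe := sahs_entry_sqsum i j sA; have sBe := sahs_entry_sqsum i j sB.
have sRe := sahs_entry_sqsum i j sR0.
rewrite -lerBlDl [fip _ _ (entry B i j)]fipC [fip _ _ (entry R0 i j)]fipC -fipBl//.
apply: le_trans (fip_le (sqsumB sBe sRe) sAe) _.
by rewrite ler_wpM2r ?sqrtr_ge0// sqrt_le_lam ?sqnorm_ge0//; exact: Bl.
Qed.

(** Equality in Cauchy-Schwarz in every block: [C_ij = R0_ij + lam A_ij / |A_ij|] off the diagonal.
    The symmetry of the block norms makes [C] self-adjoint. *)
Lemma Kset_strong A : sahs A -> exists2 C, Kset C &
  hsip A C = hsip A R0 + lam * norm21 (offdg A).
Proof.
move=> sA; have sa := sA.1; have saR := sR0.1.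
(* [r i j = 0] when [A_ij = 0], by the convention [lam / 0 = 0]; the extremal
   [C_ij] is then [R0_ij]. *)
pose r i j := lam / Num.sqrt (nentry A i j).
pose c i j : H j -> H i := fun x => if i == j then 0 else
  entry R0 i j x + r i j *: entry A i j x.
have c0 i j : c i j 0 = 0.
  by rewrite /c; case: eqP => // _; rewrite !entry0// scaler0 addr0.
have cadj i j x y : inner (c i j x) y = inner x (c j i y).
  rewrite /c eq_sym; case: eqP => [_|_]; first by rewrite inner0l inner0r.
  rewrite innerDl innerDr innerZl innerZr !entry_adjoint// /r.
  by rewrite (nentry_sym i j sa).
pose C := of_entries c.
have CE i j : entry C i j = c i j by exact: entry_of_entries.
have cs i j : sqsum (onbH j) (c i j).
  rewrite /c; case: eqP => ij.
    by rewrite /sqsum /finsum esum1 ?ltry//= => e _; rewrite normr0 expr0n.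
  by apply: sqsumD; [|apply: sqsumZ]; exact: sahs_entry_sqsum.
have sC : sahs C.
  apply: entries_sahs; first exact: of_entries_selfadjoint.
  by move=> i j; rewrite CE; exact: cs.
have dC : dg C = (fun=> 0) by apply/dg_eq0 => i x; rewrite CE /c eqxx.
exists C.
  split => // i j; rewrite /ndiff CE /c; have [ij|ij] := eqVneq i j.
    subst j; rewrite /sqnorm /nnsum esum1 ?sqr_ge0//= => e _.
    by rewrite ((dg_eq0 R0).1 dgR0) subr0 normr0 expr0n.
  have -> : (fun x : H j => entry R0 i j x + r i j *: entry A i j x - entry R0 i j x) =
      (fun x => r i j *: entry A i j x) by apply/funext => x; rewrite addrC addKr.
  rewrite sqnormZ; last exact: sahs_entry_sqsum.
  rewrite -/(nentry A i j) /r exprMn exprVn sqr_sqrtr ?sqnorm_ge0// -mulrA ler_piMr ?sqr_ge0//.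
  have [->|n0] := eqVneq (nentry A i j) 0; first by rewrite mulr0.
  by rewrite mulVf.
rewrite norm21_offdg// !hsip_blocks// mulr_sumr -big_split/=.
apply: eq_bigr => j _; rewrite mulr_sumr (bigD1 j)//= [in RHS](bigD1 j)//=.
rewrite !fip_dg0// !add0r -big_split/=; apply: eq_bigr => i ij.
have sAe := sahs_entry_sqsum i j sA; have sRe := sahs_entry_sqsum i j sR0.
rewrite CE /c (negbTE ij) fipC fipDl//; last exact: sqsumZ.
rewrite fipZl// fip_sqnorm// fipC; congr (_ + _).
rewrite -/(nentry A i j) /r -mulrA; congr (_ * _).
have [->|n0] := eqVneq (nentry A i j) 0; first by rewrite mulr0 sqrtr0.
have np : 0 < nentry A i j by rewrite lt_def n0 sqnorm_ge0.
rewrite -{2}(@sqr_sqrtr _ (nentry A i j)) ?sqnorm_ge0//.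
by rewrite expr2 mulrA mulVf ?mul1r// gt_eqF// sqrtr_gt0.
Qed.

End duality.

(** * The feasible set as a closed convex bounded set, and strong duality *)

Section duality_theorem.
Variables (R : realType) (p : nat) (H : 'I_p -> hilbertType R).
Implicit Types (A B C : hprod H -> hprod H).
Variables (lam : R) (R0 : hprod H -> hprod H).
Hypotheses (lam_gt0 : 0 < lam) (pR0 : posop R0) (dgR0 : dg R0 = (fun=> 0)).

Let K := Kset lam R0.

Lemma Kset_sahs B : K B -> sahs B. Proof. by case. Qed.

Lemma Kset_convex t B C : 0 <= t <= 1 -> K B -> K C -> K (convex_comb t B C).
Proof.
move=> /andP[t0 t1] [sB B0 Bl] [sC C0 Cl]; split; first exact: sahs_convex_comb.
  apply/dg_eq0 => i x.
  have -> : entry (convex_comb t B C) i i x =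
    (1 - t) *: entry B i i x + t *: entry C i i x by [].
  by rewrite ((dg_eq0 B).1 B0) ((dg_eq0 C).1 C0) !scaler0 addr0.
move=> i j.
have sBe := sqsumB (sahs_entry_sqsum i j sB) (sahs_entry_sqsum i j pR0.1).
have sCe := sqsumB (sahs_entry_sqsum i j sC) (sahs_entry_sqsum i j pR0.1).
have hB := Bl i j; have hC := Cl i j; rewrite /ndiff in hB hC *.
pose u x := entry B i j x - entry R0 i j x; pose v x := entry C i j x - entry R0 i j x.
rewrite (_ : (fun x : H j => _) = (fun x => (1 - t) *: u x + t *: v x)); last first.
  apply/funext => x; rewrite /u /v !scalerBr addrACA -opprD -scalerDl subrK scale1r.
  by [].
rewrite sqnormD; [|exact: sqsumZ|exact: sqsumZ].
rewrite !sqnormZ// fipZl//; last exact: sqsumZ.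
rewrite fipC fipZl//.
(* Convexity comes from [|(1 - t) u + t v|^2 = (1 - t) |u|^2 + t |v|^2 - t (1 - t) |v - u|^2]. *)
have := sqnorm_ge0 (@onb R (H j)) (fun x => v x - u x).
rewrite sqnormB// => h.
have hu : sqnorm (@onb R (H j)) u <= lam ^+ 2 by [].
have hv : sqnorm (@onb R (H j)) v <= lam ^+ 2 by [].
move: (sqnorm _ u) (sqnorm _ v) (fip _ v u) hu hv h => a b c hu hv h.
have : 0 <= t * (1 - t) * (b - 2 * c + a) by rewrite mulr_ge0// mulr_ge0// subr_ge0.
have : 0 <= t * (lam ^+ 2 - b) by rewrite mulr_ge0// subr_ge0.
have : 0 <= (1 - t) * (lam ^+ 2 - a) by rewrite mulr_ge0// subr_ge0.
by move: (lam ^+ 2) => l; nra.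
Qed.

Lemma Kset_bounded B : K B ->
  hsn B <= \sum_(j < p) \sum_(i < p) (2 * lam ^+ 2 + 2 * nentry R0 i j).
Proof.
move=> [sB B0 Bl]; rewrite hsn_blocks//; apply: ler_sum => j _; apply: ler_sum => i _.
have sBe := sahs_entry_sqsum i j sB; have sRe := sahs_entry_sqsum i j pR0.1.
have := Bl i j; rewrite /ndiff sqnormB// -/(nentry _ i j) -/(nentry _ i j) => h.
(* Four times this square is [2 |B_ij - R0_ij|^2 + 2 |R0_ij|^2 - |B_ij|^2]. *)
have := sqnorm_ge0 (@onb R (H j)) (fun x => 2^-1 *: entry B i j x - entry R0 i j x).
rewrite sqnormB//; last exact: sqsumZ.
rewrite sqnormZ// fipZl// -/(nentry _ i j) -/(nentry _ i j).
move: (nentry B i j) (nentry R0 i j) (fip _ _ _) h => a b c h.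
by move: (lam ^+ 2) h => l; lra.
Qed.

Lemma Kset_closed (B_ : nat -> hprod H -> hprod H) B : (forall n, K (B_ n)) ->
  (forall x, (fun n => B_ n x) @ \oo --> B x) -> K B.
Proof.
move=> KB cB.
have cE i j (x : H j) : (fun n => entry (B_ n) i j x) @ \oo --> entry B i j x.
  exact: entry_cvg.
split.
- split.
    move=> x y.
    have c1 : (fun n => inner (B_ n x) y) @ \oo --> inner (B x) y by exact: cvg_inner_l.
    have c2 : (fun n => inner (B_ n y) x) @ \oo --> inner (B y) x by exact: cvg_inner_l.
    rewrite [RHS]innerC -(cvg_lim _ c1)// -(cvg_lim _ c2)//; congr (limn _).
    by apply/funext => n; have [[sB _] _ _] := KB n; rewrite sB innerC.
  set M := \sum_(j < p) \sum_(i < p) (2 * lam ^+ 2 + 2 * nentry R0 i j).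
  have : (\esum_(x in @onb R (hprod H)) (`|B x| ^+ 2)%:E <= M%:E)%E.
    apply: (@esum_sqnorm_lim _ _ _ _ nat \oo _ B_) => //.
    apply: nearW => n; rewrite (esum_sahs (onbP _))//; last exact: Kset_sahs.
    by rewrite lee_fin; exact: Kset_bounded.
  by move=> /esum_sqnorm_le[].
- apply/dg_eq0 => i x; rewrite -(cvg_lim _ (cE i i x))//.
  rewrite (_ : (fun n => _) = cst 0) ?lim_cst//.
  by apply/funext => n; have [_ B0 _] := KB n; rewrite ((dg_eq0 _).1 B0).
- move=> i j; rewrite /ndiff.
  have : (\esum_(x in @onb R (H j)) (`|entry B i j x - entry R0 i j x| ^+ 2)%:E <=
      (lam ^+ 2)%:E)%E.
    apply: (@esum_sqnorm_lim _ _ _ _ nat \oo _ (fun n x => entry (B_ n) i j x - entry R0 i j x)).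
      by move=> x _; apply: cvgB; [exact: cE|exact: cvg_cst].
    apply: nearW => n; have [sB _ Bl] := KB n.
    rewrite esum_sqnorm; first by rewrite lee_fin; exact: Bl.
    by apply: sqsumB; apply: sahs_entry_sqsum => //; exact: pR0.1.
  by move=> /esum_sqnorm_le[].
Qed.

Lemma glasso_ge A B : posop A -> K B -> posop B ->
  - negldet B <= glasso lam R0 A /\
  (glasso lam R0 A = - negldet B -> negldet A + negldet B + hsip A B = 0).
Proof.
move=> pA KB pB; have sA := pA.1; rewrite glassoE; last exact: sA.1.
have := Kset_weak lam_gt0 pR0 dgR0 sA KB.
have := fenchel_ge0 pA pB.
by move=> h1 h2; split; [|move=> h3]; lra.
Qed.

Lemma exists_saddle : exists A B, [/\ posop A, K B, posop B,
  (forall C, K C -> posop C -> negldet B <= negldet C) &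
  glasso lam R0 A = - negldet B].
Proof.
have [|B [KB pB minB]] := exists_constrained_minimizer Kset_sahs Kset_convex Kset_bounded Kset_closed.
  by exists R0 => //; exact: Kset_R0.
have [d d0 cB] := posop_coercive pB.
have [A [pA AB BA _]] := exists_inverse_pair d0 pB.1 cB.
exists A, B; split => //.
have sA := pA.1.
have [C KC hC] := Kset_strong lam pR0 dgR0 sA.
have h1 := minimizer_variational Kset_convex KB KC pB (Kset_sahs KC) minB pA AB BA.
have h2 := Kset_weak lam_gt0 pR0 dgR0 sA KB.
have h3 := fenchel_cancel pA pB AB.
rewrite glassoE; last exact: sA.1.
lra.
Qed.

Lemma inf_minimizer (T : Type) (S : set T) (f : T -> R) x : minimizer S f x ->
  inf (f @` S) = f x.
Proof.
move=> [Sx fx]; apply/eqP; rewrite eq_le; apply/andP; split.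
  by apply: ge_inf; [exists (f x) => _ [y Sy <-]; exact: fx|exists x].
by apply: lb_le_inf; [exists (f x), x|move=> _ [y Sy <-]; exact: fx].
Qed.

Lemma KLdiv_offdg B : K B -> KLdiv (offdg B) = 2^-1 * negldet B.
Proof. by move=> [_ B0 _]; rewrite offdg_id// /KLdiv negldet.unlock mulNr mulrN. Qed.

(** The constructed saddle pair fixes both optimal values, so arbitrary minimisers also attain
    equality in weak duality. Their gap then vanishes, and its symmetry in the two operators yields
    both cancellations. *)
Lemma glasso_duality :
  [/\ exists A, minimizer (@glasso_dom _ _ H) (glasso lam R0) A,
      exists B, minimizer (KLdiv_dom lam R0) (fun B => KLdiv (offdg B)) B,
      inf (glasso lam R0 @` @glasso_dom _ _ H) =
        - 2 * inf ((fun B => KLdiv (offdg B)) @` KLdiv_dom lam R0) &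
      forall A B, minimizer (@glasso_dom _ _ H) (glasso lam R0) A ->
        minimizer (KLdiv_dom lam R0) (fun B => KLdiv (offdg B)) B ->
        cancel (idfun \+ offdg B) (idfun \+ A) /\
        cancel (idfun \+ A) (idfun \+ offdg B)].
Proof.
have [A [B [pA KB pB minB AB]]] := exists_saddle.
have mA : minimizer (@glasso_dom _ _ H) (glasso lam R0) A.
  split; first exact/posopP.
  move=> A' /posopP pA'; rewrite AB.
  by have [] := glasso_ge pA' KB pB.
have mB : minimizer (KLdiv_dom lam R0) (fun B => KLdiv (offdg B)) B.
  split; first exact/KLdiv_domP.
  move=> C /KLdiv_domP[//|KC pC]; rewrite !KLdiv_offdg//.
  by rewrite ler_wpM2l ?invr_ge0//; exact: minB.
split; [by exists A|by exists B| |].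
  rewrite (inf_minimizer mA) (inf_minimizer mB) AB KLdiv_offdg//; lra.
move=> A' B' mA' mB'.
have pA' : posop A' by apply/posopP; exact: mA'.1.
have /KLdiv_domP[//|KB' pB'] := mB'.1.
have e1 : glasso lam R0 A' = - negldet B'.
  rewrite -(inf_minimizer mA') (inf_minimizer mA) AB; congr (- _).
  have : KLdiv (offdg B') = KLdiv (offdg B).
    by rewrite -(inf_minimizer mB') (inf_minimizer mB).
  rewrite !KLdiv_offdg// => h; lra.
have [_ /(_ e1) e2] := glasso_ge pA' KB' pB'.
have [_ B'0 _] := KB'; rewrite offdg_id//.
split; first exact: fenchel_eq0.
apply: fenchel_eq0 => //.
by rewrite hsipC [negldet B' + _]addrC.
Qed.

End duality_theorem.

(** * The correlation operator *)

Section nonneg_square_roots.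
Variables (R : realType) (U : hilbertType R).
Implicit Types (S T : U -> U).

(** Cauchy-Schwarz for the semi-inner product [<S x, y>], at [x] and [S x], gives
    [|S x|^4 <= <S x, x> <S S x, S x>], whose last factor is at most [M |S x|^2]. *)
Lemma nonneg_op_sqr_bound S (M : R) x : 0 <= M -> nonneg_op S ->
  (forall x, `|S x| <= M * `|x|) -> `|S x| ^+ 2 <= M * inner (S x) x.
Proof.
move=> M0 [sS S0] SM.
have h : inner (S x) (S x) ^+ 2 <= inner (S x) x * inner (S (S x)) (S x).
  apply: quadratic_discr => // t; have := S0 (x + t *: S x).
  rewrite (saD _ _ sS) (saZ _ _ sS) !innerDl !innerDr !innerZl !innerZr (sS (S x) x).
  move=> h0; apply: le_trans h0 _.
  by rewrite le_eqVlt; apply/orP; left; apply/eqP; ring.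
have h2 : inner (S (S x)) (S x) <= M * `|S x| ^+ 2.
  apply: le_trans (ler_norm _) _; apply: le_trans (cauchy_schwarz _ _) _.
  by rewrite expr2 mulrA ler_wpM2r.
rewrite inner_norm in h.
have [n0|n0] := eqVneq (`|S x| ^+ 2) 0.
  by rewrite n0 mulr_ge0.
have np : 0 < `|S x| ^+ 2 by rewrite lt_def n0 sqr_ge0.
have h3 : inner (S x) x * inner (S (S x)) (S x) <= inner (S x) x * (M * `|S x| ^+ 2).
  by rewrite ler_wpM2l.
have := le_trans h h3.
by rewrite expr2 mulrA ler_pM2r// mulrC.
Qed.

(* [X = S - T] satisfies [S X = - X T] and [T X = - X S], so an approximate top
   eigenvector of [X ^ 2] is nearly annihilated by [S] and by [T]. *)
Lemma nonneg_sqrt_unique S T (M : R) : 0 <= M -> nonneg_op S -> nonneg_op T ->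
  (forall x, `|S x| <= M * `|x|) -> (forall x, `|T x| <= M * `|x|) ->
  (forall x, S (S x) = T (T x)) -> forall x, S x = T x.
Proof.
move=> M0 nS nT SM TM ST.
have [sS S0] := nS; have [sT T0] := nT.
pose X x := S x - T x.
have sX : selfadjoint X by exact: saBop.
have SX x : S (X x) = - X (T x).
  by rewrite /X (saB _ _ sS) ST opprB.
have TX x : T (X x) = - X (S x).
  by rewrite /X (saB _ _ sT) ST opprB.
have XM x : `|X x| <= 2 * M * `|x|.
  apply: le_trans (ler_normB _ _) _; have := SM x; have := TM x; lra.
move=> x; apply/eqP; rewrite -subr_eq0; apply/eqP.
change (X x = 0); apply: contrapT => /eqP Xx0.
pose Q := [set `|X y| ^+ 2 | y in [set y : U | `|y| <= 1]].
have supQ : has_sup Q.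
  split; first by exists (`|X 0| ^+ 2), 0 => //=; rewrite normr0.
  exists ((2 * M) ^+ 2) => _ [y /= y1 <-].
  rewrite ler_pXn2r ?nnegrE ?mulr_ge0//.
  by apply: le_trans (XM y) _; rewrite ler_piMr// mulr_ge0.
pose m2 := sup Q.
have Sub y : `|X y| ^+ 2 <= m2 * `|y| ^+ 2.
  have [->|y0] := eqVneq y 0; first by rewrite (sa0 sX) !normr0 expr0n mulr0.
  have ny : 0 < `|y| by rewrite normr_gt0.
  have : `|X (`|y|^-1 *: y)| ^+ 2 <= m2.
    apply: ub_le_sup; first exact: supQ.2.
    by exists (`|y|^-1 *: y) => //=; rewrite normrZ normfV normr_id mulVf// gt_eqF.
  rewrite (saZ _ _ sX) normrZ normfV normr_id exprMn exprVn mulrC ler_pdivrMr//.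
  by rewrite exprn_gt0.
have m2_gt0 : 0 < m2.
  have := Sub x; have : 0 < `|X x| ^+ 2 by rewrite exprn_gt0// normr_gt0.
  move=> h2 h3; rewrite ltNge; apply/negP => m0.
  by have := lt_le_trans h2 h3; rewrite ltNge mulr_le0_ge0// sqr_ge0.
suff : m2 ^+ 3 <= 0 by rewrite leNgt exprn_gt0.
(* For [e <= m2 / 2] a near-maximiser has [|X y|^2 >= m2 / 2], whence [m2^2 / 2 <= 4 M^2 |r|].
   Squaring, with [|r|^2 <= m2 e], gives [m2^3 <= 64 M^4 e]. *)
apply: (@le0_small _ _ (64 * M ^+ 4) (m2 / 2)); first by rewrite divr_gt0.
move=> e e0 em.
have [_ [y /= y1 <-] hy] := sup_adherent e0 supQ.
rewrite -/m2 in hy.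
pose r := X (X y) - m2 *: y.
have hr : `|r| ^+ 2 <= m2 * e.
  rewrite /r normB_sqr innerZr sX inner_norm normrZ exprMn (gtr0_norm m2_gt0).
  have h1 := Sub (X y).
  have h2 : `|y| ^+ 2 <= 1 by rewrite expr_le1.
  have h3 : m2 ^+ 2 * `|y| ^+ 2 <= m2 ^+ 2 by rewrite ler_piMr ?sqr_ge0.
  have h4 : m2 * (m2 - `|X y| ^+ 2) <= m2 * e by rewrite ler_pM2l// lerBlDl -lerBlDr ltW.
  by move: h4; lra.
(* By [A X = - X B] and symmetry of [X], [0 <= <A X y, X y> = - m2 <B y, y> - <B y, r>]: the form of
   [B] at [y] is controlled by the residual [r]. *)
have key (A B : U -> U) : selfadjoint A -> selfadjoint B ->
    (forall z, `|B z| <= M * `|z|) -> 0 <= inner (A (X y)) (X y) ->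
    A (X y) = - X (B y) -> m2 * inner (B y) y <= M * `|r|.
  move=> sA sB BM A0 AX.
  have XX : X (X y) = m2 *: y + r by rewrite /r addrC subrK.
  move: A0; rewrite AX innerNl sX XX innerDr innerZr => h.
  have : - inner (B y) r <= M * `|r|.
    rewrite -innerNl; apply: le_trans (ler_norm _) _; apply: le_trans (cauchy_schwarz _ _) _.
    rewrite ler_wpM2r// normrN; apply: le_trans (BM y) _.
    by rewrite ler_piMr.
  lra.
have k1 := key S T sS sT TM (S0 _) (SX y).
have k2 := key T S sT sS SM (T0 _) (TX y).
have b1 := nonneg_op_sqr_bound y M0 nS SM.
have b2 := nonneg_op_sqr_bound y M0 nT TM.
have xb : `|X y| ^+ 2 <= 2 * `|S y| ^+ 2 + 2 * `|T y| ^+ 2.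
  rewrite /X normB_sqr; have := sqr_ge0 `|S y + T y|; rewrite normD_sqr; lra.
have f1 : m2 * `|X y| ^+ 2 <= 4 * M ^+ 2 * `|r|.
  have g1 : m2 * `|S y| ^+ 2 <= M * (M * `|r|).
    apply: le_trans (_ : m2 * (M * inner (S y) y) <= _); first by rewrite ler_pM2l.
    by rewrite mulrCA ler_wpM2l.
  have g2 : m2 * `|T y| ^+ 2 <= M * (M * `|r|).
    apply: le_trans (_ : m2 * (M * inner (T y) y) <= _); first by rewrite ler_pM2l.
    by rewrite mulrCA ler_wpM2l.
  have g3 : m2 * `|X y| ^+ 2 <= m2 * (2 * `|S y| ^+ 2 + 2 * `|T y| ^+ 2) by rewrite ler_pM2l.
  rewrite expr2; lra.
have f2 : m2 * (m2 / 2) <= 4 * M ^+ 2 * `|r|.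
  by apply: le_trans f1; rewrite ler_pM2l//; lra.
have f3 : (m2 * (m2 / 2)) ^+ 2 <= (4 * M ^+ 2 * `|r|) ^+ 2.
  by rewrite ler_pXn2r ?nnegrE ?mulr_ge0 ?sqr_ge0// ?divr_ge0// ltW.
have f4 : (4 * M ^+ 2 * `|r|) ^+ 2 <= (4 * M ^+ 2) ^+ 2 * (m2 * e).
  by rewrite exprMn ler_wpM2l ?sqr_ge0.
have f5 := le_trans f3 f4.
rewrite -(ler_pM2l m2_gt0).
have -> : m2 * m2 ^+ 3 = 4 * (m2 * (m2 / 2)) ^+ 2 by field.
have -> : m2 * (e * (64 * M ^+ 4)) = 4 * ((4 * M ^+ 2) ^+ 2 * (m2 * e)) by ring.
by rewrite ler_pM2l.
Qed.

End nonneg_square_roots.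

(** * Feasibility of the estimated correlation operator *)

Section correlation_operator.
Variables (R : realType) (p : nat) (H : 'I_p -> hilbertType R).
Implicit Types (A B C S T : hprod H -> hprod H) (f g : hprod H).

Definition hproj (i : 'I_p) f : hprod H := hinj (f i).

Lemma hproj_selfadjoint i : selfadjoint (hproj i).
Proof. by move=> f g; rewrite innerC !inner_hinj innerC. Qed.

Lemma hprojK i f : hproj i (hproj i f) = hproj i f.
Proof. by rewrite /hproj hinj_same. Qed.

Lemma hproj_hinj i (x : H i) : hproj i (hinj x) = hinj x.
Proof. by rewrite /hproj hinj_same. Qed.

Lemma dg_selfadjoint C : selfadjoint C -> selfadjoint (dg C).
Proof.
by move=> sC f g; rewrite !hprod_innerE; apply: eq_bigr => i _; exact: entry_adjoint.
Qed.

Lemma dg_hproj i C f : selfadjoint C -> dg C (hproj i f) = hproj i (dg C f).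
Proof.
move=> sC; apply: functional_extensionality_dep => k; rewrite /dg /hproj.
have [ki|ki] := eqVneq k i; first by subst k; rewrite !hinj_same.
by rewrite !hinj_neq// entry0.
Qed.

(* Uniqueness of nonnegative square roots, applied to [S] and to its conjugate by
   the reflection [1 - 2 P]. *)
Lemma nonneg_sqrt_commute S P (M : R) : 0 <= M -> nonneg_op S ->
  (forall f, `|S f| <= M * `|f|) -> selfadjoint P -> (forall f, P (P f) = P f) ->
  (forall f, S (S (P f)) = P (S (S f))) -> forall f, S (P f) = P (S f).
Proof.
move=> M0 nS SM sP PP SSP f; have [sS S0] := nS.
pose J g := g - 2 *: P g.
have JE g : J g = g - 2 *: P g by [].
have sJ : selfadjoint J.
  by move=> g h; rewrite /J innerBl innerBr innerZl innerZr sP.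
have JJ g : J (J g) = g.
  rewrite {1}/J [P (J g)](saB _ _ sP) (saZ _ _ sP) PP JE.
  rewrite -{2}[P g]scale1r -scalerBl scalerA -addrA -opprD -scalerDl.
  by rewrite (_ : 2 + 2 * (1 - 2) = 0 :> R) ?scale0r ?subr0//; ring.
have nJ g : `|J g| = `|g|.
  by apply/eqP; rewrite -(@eqrXn2 _ 2)// -!inner_norm sJ JJ.
have SSJ g : S (S (J g)) = J (S (S g)).
  by rewrite /J (saB _ _ sS) (saZ _ _ sS) (saB _ _ sS) (saZ _ _ sS) SSP.
have h : forall g, S g = J (S (J g)).
  apply: (@nonneg_sqrt_unique _ _ _ (fun g => J (S (J g))) M) => //.
  - split; first by move=> g k; rewrite !(sJ, sS).
    by move=> g; rewrite sJ.
  - by move=> g; rewrite nJ; apply: le_trans (SM _) _; rewrite nJ.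
  - by move=> g; rewrite JJ SSJ JJ.
have SJ : S (J f) = J (S f) by rewrite [S f]h JJ.
have : 2 *: S (P f) = 2 *: P (S f).
  by move: SJ; rewrite /J (saB _ _ sS) (saZ _ _ sS) => /addrI /oppr_inj.
by apply: scalerI; rewrite pnatr_eq0.
Qed.

Section corr0.
Variables (Chat : hprod H -> hprod H) (eps : R).
Hypotheses (nC : nonneg_op Chat) (eps0 : 0 < eps).

Let T f := eps *: f + dg Chat f.
Let S := inv_sqrt T.

Let sC : selfadjoint Chat := nC.1.

Lemma offdg_selfadjoint : selfadjoint (offdg Chat).
Proof. by move=> f g; rewrite innerBl innerBr sC (dg_selfadjoint sC). Qed.

(** If no root exists, [inv_sqrt] returns its default, the zero map, and [corr0] is 0. The
    properties below hold in that case as well, so the two cases are treated side by side. *)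
Lemma inv_sqrt_cases : S = (fun=> 0) \/
  [/\ linear S, continuous S, nonneg_op S, cancel T (S \o S) & cancel (S \o S) T].
Proof.
pose P := [set X | [/\ linear X, continuous X, nonneg_op X, cancel T (X \o X) &
  cancel (X \o X) T]].
have [PS|noP] := pselect (exists X, P X).
  by right; have : P S by exact: xgetPex.
by left; apply: xgetPN => X PX; apply: noP; exists X.
Qed.

Lemma corr0_selfadjoint : selfadjoint (corr0 eps Chat).
Proof.
rewrite /corr0 -/S; have [->|[_ _ [sS _] _ _]] := inv_sqrt_cases.
  by move=> f g; rewrite inner0l inner0r.
by move=> f g; rewrite /= sS offdg_selfadjoint sS.
Qed.

(** Writing [x = S T S x] gives [<x, x> + <R_0 x, x> = <(T + C_0) S x, S x>], and
    [T + C_0 = eps I + C]: the form is at least [eps |S x|^2]. *)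
Lemma corr0_posop : hilbert_schmidt (corr0 eps Chat) -> posop (corr0 eps Chat).
Proof.
move=> hR; have sR := corr0_selfadjoint.
have sa : sahs (corr0 eps Chat) by apply/sahsP.
split=> //; split=> // c [x x0 xE].
have nx : 0 < `|x| ^+ 2 by rewrite exprn_gt0// normr_gt0.
suff : 0 < inner x x + inner (corr0 eps Chat x) x.
  by rewrite xE innerZl inner_norm -[X in X + _]mul1r -mulrDl pmulr_lgt0//; lra.
rewrite /corr0 -/S; have [->|[_ _ [sS _] TSS SST]] := inv_sqrt_cases.
  by rewrite /= inner0l addr0 inner_norm.
(* [S] commutes with its square, the inverse of [T], and therefore with [T]. *)
have xS : x = S (T (S x)).
  have e1 : S (S (T x)) = x by exact: TSS.
  have e2 : T (S (S (S (T x)))) = S (T x) by exact: SST.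
  by rewrite -{1}e1 -{1}e2 e1.
have Sx0 : S x != 0.
  apply: contra x0 => /eqP Sx; have := SST x; rewrite /= Sx (sa0 sS) => <-.
  rewrite /T scaler0 add0r; apply/eqP.
  by apply: functional_extensionality_dep => i; rewrite /dg entry0.
rewrite {1}xS sS /= sS /T /offdg /= innerDl innerZl innerBl inner_norm.
have := nC.2 (S x); have : 0 < eps * `|S x| ^+ 2.
  by rewrite mulr_gt0// exprn_gt0// normr_gt0.
lra.
Qed.

(** [T] is block-diagonal and so commutes with each [hproj i]; its inverse [S^2] does too, hence so
    does the nonnegative root [S]. Being block-diagonal, [S] cannot create diagonal blocks in
    [S C_0 S]. *)
Lemma corr0_dg : dg (corr0 eps Chat) = (fun=> 0).
Proof.
apply/dg_eq0 => i x; rewrite /entry -/(hinj x) /corr0 -/S.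
have [->//|[lS cS nS TSS SST]] := inv_sqrt_cases.
have [sS _] := nS.
have [M M0 SM] := linear_continuous_bound lS cS.
have TP f : T (hproj i f) = hproj i (T f).
  rewrite /T (saD _ _ (hproj_selfadjoint i)) (saZ _ _ (hproj_selfadjoint i)).
  by rewrite dg_hproj.
have SP : forall f, S (hproj i f) = hproj i (S f).
  apply: (@nonneg_sqrt_commute _ _ M) => //; [exact: ltW|exact: hproj_selfadjoint|exact: hprojK|].
  by move=> f; rewrite -{1}[f]SST -TP [LHS]TSS.
rewrite /= -hproj_hinj SP /hproj.
set g := offdg Chat _.
have gi : g i = 0.
  have -> : g i = entry (offdg Chat) i i (S (hinj x) i) by [].
  by rewrite entry_offdg// eqxx.
have : hproj i (S g) = 0 by rewrite -SP /hproj gi hinj0 (sa0 sS).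
by move=> /(congr1 (fun f => f i)); rewrite /hproj hinj_same.
Qed.

End corr0.
End correlation_operator.

Theorem theorem1 (R : realType) (p : nat) (H : 'I_p -> hilbertType R)
    (Chat : hprod H -> hprod H) (eps lam : R) :
  (0 < p)%N ->
  (forall j, separable (H j)) ->
  linear Chat -> continuous Chat -> nonneg_op Chat ->
  0 < eps -> 0 < lam ->
  let R0 := corr0 eps Chat in
  hilbert_schmidt R0 ->
  let F := glasso lam R0 in
  let D := fun B => KLdiv (offdg B) in
  [/\ exists A, minimizer (@glasso_dom _ _ H) F A,
      exists B, minimizer (KLdiv_dom lam R0) D B,
      inf (F @` @glasso_dom _ _ H) = - 2 * inf (D @` KLdiv_dom lam R0) &
      forall A B, minimizer (@glasso_dom _ _ H) F A ->
        minimizer (KLdiv_dom lam R0) D B ->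
        cancel (idfun \+ offdg B) (idfun \+ A) /\
        cancel (idfun \+ A) (idfun \+ offdg B)].
Proof.
move=> _ _ _ _ nC eps0 lam0 R0 hR0 F D.
exact: (glasso_duality lam0 (corr0_posop nC eps0 hR0) (corr0_dg eps nC)).
Qed.
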